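(* Let $\Gamma$ be an infinite weighted graph (as in the context) satisfying $(D)$ and $(P_q)$ for some $1\le q<+\infty$, and let $q_0=\inf\{q\in[1,\infty):(P_q)\text{ holds}\}$. Let $q_0<p_1<p<p_2<+\infty$ and $$\alpha=\frac{\frac1{p_1}-\frac1p}{\frac1{p_1}-\frac1{p_2}}=\frac{p_2(p-p_1)}{p(p_2-p_1)}.$$ Then, for the complex interpolation method, $$\left[W^{1,p_1}(\Gamma),W^{1,p_2}(\Gamma)\right]_\alpha=W^{1,p}(\Gamma)$$ (with equivalent norms).
   Context: Graph. $\Gamma$ is an infinite set with a symmetric weight $h_{xy}=h_{yx}\ge0$, $h_{xx}=0$; $x\sim y$ means $h_{xy}>0$ or $x=y$; $h_x=\sup_{y\sim x}h_{xy}$. Standing assumptions: there is $N$ with $\#\{y:y\sim x\}\le N$ for all $x$; there is $C_W\ge1$ with $C_W^{-1}\le h_{xy}/h_{xz}\le C_W$ whenever $x\sim y$, $x\sim z$, $y\ne x$, $z\ne x$; $\Gamma$ is connected (any $x,y$ are joined by a finite path $x=x_0\sim x_1\sim\dots\sim x_n=y$, of length $\sum_k h_{x_kx_{k+1}}$); coefficients $\mu_{xy}=\mu_{yx}>0$ are given for $x\sim y$ (including $x=y$), with $\mu_{xy}/\mu_{xz}\le C_\mu$ whenever $x\sim y$, $x\sim z$. $d(x,y)$ is the infimum of the lengths of paths joining $x$ to $y$; $B(x,r)=\{y:d(x,y)<r\}$; $m(x)=\sum_{y\sim x}\mu_{xy}$, $m(A)=\sum_{x\in A}m(x)$, $V(x,r)=m(B(x,r))$.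 Function spaces (complex-valued functions). $\|f\|_{L^p(\Gamma)}=(\sum_x|f(x)|^pm(x))^{1/p}$. $\nabla f(x)=\frac1{h_x}\big(\sum_{y\sim x}|f(y)-f(x)|^2\big)^{1/2}$. $W^{1,p}(\Gamma)$: $\|f\|_{W^{1,p}}=\|f\|_{L^p}+\|\nabla f\|_{L^p}<\infty$. $(D)$: there is $C$ with $V(x,2r)\le CV(x,r)$ for all $x\in\Gamma$, $r>0$. $(P_q)$: there is $C$ with $\sum_{y\in B}|f(y)-f_B|^qm(y)\le Cr^q\sum_{y\in B}|\nabla f(y)|^qm(y)$ for all balls $B=B(x,r)$, $r>0$, and all functions $f$ on $\Gamma$, where $f_B=\frac1{m(B)}\sum_{y\in B}f(y)m(y)$. *)

(* Defs.v *)
From HB Require Import structures.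
From mathcomp Require Import all_boot all_order all_algebra.
From mathcomp Require Import complex.
From mathcomp Require Import all_classical all_reals all_analysis.

Set Implicit Arguments.
Unset Strict Implicit.
Unset Printing Implicit Defensive.

Import Order.TTheory GRing.Theory Num.Theory.
Import numFieldNormedType.Exports.
Import ComplexField.Normc.

Local Open Scope classical_set_scope.
Local Open Scope ring_scope.

(* A normed space continuously embedded in a vector space V over R[i] is given
   by its norm N : V -> \bar R, the space being { v | N v < +oo }.  A compatible
   couple is a pair of such norms on the same V.  The regular module R[i]^o,
   rather than R[i], carries the usual topology of the complex plane. *)
Section ComplexInterpolation.
Variables (R : realType) (V : lmodType R[i]).
Implicit Types (N : V -> \bar R) (F : R[i]^o -> V) (g : R -> V).

Definition normed_space N : set V := [set v | (N v < +oo)%E].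

Definition sum_norm N0 N1 (v : V) : \bar R :=
  ereal_inf [set (N0 u.1 + N1 u.2)%E | u in [set u : V * V | u.1 + u.2 = v]].

Definition strip : set R[i]^o := [set z | 0 <= complex.Re z <= 1].
Definition open_strip : set R[i]^o := [set z | 0 < complex.Re z < 1].

Definition vline (j : R) F : R -> V := fun t => F (Complex j t).

Record continuous_vanishing N g : Prop := {
  cv_fin : forall t, normed_space N (g t) ;
  cv_continuous : forall t, N (g s - g t) @[s --> t] --> 0%E ;
  cv_pinfty : N (g t) @[t --> +oo] --> 0%E ;
  cv_ninfty : N (g t) @[t --> -oo] --> 0%E }.

(* Membership in Calderon's space of analytic functions on the strip (with
   decay at infinity on the boundary lines). *)
Record calderon N0 N1 F : Prop := {
  cald_bounded : exists M : R,
    forall z, strip z -> (sum_norm N0 N1 (F z) <= M%:E)%E ;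
  cald_continuous : forall z, strip z ->
    sum_norm N0 N1 (F w - F z) @[w --> within strip (nbhs z)] --> 0%E ;
  cald_analytic : forall z, open_strip z ->
    exists2 L : V, normed_space (sum_norm N0 N1) L &
      sum_norm N0 N1 ((w - z)^-1 *: (F w - F z) - L) @[w --> z^'] --> 0%E ;
  cald_left : continuous_vanishing N0 (vline 0 F) ;
  cald_right : continuous_vanishing N1 (vline 1 F) }.

Definition calderon_norm N0 N1 F : \bar R :=
  maxe (ereal_sup (range (fun t => N0 (vline 0 F t))))
       (ereal_sup (range (fun t => N1 (vline 1 F t)))).

Definition interp_space N0 N1 (theta : R) : set V :=
  [set F (theta%:C)%C | F in calderon N0 N1].

Definition interp_norm N0 N1 (theta : R) (v : V) : \bar R :=
  ereal_inf [set calderon_norm N0 N1 F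
            | F in [set F | calderon N0 N1 F /\ F (theta%:C)%C = v]].

End ComplexInterpolation.

Section Adjacency.
Variables (R : realType) (T : choiceType) (h : T -> T -> R).

Definition adj : rel T := fun x y => (0 < h x y) || (x == y).

(* Length of the path x :: p. *)
Definition path_length (x : T) (p : seq T) : R := \sum_(l <- pairmap h x p) l.

End Adjacency.

Record weighted_graph (R : realType) := WeightedGraph {
  vertex :> choiceType ;
  wgh : vertex -> vertex -> R ;
  wgmu : vertex -> vertex -> R ;
  wg_infinite : infinite_set [set: vertex] ;
  wgh_sym : forall x y, wgh x y = wgh y x ;
  wgh_ge0 : forall x y, 0 <= wgh x y ;
  wgh_diag : forall x, wgh x x = 0 ;
  wg_degree : exists N : nat, forall x, ([set y | adj wgh x y] #<= `I_N)%card ;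
  wgh_ratio : exists2 CW : R, 1 <= CW &
    forall x y z, adj wgh x y -> adj wgh x z -> y != x -> z != x ->
      CW^-1 <= wgh x y / wgh x z <= CW ;
  wg_connected : forall x y, exists2 p : seq vertex,
    path (adj wgh) x p & last x p = y ;
  wgmu_sym : forall x y, adj wgh x y -> wgmu x y = wgmu y x ;
  wgmu_gt0 : forall x y, adj wgh x y -> 0 < wgmu x y ;
  wgmu_ratio : exists Cmu : R,
    forall x y z, adj wgh x y -> adj wgh x z -> wgmu x y / wgmu x z <= Cmu }.

Section Graph.
Variables (R : realType) (G : weighted_graph R).
Implicit Types (x y : G) (A : set G) (p q r : R) (f : G -> R[i]^o).

Definition nbrs x : set G := [set y | adj (@wgh R G) x y].

Definition hmax x : R := sup [set wgh x y | y in nbrs x].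

Definition gdist x y : R :=
  inf [set path_length (@wgh R G) x s
      | s in [set s | path (adj (@wgh R G)) x s /\ last x s = y]].

Definition gball x r : set G := [set y | gdist x y < r].

Definition mass x : R := \sum_(y \in nbrs x) wgmu x y.

(* Balls may be infinite sets, so the mass of a set is an extended real. *)
Definition massS A : \bar R := \esum_(x in A) (mass x)%:E.

Definition vol x r : \bar R := massS (gball x r).

Definition Lp_norm p (g : G -> R) : \bar R :=
  poweR (\esum_(x in [set: G]) (`|g x| `^ p * mass x)%:E) p^-1.

Definition grad f x : R :=
  (hmax x)^-1 * Num.sqrt (\sum_(y \in nbrs x) normc (f y - f x) ^+ 2).

Definition sobolev_norm p f : \bar R :=
  (Lp_norm p (fun x => normc (f x)) + Lp_norm p (grad f))%E.

Definition doubling : Prop := exists2 C : R, 0 < C &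
  forall x r, 0 < r -> (vol x (2 * r) <= C%:E * vol x r)%E.

(* Sum of an absolutely summable real family (meaningless otherwise). *)
Definition rsum A (g : G -> R) : R :=
  fine (\esum_(x in A) (g^\+ x)%:E) - fine (\esum_(x in A) (g^\- x)%:E).

Definition average A f : R[i]^o :=
  Complex ((fine (massS A))^-1 * rsum A (fun y => complex.Re (f y) * mass y))
          ((fine (massS A))^-1 * rsum A (fun y => complex.Im (f y) * mass y)).

(* On an infinite ball B some f are not summable and [average B f] is then a
   dummy value.  Under [doubling] this does not affect [poincare q] for
   q >= 1: applying the inequality to truncations of f shows that f is summable
   on B as soon as the right-hand side is finite. *)
Definition poincare q : Prop := exists2 C : R, 0 < C &
  forall x r f, 0 < r -> let B := gball x r in
    (\esum_(y in B) (normc (f y - average B f) `^ q * mass y)%:E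
      <= (C * r `^ q)%:E * \esum_(y in B) (grad f y `^ q * mass y)%:E)%E.

Definition poincare_threshold : R := inf [set q | 1 <= q /\ poincare q].

End Graph.

(* Main.v *)
Require Import Defs.
From mathcomp Require Import all_boot all_order all_algebra.
From mathcomp Require Import complex.
From mathcomp Require Import all_classical all_reals all_analysis.
From mathcomp Require Import ring lra.
Set Implicit Arguments.
Unset Strict Implicit.
Unset Printing Implicit Defensive.
Import Order.TTheory GRing.Theory Num.Theory.
Import numFieldNormedType.Exports.
Import ComplexField.Normc.
Local Open Scope classical_set_scope.
Local Open Scope ring_scope.

(* Write [D = max (|f|, grad f)] and let [O_k] be the set where the maximal
   function of [D ^ q] exceeds [2^(k q)], with [q < p1] such that (P_q) holds.
   By (P_q) and (D), [f] is Lipschitz with constant of order [2^k] and bounded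
   by [2^k] off [O_k]; extending from there (McShane) gives [g_k] with the same
   bounds, equal to [f] off [O_k].  Then [f] is the sum over all integers [k] of
   [u_k = g_(k+1) - g_k], where [u_k] and its gradient are at most of order
   [2^k] and live on [O_k] enlarged by its neighbours, and the weak type
   inequality gives [sum_k 2^(k p) m(O_k) <= C ||f||^p].  Hence
     [F z = sum_k exp (z^2 - alpha^2) 2^(k (s0 + (s1 - s0) z)) u_k]
   with [s0 = p / p1 - 1], [s1 = p / p2 - 1] belongs to Calderon's space, and
   [F alpha = f] since [s0 + (s1 - s0) alpha = 0].
   Conversely, if [F] belongs to Calderon's space, the three lines theorem is
   applied to finitely many values [F z x] and difference quotients
   [(F z y - F z x) / h_x]. *)

(** * Goursat's lemma on rectangles *)

(** Since [u_k] has size [2^k] on [O_k], the [p1]-th power of the norm of [2^(k s0) u_k] in W^{1,p1}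
    is of order [2^(k p) m(O_k)] because [p1 (1 + s0) = p], and likewise for [p2] and [s1]. A single
    sum thus controls both boundary lines. The sets [O_k] overlap, but at each vertex the sums over
    [k] are geometric, hence comparable to their largest term, and powers can be taken term by term.
    The factor [exp (z^2 - alpha^2)] provides the decay required on vertical lines. Analyticity in
    the sum norm is delicate: differentiation in [z] brings out factors [k]. They are absorbed
    because at an interior [z] the coefficients are smaller than the larger of the two boundary ones
    by a factor exponential in [|k|]. Conversely, vertices have positive mass, so evaluation at a
    vertex is continuous and scalar analytic functions suffice; difference quotients replace the
    gradient, which is not linear in [F]. The maximum principle is derived from Goursat's lemma in
    logarithmic coordinates around a point. *)

Section Goursat.
Variable R : realType.
Implicit Types (f g : R -> R) (a b c x t u : R).

Lemma in_sub_itv a b x x' t : a <= x -> x <= t <= x' -> x' <= b -> a <= t <= b.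
Proof. by move=> ax /andP[xt tx] xb; rewrite (le_trans ax xt) (le_trans tx xb). Qed.

Lemma dist_itv x x' t u : x <= t <= x' -> x <= u <= x' -> `|t - u| <= x' - x.
Proof. by move=> /andP[? ?] /andP[? ?]; rewrite ler_norml opprB !lerB. Qed.

Definition itv_int f a b : R := \int[lebesgue_measure]_(t in `[a, b]) f t.

Lemma itv_integrable f a b : {within `[a, b], continuous f} ->
  (@lebesgue_measure R).-integrable `[a, b] (EFin \o f).
Proof. by apply: continuous_compact_integrable; exact: segment_compact. Qed.

Lemma itv_int_split f a c b : a <= c -> c <= b ->
  {within `[a, b], continuous f} ->
  itv_int f a b = itv_int f a c + itv_int f c b.
Proof.
move=> ac cb cf.
have If := itv_integrable cf.
have := Rintegral_itvB If; rewrite /itv_int => /(_ c); rewrite !bnd_simp => /(_ ac cb).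
rewrite Rintegral_itv_obnd_cbnd; first by move=> <-; rewrite addrC subrK.
apply: integrableS If => //.
by apply: subset_itv; rewrite bnd_simp.
Qed.

Lemma itv_int_le_addr f g a b K : a <= b ->
  {within `[a, b], continuous f} -> {within `[a, b], continuous g} ->
  (forall t, a <= t <= b -> f t <= g t + K) ->
  itv_int f a b <= itv_int g a b + K * (b - a).
Proof.
move=> ab cf cg fg.
have Ic : (@lebesgue_measure R).-integrable `[a, b] (EFin \o cst K).
  by apply: itv_integrable; apply: continuous_subspaceT => ?; exact: cvg_cst.
have -> : K * (b - a) = \int[lebesgue_measure]_(t in `[a, b]) K.
  rewrite Rintegral_cst //=; have -> := lebesgue_measure_itv `[a, b]; rewrite /= lte_fin.
  by move: ab; rewrite le_eqVlt => /predU1P[->|->] //; rewrite ltxx /= subrr.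
rewrite /itv_int -RintegralD //; last exact: itv_integrable.
apply: le_Rintegral => //.
- exact: itv_integrable.
- by apply: itv_integrable => t; apply: cvgD; [exact: cg | exact: cvg_cst].
Qed.

Lemma itv_int_dist f g a b K e : a <= b ->
  {within `[a, b], continuous f} -> {within `[a, b], continuous g} ->
  (forall t, a <= t <= b -> `|f t - g t - K| <= e) ->
  `|itv_int f a b - itv_int g a b - K * (b - a)| <= e * (b - a).
Proof.
move=> ab cf cg fg.
have := @itv_int_le_addr f g a b (K + e) ab cf cg.
have := @itv_int_le_addr g f a b (e - K) ab cg cf.
move=> H1 H2.
have {}H1 : itv_int g a b <= itv_int f a b + (e - K) * (b - a).
  by apply: H1 => t /fg; rewrite ler_norml; lra.
have {}H2 : itv_int f a b <= itv_int g a b + (K + e) * (b - a).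
  by apply: H2 => t /fg; rewrite ler_norml; lra.
by rewrite ler_norml; lra.
Qed.

Implicit Types (P Q : R -> R -> R) (d e r : R).

(* [P + i Q] has derivative [A + i B] at [x0 + i y0], relatively to the rectangle. *)
Definition cauchy_riemann P Q a b c d := forall x0 y0, a <= x0 <= b -> c <= y0 <= d ->
  exists A B : R, forall e : R, 0 < e -> exists2 r : R, 0 < r &
  forall x y, a <= x <= b -> c <= y <= d -> `|x - x0| <= r -> `|y - y0| <= r ->
    `|P x y - P x0 y0 - (A * (x - x0) - B * (y - y0))| <= e * (`|x - x0| + `|y - y0|) /\
    `|Q x y - Q x0 y0 - (B * (x - x0) + A * (y - y0))| <= e * (`|x - x0| + `|y - y0|).

Lemma cauchy_riemann_cvg P Q a b c d x0 y0 : cauchy_riemann P Q a b c d -> a <= x0 <= b -> c <= y0 <= d ->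
  forall e : R, 0 < e -> exists2 r : R, 0 < r &
  forall x y, a <= x <= b -> c <= y <= d -> `|x - x0| <= r -> `|y - y0| <= r ->
    `|P x y - P x0 y0| <= e /\ `|Q x y - Q x0 y0| <= e.
Proof.
move=> CR hx hy; have [A [B AB]] := CR _ _ hx hy.
move=> e e0; have [r r0 hr] := AB 1 ltr01.
have K0 : 0 < 2 * (1 + `|A| + `|B|).
  by apply: mulr_gt0 => //; have := normr_ge0 A; have := normr_ge0 B; lra.
exists (Num.min r (e / (2 * (1 + `|A| + `|B|)))).
  by rewrite lt_min r0 divr_gt0.
move=> x y xab ycd; rewrite !le_min => /andP[xr xe] /andP[yr ye].
have [h1 h2] := hr x y xab ycd xr yr.
have xye : (1 + `|A| + `|B|) * (`|x - x0| + `|y - y0|) <= e.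
  have h : `|x - x0| + `|y - y0| <= e / (1 + `|A| + `|B|).
    have -> : e / (1 + `|A| + `|B|) = e / (2 * (1 + `|A| + `|B|)) + e / (2 * (1 + `|A| + `|B|)).
      by field; apply/eqP; move: K0; lra.
    exact: lerD.
  apply: le_trans (ler_wpM2l _ h) _; first by move: K0; clear; lra.
  by rewrite mulrC divfK //; apply/eqP; move: K0; lra.
have hA1 := ler_norm (A * (x - x0)); have hA2 := ler_norm (- (A * (x - x0))).
have hB1 := ler_norm (B * (x - x0)); have hB2 := ler_norm (- (B * (x - x0))).
have hC1 := ler_norm (A * (y - y0)); have hC2 := ler_norm (- (A * (y - y0))).
have hD1 := ler_norm (B * (y - y0)); have hD2 := ler_norm (- (B * (y - y0))).
rewrite !normrN !normrM in hA1 hA2 hB1 hB2 hC1 hC2 hD1 hD2.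
have p1 := mulr_ge0 (normr_ge0 A) (normr_ge0 (y - y0)).
have p2 := mulr_ge0 (normr_ge0 B) (normr_ge0 (x - x0)).
have p3 := mulr_ge0 (normr_ge0 A) (normr_ge0 (x - x0)).
have p4 := mulr_ge0 (normr_ge0 B) (normr_ge0 (y - y0)).
by move: h1 h2 hA1 hA2 hB1 hB2 hC1 hC2 hD1 hD2 p1 p2 p3 p4 xye; rewrite !ler_norml !mul1r; clear; split; lra.
Qed.

Lemma within_itvP f a' b' : (forall x0, a' <= x0 <= b' ->
    forall e : R, 0 < e -> exists2 r : R, 0 < r &
    forall x, a' <= x <= b' -> `|x - x0| <= r -> `|f x - f x0| <= e) ->
  {within `[a', b'], continuous f}.
Proof.
move=> H; apply/subspace_continuousP => x0 /=; rewrite in_itv /= => hx0.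
apply/cvgrPdist_le => e e0; have [r r0 hr] := H x0 hx0 e e0.
apply/nbhs_ballP; exists r => //= x; rewrite /ball /= => xr; rewrite in_itv /= => xab.
by rewrite distrC; apply: hr => //; rewrite distrC ltW.
Qed.

Lemma continuous_P_vert P Q a b c d x a' b' : cauchy_riemann P Q a b c d ->
  a <= x <= b -> c <= a' -> b' <= d ->
  {within `[a', b'], continuous (P x)}.
Proof.
move=> CR xab ca bd; apply: within_itvP => y0 hy e e0.
have y0cd : c <= y0 <= d by lra.
have [r r0 hr] := cauchy_riemann_cvg CR xab y0cd e0.
exists r => // y hy' yr; have [] // := hr x y xab _ _ yr; first by lra.
by rewrite subrr normr0 ltW.
Qed.

Lemma continuous_Q_hor P Q a b c d y a' b' : cauchy_riemann P Q a b c d ->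
  c <= y <= d -> a <= a' -> b' <= b ->
  {within `[a', b'], continuous (Q ^~ y)}.
Proof.
move=> CR ycd aa bb; apply: within_itvP => x0 hx e e0.
have x0ab : a <= x0 <= b by lra.
have [r r0 hr] := cauchy_riemann_cvg CR x0ab ycd e0.
exists r => // x hx' xr; have [] // := hr x y _ ycd xr _; first by lra.
by rewrite subrr normr0 ltW.
Qed.

(* The circulation of [Q dx + P dy] around [x, x'] x [y, y']. *)
Definition circ P Q x x' y y' :=
  (itv_int (Q ^~ y) x x' - itv_int (Q ^~ y') x x') +
  (itv_int (P x') y y' - itv_int (P x) y y').

Lemma circ_splitx P Q a b c d x z x' y y' : cauchy_riemann P Q a b c d ->
  a <= x -> x <= z -> z <= x' -> x' <= b ->
  c <= y <= d -> c <= y' <= d ->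
  circ P Q x x' y y' = circ P Q x z y y' + circ P Q z x' y y'.
Proof.
move=> CR ax xz zx xb yd yd'; rewrite /circ.
rewrite (@itv_int_split (Q ^~ y) x z x') // ?(@itv_int_split (Q ^~ y') x z x') //.
- lra.
- exact: continuous_Q_hor CR _ _ _.
- exact: continuous_Q_hor CR _ _ _.
Qed.

Lemma circ_splity P Q a b c d x x' y z y' : cauchy_riemann P Q a b c d ->
  c <= y -> y <= z -> z <= y' -> y' <= d ->
  a <= x <= b -> a <= x' <= b ->
  circ P Q x x' y y' = circ P Q x x' y z + circ P Q x x' z y'.
Proof.
move=> CR ax xz zx xb yd yd'; rewrite /circ.
rewrite (@itv_int_split (P x) y z y') // ?(@itv_int_split (P x') y z y') //.
- lra.
- exact: continuous_P_vert CR _ _ _.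
- exact: continuous_P_vert CR _ _ _.
Qed.

(** The affine part of [P + i Q] has no circulation: its contributions [- A * h * w] and [A * w * h]
    cancel. The remainder is at most [e / 2 * (w + h)] on each of the four sides. *)
Lemma circ_local P Q a b c d x0 y0 : cauchy_riemann P Q a b c d ->
  a <= x0 <= b -> c <= y0 <= d ->
  forall e : R, 0 < e -> exists2 r : R, 0 < r &
  forall x x' y y', a <= x -> x <= x0 <= x' -> x' <= b ->
    c <= y -> y <= y0 <= y' -> y' <= d -> x' - x <= r -> y' - y <= r ->
    `|circ P Q x x' y y'| <= e * (x' - x + (y' - y)) ^+ 2.
Proof.
move=> CR hx hy e e0; have [A [B AB]] := CR _ _ hx hy.
have e2 : 0 < e / 2 by rewrite divr_gt0.
have [r r0 hr] := AB _ e2; exists r => // x x' y y' ax xx xb cy yy yd xr yr.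
set w := x' - x; set h := y' - y.
have xx' : x <= x' by case/andP: xx; exact: le_trans.
have yy' : y <= y' by case/andP: yy; exact: le_trans.
have iy : y <= y <= y' by rewrite lexx.
have iy' : y <= y' <= y' by rewrite lexx andbT.
have ix : x <= x <= x' by rewrite lexx.
have ix' : x <= x' <= x' by rewrite lexx andbT.
have near t s : x <= t <= x' -> y <= s <= y' ->
    `|P t s - P x0 y0 - (A * (t - x0) - B * (s - y0))| <= e / 2 * (w + h) /\
    `|Q t s - Q x0 y0 - (B * (t - x0) + A * (s - y0))| <= e / 2 * (w + h).
  move=> ht hs.
  have t0 := dist_itv ht xx; have s0 := dist_itv hs yy.
  have [k1 k2] := hr t s (in_sub_itv ax ht xb) (in_sub_itv cy hs yd) (le_trans t0 xr) (le_trans s0 yr).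
  by split; [apply: le_trans k1 _ | apply: le_trans k2 _]; apply: ler_wpM2l;
    rewrite ?(ltW e2) // lerD.
have H1 : `|itv_int (Q ^~ y) x x' - itv_int (Q ^~ y') x x' - (- (A * h)) * (x' - x)|
     <= e * (w + h) * (x' - x).
  apply: itv_int_dist => //.
  - by apply: (continuous_Q_hor CR) => //; exact: in_sub_itv cy iy yd.
  - by apply: (continuous_Q_hor CR) => //; exact: in_sub_itv cy iy' yd.
  move=> t ht; have [_ k1] := near t y ht iy; have [_ k2] := near t y' ht iy'.
  by move: k1 k2; rewrite !ler_norml /h; clear; lra.
have H2 : `|itv_int (P x') y y' - itv_int (P x) y y' - (A * w) * (y' - y)|
     <= e * (w + h) * (y' - y).
  apply: itv_int_dist => //.
  - by apply: (continuous_P_vert CR) => //; exact: in_sub_itv ax ix' xb.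
  - by apply: (continuous_P_vert CR) => //; exact: in_sub_itv ax ix xb.
  move=> t ht; have [k1 _] := near x t ix ht; have [k2 _] := near x' t ix' ht.
  by move: k1 k2; rewrite !ler_norml /w; clear; lra.
have -> : e * (w + h) ^+ 2 = e * (w + h) * (x' - x) + e * (w + h) * (y' - y).
  by rewrite -/w -/h; ring.
clear near; rewrite /circ; move: H1 H2; rewrite -/w -/h.
have := ler_normD (itv_int (Q^~ y) x x' - itv_int (Q^~ y') x x' - - (A * h) * w)
  (itv_int (P x') y y' - itv_int (P x) y y' - A * w * h).
set u := itv_int _ _ _ - itv_int _ _ _; set v := itv_int _ _ _ - itv_int _ _ _.
have -> : u - - (A * h) * w + (v - A * w * h) = u + v by ring.
by clear; lra.
Qed.

(** All rectangles of generation [n] have the same sides, so the lower left corner [z] alone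
    determines one; [corner] says that it lies in the initial rectangle. *)
Definition corner a b c d (n : nat) (z : R * R) :=
  [&& a <= z.1, z.1 + (b - a) / 2 ^+ n <= b, c <= z.2 & z.2 + (d - c) / 2 ^+ n <= d].
Definition subcirc P Q a b c d n (z : R * R) :=
  circ P Q z.1 (z.1 + (b - a) / 2 ^+ n) z.2 (z.2 + (d - c) / 2 ^+ n).

Lemma circ_quarter P Q a b c d n z (CR : cauchy_riemann P Q a b c d) (ab : a <= b) (cd : c <= d) (Psi := subcirc P Q a b c d) :
  corner a b c d n z -> exists z' : R * R, [/\ corner a b c d n.+1 z',
   z.1 <= z'.1, z'.1 + (b - a) / 2 ^+ n.+1 <= z.1 + (b - a) / 2 ^+ n,
   z.2 <= z'.2 /\ z'.2 + (d - c) / 2 ^+ n.+1 <= z.2 + (d - c) / 2 ^+ n &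
   `|Psi n z| <= 4 * `|Psi n.+1 z'|].
Proof.
case: z => x y /and4P[/= ax xb cy yd].
set w := (b - a) / 2 ^+ n.+1; set h := (d - c) / 2 ^+ n.+1.
have w0 : 0 <= w by rewrite divr_ge0 ?exprn_ge0 // subr_ge0.
have h0 : 0 <= h by rewrite divr_ge0 ?exprn_ge0 // subr_ge0.
have n0 : (2 : R) ^+ n != 0 by rewrite expf_neq0.
have wE : (b - a) / 2 ^+ n = w + w by rewrite /w exprS; field.
have hE : (d - c) / 2 ^+ n = h + h by rewrite /h exprS; field.
rewrite wE hE in xb yd *.
have xw : x <= x + w by rewrite lerDl.
have xww : x + w <= x + (w + w) by rewrite lerD2l lerDl.
have yh : y <= y + h by rewrite lerDl.
have yhh : y + h <= y + (h + h) by rewrite lerD2l lerDl.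
have axw := le_trans ax xw; have xwb := le_trans xww xb.
have cyh := le_trans cy yh; have yhd := le_trans yhh yd.
have E : Psi n (x, y) = (Psi n.+1 (x, y) + Psi n.+1 (x, y + h)) +
    (Psi n.+1 (x + w, y) + Psi n.+1 (x + w, y + h)).
  rewrite /Psi /subcirc /= -/w -/h wE hE -!(addrA x) -!(addrA y).
  have iy : c <= y <= d by rewrite cy (le_trans yh).
  have iyh : c <= y + (h + h) <= d by rewrite yd andbT (le_trans cyh).
  have ix : a <= x <= b by rewrite ax (le_trans xw).
  have ixw : a <= x + w <= b by rewrite axw xwb.
  have ixww : a <= x + (w + w) <= b by rewrite xb andbT (le_trans axw).
  rewrite (@circ_splitx _ _ a b c d x (x + w)) //.
  rewrite (@circ_splity _ _ a b c d x (x + w) y (y + h)) //.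
  rewrite (@circ_splity _ _ a b c d (x + w) (x + (w + w)) y (y + h)) //.
have [H1|H1] := leP `|Psi n (x, y)| (4 * `|Psi n.+1 (x, y)|).
  exists (x, y); rewrite /corner /= -/w -/h ax cy xwb yhd.
  by split.
have [H2|H2] := leP `|Psi n (x, y)| (4 * `|Psi n.+1 (x, y + h)|).
  by exists (x, y + h); rewrite /corner /= -/w -/h ax cyh xwb -addrA yd; split => //; rewrite lerD2l lerDl.
have [H3|H3] := leP `|Psi n (x, y)| (4 * `|Psi n.+1 (x + w, y)|).
  by exists (x + w, y); rewrite /corner /= -/w -/h axw cy -addrA xb yhd; split => //; rewrite lerD2l lerDl.
exists (x + w, y + h); rewrite /corner /= -/w -/h axw cyh -!addrA xb yd; split => //.
move: H1 H2 H3; rewrite E.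
have := ler_normD (Psi n.+1 (x, y) + Psi n.+1 (x, y + h)) (Psi n.+1 (x + w, y) + Psi n.+1 (x + w, y + h)).
have := ler_normD (Psi n.+1 (x, y)) (Psi n.+1 (x, y + h)).
have := ler_normD (Psi n.+1 (x + w, y)) (Psi n.+1 (x + w, y + h)).
by clear; lra.
Qed.

(** Quartering: some quarter keeps at least a quarter of the circulation, so the initial one is at
    most [4 ^+ n] times that of the [n]-th rectangle. By [circ_local] at the common point of the
    rectangles, the latter is at most a small constant times [(L / 2 ^+ n) ^+ 2], and the powers of
    4 cancel. *)
Lemma goursat P Q a b c d : a <= b -> c <= d -> cauchy_riemann P Q a b c d ->
  circ P Q a b c d = 0.
Proof.
move=> ab cd CR; set Psi := subcirc P Q a b c d.
(* The value [z] in the other case is a dummy: [Hc] shows that every corner of the sequence is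
   admissible. *)
pose next n z := if pselect (corner a b c d n z) is left h
  then projT1 (cid (circ_quarter CR ab cd h)) else z.
pose fix seqz n := if n is m.+1 then next m (seqz m) else (a, c).
have Hc n : corner a b c d n (seqz n).
  elim: n => [|n IH] /=; first by rewrite /corner /= expr0 !divr1 !subrKC !lexx.
  by rewrite /next; case: pselect => // h; case: cid => z' [].
have Hn n : [/\ (seqz n).1 <= (seqz n.+1).1,
   (seqz n.+1).1 + (b - a) / 2 ^+ n.+1 <= (seqz n).1 + (b - a) / 2 ^+ n,
   (seqz n).2 <= (seqz n.+1).2 /\ (seqz n.+1).2 + (d - c) / 2 ^+ n.+1 <= (seqz n).2 + (d - c) / 2 ^+ n &
   `|Psi n (seqz n)| <= 4 * `|Psi n.+1 (seqz n.+1)|].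
  by rewrite /= /next; case: pselect => [h|/(_ (Hc n))//]; case: cid => z' [].
have nested (v : R) (s : nat -> R) : 0 <= v -> (forall n, s n <= s n.+1) ->
    (forall n, s n.+1 + v / 2 ^+ n.+1 <= s n + v / 2 ^+ n) ->
    exists X, forall n, s n <= X <= s n + v / 2 ^+ n.
  move=> v0 s1 s2.
  have v0n n : 0 <= v / 2 ^+ n by rewrite divr_ge0 // exprn_ge0.
  have m1 : {homo s : n m / (n <= m)%N >-> n <= m} by apply: homo_leq => // ? ? ?; exact: le_trans.
  have m2 n m : (n <= m)%N -> s m + v / 2 ^+ m <= s n + v / 2 ^+ n.
    elim: m => [|m IH]; first by rewrite leqn0 => /eqP ->.
    by rewrite leq_eqVlt => /predU1P[<-//|]; rewrite ltnS => /IH; apply: le_trans.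
  have ub m : ubound (range s) (s m + v / 2 ^+ m).
    move=> _ [n _ <-]; have [nm|mn] := leP n m.
      by apply: le_trans (m1 _ _ nm) _; rewrite lerDl.
    by apply: le_trans _ (m2 m n (ltnW mn)); rewrite lerDl.
  exists (sup (range s)) => n; apply/andP; split.
    by apply: sup_upper_bound; [split; [exists (s 0%N), 0%N|exists (s 0%N + v / 2 ^+ 0); exact: ub]|exists n].
  by apply: ge_sup; [exists (s 0%N), 0%N|exact: ub].
have [X HX] : exists X, forall n, (seqz n).1 <= X <= (seqz n).1 + (b - a) / 2 ^+ n.
  by apply: nested; rewrite ?subr_ge0 // => n; case: (Hn n).
have [Y HY] : exists Y, forall n, (seqz n).2 <= Y <= (seqz n).2 + (d - c) / 2 ^+ n.
  by apply: nested; rewrite ?subr_ge0 // => n; case: (Hn n) => ? ? [].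
have Hpsi n : `|circ P Q a b c d| <= 4 ^+ n * `|Psi n (seqz n)|.
  elim: n => [|n IH].
    by rewrite /Psi /subcirc /= expr0 mul1r !divr1 !subrKC.
  apply: le_trans IH _; rewrite exprSr -mulrA; apply: ler_wpM2l; first exact: exprn_ge0.
  by case: (Hn n).
have hX : a <= X <= b by have := HX 0%N; rewrite /= expr0 divr1 subrKC.
have hY : c <= Y <= d by have := HY 0%N; rewrite /= expr0 divr1 subrKC.
set L := b - a + (d - c).
have L0 : 0 <= L by rewrite /L addr_ge0 // subr_ge0.
apply/eqP; rewrite -normr_le0; apply/ler_addgt0Pr => e e0; rewrite add0r.
have L1 : 0 < L + 1 by rewrite ltr_wpDl.
have e1 : 0 < e / (L + 1) ^+ 2 by rewrite divr_gt0 // exprn_gt0.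
have [r r0 hr] := circ_local CR hX hY e1.
have [n hn] : exists n : nat, L / 2 ^+ n <= r.
  exists (Num.bound (L / r)).
  rewrite ler_pdivrMr ?exprn_gt0 // mulrC -ler_pdivrMr //.
  apply: le_trans (ltW (archi_boundP (divr_ge0 L0 (ltW r0)))) _.
  by rewrite -natrX ler_nat ltnW // ltn_expl.
have wn0 : 0 <= (b - a) / 2 ^+ n by rewrite divr_ge0 ?exprn_ge0 // subr_ge0.
have hn0 : 0 <= (d - c) / 2 ^+ n by rewrite divr_ge0 ?exprn_ge0 // subr_ge0.
have LE : L / 2 ^+ n = (b - a) / 2 ^+ n + (d - c) / 2 ^+ n by rewrite /L mulrDl.
have /and4P[c1 c2 c3 c4] := Hc n.
have := hr (seqz n).1 ((seqz n).1 + (b - a) / 2 ^+ n) (seqz n).2 ((seqz n).2 + (d - c) / 2 ^+ n)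
   c1 (HX n) c2 c3 (HY n) c4.
have addKr (u v : R) : u + v - u = v by ring.
rewrite !addKr -LE.
have -> : (b - a) / 2 ^+ n <= r by apply: le_trans hn; rewrite LE lerDl.
have -> : (d - c) / 2 ^+ n <= r by apply: le_trans hn; rewrite LE lerDr.
move=> /(_ isT isT); rewrite -/(subcirc P Q a b c d n (seqz n)) -/Psi => h.
apply: le_trans (Hpsi n) _; apply: le_trans (ler_wpM2l _ h) _; first exact: exprn_ge0.
have n0 : (2 : R) ^+ n != 0 by rewrite expf_neq0.
have -> : 4 ^+ n * (e / (L + 1) ^+ 2 * (L / 2 ^+ n) ^+ 2) = e * (L / (L + 1)) ^+ 2.
  have -> : (4 : R) ^+ n = 2 ^+ n * 2 ^+ n by rewrite -exprMn; congr (_ ^+ _); ring.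
  by field; rewrite n0 /= gt_eqF.
rewrite ger_pMr // expr_le1 //.
  by rewrite ler_pdivrMr // mul1r lerDl.
by rewrite divr_ge0 // ltW.
Qed.

End Goursat.

(** * Analytic functions and the maximum principle on the strip *)

Section ComplexPlane.
Variable R : realType.
Implicit Types (z w : R[i]) (f g h : R[i] -> R[i]) (S : set R[i]) (a b e d : R).

Lemma cnormE a b : normc (Complex a b) = Num.sqrt (a ^+ 2 + b ^+ 2).
Proof. by []. Qed.

Lemma cnorm_sqr z : normc z ^+ 2 = complex.Re z ^+ 2 + complex.Im z ^+ 2.
Proof. by case: z => a b; rewrite cnormE sqr_sqrtr // addr_ge0 // sqr_ge0. Qed.

Lemma cnorm_ge0 z : 0 <= normc z.
Proof. by case: z => a b; exact: sqrtr_ge0. Qed.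

Lemma cnormD (x y : R[i]) : normc (x + y) <= normc x + normc y.
Proof. exact: le_normcD. Qed.

Lemma cnormM (x y : R[i]) : normc (x * y) = normc x * normc y.
Proof. exact: normcM. Qed.

Lemma cnormN (x : R[i]) : normc (- x) = normc x.
Proof. exact: normcN. Qed.

Lemma cnormB (x y : R[i]) : normc (x - y) <= normc x + normc y.
Proof. by rewrite -(cnormN y); exact: cnormD. Qed.

Lemma cdistC (x y : R[i]) : normc (x - y) = normc (y - x).
Proof. by rewrite -cnormN opprB. Qed.

Lemma cnorm0 : normc (0 : R[i]) = 0.
Proof. exact: normc0. Qed.

Lemma cnorm_eq0 (x : R[i]) : (normc x == 0) = (x == 0).
Proof. by apply/eqP/eqP => [/eq0_normc//|->]; exact: cnorm0. Qed.

Lemma cnorm_dist (x y : R[i]) : `|normc x - normc y| <= normc (x - y).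
Proof.
have h1 : normc x <= normc (x - y) + normc y by rewrite -{1}(subrK y x) cnormD.
have h2 : normc y <= normc (x - y) + normc x by rewrite cdistC -{1}(subrK x y) cnormD.
by rewrite ler_norml; lra.
Qed.

Lemma cnorm_real a : normc (a%:C)%C = `|a|.
Proof. by rewrite cnormE expr0n addr0 sqrtr_sqr. Qed.

Lemma cnormZ a z : normc ((a%:C)%C * z) = `|a| * normc z.
Proof. by rewrite cnormM cnorm_real. Qed.

Lemma abs_Re_le z : `|complex.Re z| <= normc z.
Proof.
case: z => a b; rewrite cnormE -sqrtr_sqr ler_wsqrtr // lerDl; exact: sqr_ge0.
Qed.

Lemma abs_Im_le z : `|complex.Im z| <= normc z.
Proof.
case: z => a b; rewrite cnormE -sqrtr_sqr ler_wsqrtr // lerDr; exact: sqr_ge0.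
Qed.

Lemma cnorm_le_abs z : normc z <= `|complex.Re z| + `|complex.Im z|.
Proof.
case: z => a b; rewrite cnormE /= -[leRHS]ger0_norm ?addr_ge0 // -sqrtr_sqr.
rewrite ler_wsqrtr // sqrrD !real_normK ?num_real // lerD2r lerDl.
by rewrite mulrn_wge0 // mulr_ge0.
Qed.

Lemma ReB (x y : R[i]) : complex.Re (x - y) = complex.Re x - complex.Re y.
Proof. by case: x y => ? ? [? ?]. Qed.

Lemma ImB (x y : R[i]) : complex.Im (x - y) = complex.Im x - complex.Im y.
Proof. by case: x y => ? ? [? ?]. Qed.

Lemma ReD (x y : R[i]) : complex.Re (x + y) = complex.Re x + complex.Re y.
Proof. by case: x y => ? ? [? ?]. Qed.

Lemma ImD (x y : R[i]) : complex.Im (x + y) = complex.Im x + complex.Im y.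
Proof. by case: x y => ? ? [? ?]. Qed.

Lemma ReM (x y : R[i]) : complex.Re (x * y) = complex.Re x * complex.Re y - complex.Im x * complex.Im y.
Proof. by case: x y => ? ? [? ?]. Qed.

Lemma ImM (x y : R[i]) : complex.Im (x * y) = complex.Re x * complex.Im y + complex.Im x * complex.Re y.
Proof. by case: x y => ? ? [? ?]. Qed.

Definition ccont S f z := forall e, 0 < e -> exists2 d : R, 0 < d &
  forall w, S w -> normc (w - z) <= d -> normc (f w - f z) <= e.

(* Caratheodory's form: the slope of [f] at [z] extends continuously to [z]. *)
Definition cdiff f z := exists2 g, ccont setT g z &
  forall w, f w - f z = g w * (w - z).

Lemma ccontS S S' f z : S `<=` S' -> ccont S' f z -> ccont S f z.
Proof.
by move=> SS H e e0; have [d d0 hd] := H e e0; exists d => // w /SS; exact: hd.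
Qed.

Lemma ccont_cst S c z : ccont S (fun _ => c) z.
Proof. by move=> e e0; exists 1 => // w _ _; rewrite subrr cnorm0 ltW. Qed.

Lemma ccont_id S z : ccont S id z.
Proof. by move=> e e0; exists e. Qed.

Lemma ccont_bounded S f z : ccont S f z -> exists2 d, 0 < d &
  forall w, S w -> normc (w - z) <= d -> normc (f w) <= normc (f z) + 1.
Proof.
move=> /(_ 1 ltr01)[d d0 hd]; exists d => // w Sw wd.
by have := hd w Sw wd; have := cnorm_dist (f w) (f z); rewrite ler_norml; lra.
Qed.

Lemma ccontD S f g z : ccont S f z -> ccont S g z -> ccont S (fun w => f w + g w) z.
Proof.
move=> cf cg e e0; have e2 : 0 < e / 2 by rewrite divr_gt0.
have [d1 d10 h1] := cf _ e2; have [d2 d20 h2] := cg _ e2.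
exists (Num.min d1 d2); first by rewrite lt_min d10.
move=> w Sw; rewrite le_min => /andP[/(h1 w Sw) k1 /(h2 w Sw) k2].
by rewrite opprD addrACA (le_trans (cnormD _ _)) // [leRHS]splitr lerD.
Qed.

Lemma ccontM S f g z : ccont S f z -> ccont S g z -> ccont S (fun w => f w * g w) z.
Proof.
move=> cf cg e e0.
have K0 : 0 < normc (f z) + normc (g z) + 1.
  by have := cnorm_ge0 (f z); have := cnorm_ge0 (g z); lra.
set K := _ + 1 in K0.
have e2 : 0 < e / (2 * K) by rewrite divr_gt0 // mulr_gt0.
have [d1 d10 h1] := cf _ e2; have [d2 d20 h2] := cg _ e2.
have [d3 d30 h3] := ccont_bounded cf.
exists (Num.min (Num.min d1 d2) d3); first by rewrite !lt_min d10 d20.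
move=> w Sw; rewrite !le_min => /andP[/andP[/(h1 w Sw) k1 /(h2 w Sw) k2] /(h3 w Sw) k3].
have -> : f w * g w - f z * g z = f w * (g w - g z) + (f w - f z) * g z by ring.
rewrite (le_trans (cnormD _ _)) // !cnormM.
have -> : e = K * (e / (2 * K)) + e / (2 * K) * K.
  by field; rewrite gt_eqF.
apply: lerD; apply: ler_pM; rewrite ?cnorm_ge0 //.
- by apply: le_trans k3 _; rewrite /K; have := cnorm_ge0 (g z); lra.
- by rewrite /K; have := cnorm_ge0 (f z); lra.
Qed.

Lemma ccont_comp f g z : ccont setT g z -> ccont setT f (g z) ->
  ccont setT (fun w => f (g w)) z.
Proof.
move=> cg cf e /cf[d d0 hd]; have [r r0 hr] := cg d d0.
by exists r => // w _ /(hr w I) /hd; exact.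
Qed.

Lemma cdiff_ccont f z : cdiff f z -> ccont setT f z.
Proof.
move=> [g cg fg].
have : ccont setT (fun w => f z + g w * (w - z)) z.
  apply: ccontD; first exact: ccont_cst.
  by apply: ccontM => //; apply: ccontD; [exact: ccont_id|exact: ccont_cst].
by congr ccont; apply/funext => w; rewrite -fg subrKC.
Qed.

Lemma cdiff_cst c z : cdiff (fun _ => c) z.
Proof.
by exists (fun _ => 0); [exact: ccont_cst | move=> w; rewrite mul0r subrr].
Qed.

Lemma cdiff_id z : cdiff id z.
Proof.
by exists (fun _ => 1); [exact: ccont_cst | move=> w; rewrite mul1r].
Qed.

Lemma cdiffD f g z : cdiff f z -> cdiff g z -> cdiff (fun w => f w + g w) z.
Proof.
move=> [f' cf hf] [g' cg hg]; exists (fun w => f' w + g' w); first exact: ccontD.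
by move=> w; rewrite mulrDl -hf -hg; ring.
Qed.

Lemma cdiffM f g z : cdiff f z -> cdiff g z -> cdiff (fun w => f w * g w) z.
Proof.
move=> df dg; have cg := cdiff_ccont dg; move: df dg => [f' cf' hf] [g' cg' hg].
exists (fun w => f' w * g w + f z * g' w).
  apply: ccontD; first exact: ccontM.
  by apply: ccontM => //; exact: ccont_cst.
move=> w; have -> : (f' w * g w + f z * g' w) * (w - z) =
   (f' w * (w - z)) * g w + f z * (g' w * (w - z)) by ring.
by rewrite -hf -hg; ring.
Qed.

Lemma cdiff_comp f g z : cdiff g z -> cdiff f (g z) -> cdiff (fun w => f (g w)) z.
Proof.
move=> dg; have cg := cdiff_ccont dg; move: dg => [g' cg' hg] [f' cf' hf].
exists (fun w => f' (g w) * g' w).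
  by apply: ccontM => //; exact: ccont_comp.
by move=> w; rewrite hf hg mulrA.
Qed.

Lemma cdiff_sum (I : Type) (s : seq I) (F : I -> R[i] -> R[i]) z :
  (forall i, cdiff (F i) z) -> cdiff (fun w => \sum_(i <- s) F i w) z.
Proof.
move=> HF; elim: s => [|i s IH].
  have -> : (fun w => \sum_(i <- [::]) F i w) = (fun _ => 0).
    by apply/funext => w; rewrite big_nil.
  exact: cdiff_cst.
have -> : (fun w => \sum_(j <- i :: s) F j w) = (fun w => F i w + \sum_(j <- s) F j w).
  by apply/funext => w; rewrite big_cons.
exact: cdiffD.
Qed.

Lemma ccont_sum (I : Type) (s : seq I) S (F : I -> R[i] -> R[i]) z :
  (forall i, ccont S (F i) z) -> ccont S (fun w => \sum_(i <- s) F i w) z.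
Proof.
move=> HF; elim: s => [|i s IH].
  have -> : (fun w => \sum_(i <- [::]) F i w) = (fun _ => 0).
    by apply/funext => w; rewrite big_nil.
  exact: ccont_cst.
have -> : (fun w => \sum_(j <- i :: s) F j w) = (fun w => F i w + \sum_(j <- s) F j w).
  by apply/funext => w; rewrite big_cons.
exact: ccontD.
Qed.

Definition cexp z : R[i] := (expR (complex.Re z))%:C%C *
  Complex (cos (complex.Im z)) (sin (complex.Im z)).

Lemma cexp0 : cexp 0 = 1.
Proof. by rewrite /cexp /= expR0 cos0 sin0 mul1r. Qed.

Lemma cexpD z w : cexp (z + w) = cexp z * cexp w.
Proof.
rewrite /cexp ReD ImD expRD cosD sinD rmorphM /= mulrACA; congr (_ * _).
by apply/eqP; rewrite eq_complex /=; apply/andP; split; apply/eqP; ring.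
Qed.

Lemma cnorm_cexp z : normc (cexp z) = expR (complex.Re z).
Proof.
by rewrite cnormZ cnormE cos2Dsin2 sqrtr1 mulr1 ger0_norm // expR_ge0.
Qed.

Lemma cexp_real a : cexp (a%:C)%C = (expR a)%:C%C.
Proof. by rewrite /cexp /= cos0 sin0 mulr1. Qed.

Lemma expR_sub1_le a : `|expR a - 1| <= `|a| * expR `|a|.
Proof.
have [a0|a0] := leP 0 a.
  rewrite ger0_norm; last by rewrite subr_ge0 -[leLHS]expR0 ler_expR.
  have -> : expR a - 1 = expR a * (1 - expR (- a)) by rewrite mulrBr mulr1 -expRD subrr expR0.
  rewrite (ger0_norm a0) mulrC; apply: ler_wpM2r; first exact: expR_ge0.
  by have := expR_ge1Dx (- a); lra.
rewrite ltr0_norm; last by rewrite subr_lt0 -[ltRHS]expR0 ltr_expR.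
rewrite (ltr0_norm a0).
apply: (@le_trans _ _ (- a * 1)); first by have := expR_ge1Dx a; lra.
by apply: ler_wpM2l; [lra | rewrite -[leLHS]expR0 ler_expR; lra].
Qed.

Lemma expR_taylor1_le a : `|expR a - 1 - a| <= a ^+ 2 * expR `|a|.
Proof.
have h0 : 0 <= expR a - 1 - a by have := expR_ge1Dx a; lra.
rewrite ger0_norm //; have [a0|a0] := leP 0 a.
  have := expR_sub1_le a; rewrite (ger0_norm a0) ler_norml => /andP[_ h].
  have h2 : expR a - 1 - a <= a * (expR a - 1) by lra.
  by apply: le_trans h2 _; rewrite expr2 -mulrA ler_wpM2l.
have h1 : expR a <= (1 - a)^-1.
  rewrite -[a in leLHS]opprK expRN lef_pV2 ?posrE ?expR_gt0 //; last lra.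
  by have := expR_ge1Dx (- a); lra.
apply: (@le_trans _ _ (a ^+ 2 * 1)).
  rewrite mulr1; apply: (@le_trans _ _ ((1 - a)^-1 - 1 - a)); first lra.
  have -> : (1 - a)^-1 - 1 - a = a ^+ 2 / (1 - a) by field; lra.
  rewrite ler_pdivrMr; last lra.
  by have := sqr_ge0 a; nra.
apply: ler_wpM2l; first exact: sqr_ge0.
by rewrite -[leLHS]expR0 ler_expR.
Qed.

Lemma mean_value_le (u du : R -> R) a K : (forall x : R, is_derive x (1 : R) u (du x)) ->
  (forall x : R, `|x| <= `|a| -> `|du x| <= K) -> `|u a - u 0| <= K * `|a|.
Proof.
move=> Hd Hb.
have cu : forall x : R, {for x, continuous u}.
  move=> x; apply: differentiable_continuous; apply/derivable1_diffP.
  by case: (Hd x).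
have wc (c d : R) : {within `[c, d], continuous u}.
  by apply: continuous_subspaceT => x; exact: cu.
have [a0|a0|->] := ltgtP a 0; last by rewrite !subrr !normr0 mulr0.
- have [x] := MVT a0 (fun x _ => Hd x) (wc _ _); rewrite in_itv /= => hx E.
  rewrite distrC E normrM sub0r normrN; apply: ler_wpM2r => //; apply: Hb.
  by rewrite !ler0_norm; lra.
- have [x] := MVT a0 (fun x _ => Hd x) (wc _ _); rewrite in_itv /= => hx E.
  rewrite E normrM subr0; apply: ler_wpM2r => //; apply: Hb.
  by rewrite !ger0_norm; lra.
Qed.

Lemma abs_sin_le a : `|sin a| <= `|a|.
Proof.
have := @mean_value_le sin cos a 1 (@is_derive_sin R); rewrite sin0 subr0 mul1r; apply.
by move=> x _; exact: cos_max.
Qed.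

Lemma abs_cos_sub1_le a : `|cos a - 1| <= `|a|.
Proof.
have := @mean_value_le cos (fun x => - sin x) a 1 (@is_derive_cos R).
rewrite cos0 mul1r; apply => x _; rewrite normrN; exact: sin_max.
Qed.

Lemma abs_cos_taylor_le a : `|cos a - 1| <= a ^+ 2.
Proof.
have := @mean_value_le cos (fun x => - sin x) a `|a| (@is_derive_cos R).
rewrite cos0 -normrM -expr2 (ger0_norm (sqr_ge0 a)); apply => x ax.
by rewrite normrN (le_trans (abs_sin_le x)).
Qed.

Lemma abs_sin_taylor_le a : `|sin a - a| <= a ^+ 2.
Proof.
have Hd (x : R) : is_derive x (1 : R) (fun y => sin y - y) (cos x - 1).
  by apply: is_deriveB.
have := @mean_value_le _ _ a `|a| Hd; rewrite sin0 !subr0 -normrM -expr2 (ger0_norm (sqr_ge0 a)).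
by apply => x ax; exact: le_trans (abs_cos_sub1_le x) ax.
Qed.

(** The factor [expR (normc z)] makes the bound valid for every [z], not only near 0: in
    [coef_taylor] the increment of the exponent grows with the level [k]. *)
Lemma cexp_taylor1_le z : normc (cexp z - 1 - z) <= 4 * normc z ^+ 2 * expR (normc z).
Proof.
set n := normc z; set x := complex.Re z; set y := complex.Im z.
have n0 : 0 <= n := cnorm_ge0 z.
have xn : `|x| <= n := abs_Re_le z.
have yn : `|y| <= n := abs_Im_le z.
have ex : expR x <= expR n by rewrite ler_expR (le_trans (ler_norm _)).
have ex' : expR `|x| <= expR n by rewrite ler_expR.
have x2 : x ^+ 2 <= n ^+ 2 by rewrite -[x ^+ 2]real_normK ?num_real // lerXn2r ?nnegrE.
have y2 : y ^+ 2 <= n ^+ 2 by rewrite -[y ^+ 2]real_normK ?num_real // lerXn2r ?nnegrE.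
have e0 := expR_gt0 n.
apply: le_trans (cnorm_le_abs _) _; rewrite !ReB !ImB /cexp ReM ImM /= -/x -/y !mul0r subr0 addr0 subr0.
have -> : expR x * cos y - 1 - x = expR x * (cos y - 1) + (expR x - 1 - x) by ring.
have -> : expR x * sin y - y = expR x * (sin y - y) + (expR x - 1) * y by ring.
have h1 : `|expR x * (cos y - 1)| <= n ^+ 2 * expR n.
  rewrite normrM (ger0_norm (expR_ge0 x)) mulrC; apply: ler_pM; rewrite ?expR_ge0 //.
  exact: le_trans (abs_cos_taylor_le y) y2.
have h2 : `|expR x - 1 - x| <= n ^+ 2 * expR n.
  by apply: le_trans (expR_taylor1_le x) _; apply: ler_pM; rewrite ?sqr_ge0 ?expR_ge0.
have h3 : `|expR x * (sin y - y)| <= n ^+ 2 * expR n.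
  rewrite normrM (ger0_norm (expR_ge0 x)) mulrC; apply: ler_pM; rewrite ?expR_ge0 //.
  exact: le_trans (abs_sin_taylor_le y) y2.
have h4 : `|(expR x - 1) * y| <= n ^+ 2 * expR n.
  rewrite normrM expr2 -mulrA [n * expR n]mulrC mulrA; apply: ler_pM => //.
  by apply: le_trans (expR_sub1_le x) _; apply: ler_pM; rewrite ?expR_ge0.
have := ler_normD (expR x * (cos y - 1)) (expR x - 1 - x).
have := ler_normD (expR x * (sin y - y)) ((expR x - 1) * y).
by move: h1 h2 h3 h4; clear; lra.
Qed.

Lemma cdiff_cexp z : cdiff cexp z.
Proof.
exists (fun w => if w == z then cexp z else (cexp w - cexp z) / (w - z)); last first.
  move=> w; case: eqP => [->|/eqP wz]; first by rewrite !subrr mulr0.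
  by rewrite divfK // subr_eq0.
move=> e e0; rewrite eqxx.
set K := 4 * expR (complex.Re z) * expR 1.
have K0 : 0 < K by rewrite !mulr_gt0 ?expR_gt0.
exists (Num.min 1 (e / K)); first by rewrite lt_min ltr01 divr_gt0.
move=> w _; rewrite le_min => /andP[w1 we].
case: eqP => [_|/eqP wz]; first by rewrite subrr cnorm0 ltW.
have wz0 : w - z != 0 by rewrite subr_eq0.
have -> : (cexp w - cexp z) / (w - z) - cexp z =
    cexp z * (cexp (w - z) - 1 - (w - z)) / (w - z).
  have -> : cexp w = cexp z * cexp (w - z) by rewrite -cexpD subrKC.
  by field.
rewrite cnormM cnormM normcV cnorm_cexp.
have n0 : 0 < normc (w - z) by rewrite lt_def cnorm_ge0 cnorm_eq0 wz0.
rewrite ler_pdivrMr //.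
apply: le_trans (ler_wpM2l (expR_ge0 _) (cexp_taylor1_le _)) _.
apply: (@le_trans _ _ (expR (complex.Re z) * (4 * normc (w - z) ^+ 2 * expR 1))).
  apply: ler_wpM2l; first exact: expR_ge0.
  by apply: ler_wpM2l; [rewrite mulr_ge0 // sqr_ge0 | rewrite ler_expR].
have -> : expR (complex.Re z) * (4 * normc (w - z) ^+ 2 * expR 1) = (K * normc (w - z)) * normc (w - z).
  by rewrite /K; ring.
by apply: ler_wpM2r; [exact: ltW | rewrite mulrC -ler_pdivlMr].
Qed.

(* The values of [h] on the circles about [a] average to [h a = 0], by Goursat's
   lemma for the [2 * pi * i]-periodic function [w |-> h (a + exp w)]. *)
Lemma no_strict_superharmonic h (a : R[i]) (rho eps : R) : 0 < rho -> 0 < eps ->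
  (forall w, normc (w - a) < rho -> cdiff h w) -> h a = 0 ->
  (forall w, normc (w - a) < rho -> complex.Re (h w) <= - eps * normc (w - a) ^+ 2) ->
  False.
Proof.
move=> rho0 eps0 dh ha hle.
set r := rho / 2; have r0 : 0 < r by rewrite divr_gt0.
have rr : r < rho by rewrite /r; lra.
set s1 := ln r; have es1 : expR s1 = r by rewrite /s1 lnK ?posrE.
pose k (w : R[i]) := h (a + cexp w).
have kE (w : R[i]) : normc (a + cexp w - a) = expR (complex.Re w) by rewrite addrAC subrr add0r cnorm_cexp.
have dk w : complex.Re w <= s1 -> cdiff k w.
  move=> ws; apply: (@cdiff_comp h (fun w => a + cexp w)).
    by apply: cdiffD; [exact: cdiff_cst | exact: cdiff_cexp].
  by apply: dh; rewrite kE (le_lt_trans _ rr) // -es1 ler_expR.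
have eta0 : 0 < eps * r ^+ 2 / 2 by rewrite divr_gt0 // mulr_gt0 // exprn_gt0.
have ca : ccont setT h a by apply/cdiff_ccont/dh; rewrite subrr cnorm0.
have [d d0 hd] := ca _ eta0.
(* On the circle of radius [expR s0 <= d] the real part of [h] is at least [- (eps * r ^+ 2 / 2)] by
   continuity at [a]; on the circle of radius [r] it is at most [- eps * r ^+ 2]. Their means can
   therefore not be equal. *)
set s0 := Num.min s1 (ln d).
have s01 : s0 <= s1 by rewrite ge_min lexx.
have es0 : expR s0 <= d by rewrite -[leRHS](@lnK _ d) ?posrE // ler_expR ge_min lexx orbT.
pose P (s t : R) := complex.Re (k (Complex s t)); pose Q (s t : R) := complex.Im (k (Complex s t)).
have pi0 : (0 : R) <= 2 * pi by rewrite mulr_ge0 // pi_ge0.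
have CR : cauchy_riemann P Q s0 s1 0 (2 * pi).
  move=> x0 y0 hx hy; have [|g cg kg] := dk (Complex x0 y0); first by case/andP: hx.
  exists (complex.Re (g (Complex x0 y0))), (complex.Im (g (Complex x0 y0))) => e e0.
  have e2 : 0 < e by [].
  have [q q0 hq] := cg _ e2; exists (q / 2); first by rewrite divr_gt0.
  move=> x y _ _ xq yq; set w := Complex x y; set w0 := Complex x0 y0.
  have wE : w - w0 = Complex (x - x0) (y - y0) by [].
  have wn : normc (w - w0) <= `|x - x0| + `|y - y0| by exact: cnorm_le_abs.
  have H : normc (k w - k w0 - g w0 * (w - w0)) <= e * (`|x - x0| + `|y - y0|).
    rewrite kg -mulrBl cnormM; apply: ler_pM; rewrite ?cnorm_ge0 //.
    by apply: hq => //; apply: le_trans wn _; rewrite [leRHS]splitr lerD.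
  split.
    have := le_trans (abs_Re_le _) H; rewrite !ReB ReM wE /=; congr (_ <= _).
  have := le_trans (abs_Im_le _) H; rewrite !ImB ImM wE /= => H'.
  by rewrite [X in _ - _ - X]addrC.
have := goursat s01 pi0 CR; rewrite /circ.
(* By periodicity the two horizontal sides cancel, and Goursat's lemma says that the two vertical
   integrals, one for each circle, agree. *)
have -> : Q^~ (2 * pi) = Q^~ 0.
  apply/funext => s; rewrite /Q /k /cexp /= cos0 sin0.
  have -> : 2 * pi = pi *+ 2 :> R by rewrite mulr_natl.
  by rewrite cos2pi sin2pi.
rewrite subrr add0r => /eqP; rewrite subr_eq0 => /eqP E.
have := @itv_int_le_addr R (P s1) (P s0) 0 (2 * pi) (- (eps * r ^+ 2 / 2)) pi0.
have hs1 : s0 <= s1 <= s1 by rewrite s01 lexx.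
have hs0 : s0 <= s0 <= s1 by rewrite s01 lexx.
have c1 := continuous_P_vert CR hs1 (lexx _) (lexx _).
have c0 := continuous_P_vert CR hs0 (lexx _) (lexx _).
move=> /(_ c1 c0); rewrite E subr0 => H.
suff : itv_int (P s0) 0 (2 * pi) <= itv_int (P s0) 0 (2 * pi) + - (eps * r ^+ 2 / 2) * (2 * pi).
  rewrite lerDl mulNr oppr_ge0 leNgt => /negP; apply.
  exact: mulr_gt0 eta0 (mulr_gt0 (ltr0n R 2) (pi_gt0 R)).
apply: H => t _.
have h1 : P s1 t <= - eps * r ^+ 2.
  have hh := hle (a + cexp (Complex s1 t)).
  by rewrite kE /= es1 in hh; exact: hh rr.
have : - (eps * r ^+ 2 / 2) <= P s0 t.
  have := hd (a + cexp (Complex s0 t)) I; rewrite kE /= => /(_ es0).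
  rewrite ha subr0 => /(le_trans (abs_Re_le _)).
  by rewrite ler_norml => /andP[].
by move: h1; clear; lra.
Qed.

Definition cstrip : set R[i] := [set z | 0 <= complex.Re z <= 1].

Lemma cont_within_rect f a b c d :
  (forall z, a <= complex.Re z <= b -> c <= complex.Im z <= d ->
    ccont [set w | a <= complex.Re w <= b] f z) ->
  {within (`[a, b] `*` `[c, d])%classic, continuous
     (fun p : R * R => normc (f (Complex p.1 p.2)) : R)}.
Proof.
move=> H; apply/subspace_continuousP => -[x y] /= []; rewrite !in_itv /= => hx hy.
apply/cvgrPdist_le => e e0.
have [r r0 hr] := H (Complex x y) hx hy e e0.
have r2 : 0 < r / 2 by rewrite divr_gt0.
apply/nbhs_ballP; exists (r / 2) => //= -[x' y'] [/= h1 h2] [/=]; rewrite !in_itv /= => hx' hy'.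
apply: le_trans (cnorm_dist _ _) _; rewrite cdistC; apply: hr => //.
apply: le_trans (cnorm_le_abs _) _; rewrite ReB ImB /= [leRHS]splitr.
by apply: lerD; apply: ltW; rewrite distrC.
Qed.

(** The factor [E w = exp (delta (w^2 - 1))] makes [g = E f] at most [M] at large heights, which
    leaves a compact rectangle. There the maximum of [|g|^2 + eps |w|^2], rather than that of
    [|g|^2], is taken: the added term makes the maximum strict in the sense excluded by
    [no_strict_superharmonic]. *)
Lemma strip_max_principle f (M B : R) z0 : 0 < M ->
  (forall z, cstrip z -> normc (f z) <= B) ->
  (forall z, cstrip z -> ccont cstrip f z) ->
  (forall z, 0 < complex.Re z < 1 -> cdiff f z) ->
  (forall t : R, normc (f (Complex 0 t)) <= M) ->
  (forall t : R, normc (f (Complex 1 t)) <= M) ->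
  cstrip z0 -> normc (f z0) <= M.
Proof.
move=> M0 fB cf df fl fr sz0; rewrite leNgt; apply/negP => Mf.
set x0 := complex.Re z0; set y0 := complex.Im z0; set F := normc (f z0) in Mf.
have F0 : 0 < F := lt_trans M0 Mf.
have K0 : 0 < 1 + y0 ^+ 2 by rewrite ltr_pwDl // sqr_ge0.
(* Small enough that the factor [E] leaves at least [(F + M) / 2 > M] of the value at [z0]. *)
set delta := (F - M) / (2 * F * (1 + y0 ^+ 2)).
have delta0 : 0 < delta by rewrite divr_gt0 ?subr_gt0 // !mulr_gt0.
pose E (w : R[i]) := cexp ((delta%:C)%C * (w * w - 1)).
have nE w : normc (E w) = expR (delta * (complex.Re w ^+ 2 - complex.Im w ^+ 2 - 1)).
  by rewrite /E cnorm_cexp ReM ReB ReM /=; congr expR; rewrite mul0r subr0; ring.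
have dE w : cdiff E w.
  apply: (@cdiff_comp cexp); last exact: cdiff_cexp.
  apply: cdiffM; first exact: cdiff_cst.
  by apply: cdiffD; [apply: cdiffM; exact: cdiff_id | exact: cdiff_cst].
pose g w := E w * f w.
have ng w : normc (g w) = normc (E w) * normc (f w) by rewrite /g cnormM.
have strip2 w : cstrip w -> complex.Re w ^+ 2 <= 1.
  by move=> /andP[w0 w1]; rewrite expr_le1.
have nE1 w : cstrip w -> normc (E w) <= expR (- (delta * complex.Im w ^+ 2)).
  move=> /strip2 w2; rewrite nE ler_expR -(mulrN delta) ler_wpM2l ?(ltW delta0) //.
  by move: w2; clear; lra.
have nE2 w : cstrip w -> normc (E w) <= 1.
  move=> /nE1 /le_trans; apply; rewrite -[leRHS]expR0 ler_expR oppr_le0.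
  by rewrite mulr_ge0 ?sqr_ge0 // ltW.
have gz0 : M < normc (g z0).
  rewrite ng nE -/x0 -/y0 -/F.
  have h : 1 - delta * (1 + y0 ^+ 2) <= expR (delta * (x0 ^+ 2 - y0 ^+ 2 - 1)).
    apply: le_trans (expR_ge1Dx _); rewrite lerD2l -(mulrN delta) ler_wpM2l ?(ltW delta0) //.
    by have := sqr_ge0 x0; lra.
  apply: lt_le_trans (ler_wpM2r (ltW F0) h).
  have -> : (1 - delta * (1 + y0 ^+ 2)) * F = (F + M) / 2.
    by rewrite /delta; field; rewrite !gt_eqF.
  by move: Mf; clear; lra.
have B0 : 0 < B by apply: lt_le_trans F0 _; exact: fB.
(* From the height [Y] on, [expR (delta * Im ^+ 2) >= B / M], so that the factor [E] brings the
   bound [B] down to [M]. *)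
set Y := Num.sqrt (B / M / delta) + 1.
have Y0 : 0 < Y by rewrite ltr_wpDl // sqrtr_ge0.
have gY w : cstrip w -> Y <= `|complex.Im w| -> normc (g w) <= M.
  move=> sw hw; rewrite ng.
  have hI : B / M <= expR (delta * complex.Im w ^+ 2).
    have Q0 : 0 <= B / M / delta := divr_ge0 (divr_ge0 (ltW B0) (ltW M0)) (ltW delta0).
    have h : B / M / delta <= complex.Im w ^+ 2.
      rewrite -(sqr_sqrtr Q0) -[complex.Im w ^+ 2]real_normK ?num_real //.
      rewrite lerXn2r ?nnegrE ?sqrtr_ge0 //.
      by apply: le_trans hw; rewrite /Y lerDl.
    rewrite ler_pdivrMr // in h; rewrite (mulrC delta).
    apply: le_trans h _; apply: le_trans (expR_ge1Dx _); rewrite lerDr //.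
  apply: (@le_trans _ _ (expR (- (delta * complex.Im w ^+ 2)) * B)).
    by apply: ler_pM; rewrite ?cnorm_ge0 ?nE1 ?fB.
  rewrite expRN mulrC ler_pdivrMr ?expR_gt0 // mulrC -ler_pdivrMr //.
have gl t : normc (g (Complex 0 t)) <= M.
  rewrite ng -[leRHS]mul1r; apply: ler_pM; rewrite ?cnorm_ge0 ?nE2 //.
  by rewrite /cstrip /= lexx ler01.
have gr t : normc (g (Complex 1 t)) <= M.
  rewrite ng -[leRHS]mul1r; apply: ler_pM; rewrite ?cnorm_ge0 ?nE2 //.
  by rewrite /cstrip /= lexx ler01.
have Yz0 : `|y0| < Y by rewrite ltNge; apply/negP => /(gY z0 sz0); rewrite leNgt gz0.
set G := normc (g z0) in gz0.
have GM : 0 < G ^+ 2 - M ^+ 2 by rewrite subr_gt0 ltr_pXn2r // ?nnegrE ?ltW // (lt_trans M0).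
have YY : 0 < 1 + Y ^+ 2 by rewrite ltr_pwDl // sqr_ge0.
(* On the rectangle the perturbation is then at most [(G ^+ 2 - M ^+ 2) / 2], so [|g|] still exceeds
   [M] at the new maximum [c]. This places [c] in the interior. *)
set eps := (G ^+ 2 - M ^+ 2) / (2 * (1 + Y ^+ 2)).
have eps0 : 0 < eps by rewrite divr_gt0 // mulr_gt0.
pose K := (`[0, 1] `*` `[- Y, Y])%classic : set (R * R).
pose Phi (p : R * R) : R := normc (g (Complex p.1 p.2)) ^+ 2 + eps * (normc (Complex p.1 p.2)) ^+ 2.
have cPhi : {within K, continuous Phi}.
  have c1 : {within K, continuous (fun p : R * R => normc (g (Complex p.1 p.2)) : R)}.
    apply: cont_within_rect => z hz _; apply: ccontM; last exact: cf.
    by apply: ccontS (cdiff_ccont (dE z)).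
  have c2 : {within K, continuous (fun p : R * R => normc (Complex p.1 p.2) : R)}.
    by apply: (@cont_within_rect id) => z hz _; exact: ccont_id.
  move=> p; apply: cvgD; first by apply: cvgM; exact: c1.
  apply: cvgM; first exact: cvg_cst.
  by apply: cvgM; exact: c2.
have cK : compact K by apply: compact_setX; exact: segment_compact.
have Kz0 : K (x0, y0).
  by split => /=; rewrite in_itv /=; [exact: sz0 | move: Yz0; rewrite ltr_norml => /andP[/ltW -> /ltW ->]].
have [x [y [hx hy hmax]]] : exists x y : R, [/\ 0 <= x <= 1, - Y <= y <= Y &
    forall u v : R, 0 <= u <= 1 -> - Y <= v <= Y -> Phi (u, v) <= Phi (x, y)].
  have [[x y]] := compact_EVT_max (ex_intro _ _ Kz0) cK cPhi.
  rewrite inE => -[/=]; rewrite !in_itv /= => hx hy hmax; exists x, y; split => // u v hu hv.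
  by apply: hmax; rewrite inE; split => /=; rewrite in_itv.
set c := Complex x y.
have sc : cstrip c by exact: hx.
have max_c w : cstrip w -> - Y <= complex.Im w <= Y ->
    normc (g w) ^+ 2 + eps * normc w ^+ 2 <= normc (g c) ^+ 2 + eps * normc c ^+ 2.
  by case: w => u v hu hv; exact: (hmax u v).
have gc : M < normc (g c).
  rewrite -(ltr_pXn2r (n := 2)) ?nnegrE ?cnorm_ge0 ?(ltW M0) //.
  have := max_c z0 sz0; rewrite -/y0 => /(_ _)/wrap[].
    by move: Yz0; rewrite ltr_norml => /andP[/ltW -> /ltW ->].
  have := cnorm_sqr z0; have := sqr_ge0 (normc z0).
  have : normc c ^+ 2 <= 1 + Y ^+ 2.
    rewrite cnorm_sqr lerD //; first exact: strip2 c sc.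
    rewrite /=.
    rewrite -[y ^+ 2]real_normK ?num_real // lerXn2r ?nnegrE ?(ltW Y0) // ler_norml.
    by move: hy; clear; lra.
  rewrite -/G => k1 k2 _ k3.
  have k4 : eps * normc c ^+ 2 <= (G ^+ 2 - M ^+ 2) / 2.
    apply: le_trans (ler_wpM2l (ltW eps0) k1) _.
    by rewrite /eps le_eqVlt; apply/orP; left; apply/eqP; field; rewrite gt_eqF.
  have k5 : 0 <= eps * normc z0 ^+ 2 by rewrite mulr_ge0 // ltW.
  by move: k3 k4 k5 GM; clear; lra.
have x_gt0 : 0 < x.
  have /andP[] := hx; rewrite le_eqVlt => /predU1P[xE|//] _.
  by move: gc; rewrite /c -xE ltNge gl.
have x_lt1 : x < 1.
  have /andP[_] := hx; rewrite le_eqVlt => /predU1P[xE|//].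
  by move: gc; rewrite /c xE ltNge gr.
have y_lt : `|y| < Y by rewrite ltNge; apply/negP => /(gY c sc); rewrite leNgt gc.
set rho := Num.min (Num.min x (1 - x)) (Y - `|y|).
have rho0 : 0 < rho by rewrite !lt_min x_gt0 !subr_gt0 x_lt1.
have inside w : normc (w - c) < rho -> 0 < complex.Re w < 1 /\ - Y <= complex.Im w <= Y.
  rewrite !lt_min => /andP[/andP[h1 h2] h3].
  have := le_lt_trans (abs_Re_le _) h1; have := le_lt_trans (abs_Re_le _) h2.
  have := le_lt_trans (abs_Im_le _) h3; rewrite ReB ImB /=.
  have := ler_norm y; have := ler_norm (- y); rewrite normrN !ltr_norml.
  by clear; lra.
pose cc : R[i] := conjc c; pose gcc : R[i] := conjc (g c).
(* The linear part at [c] of the two squared moduli: maximality gives [Re (h w) <= - |g w - g c|^2 -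
   eps |w - c|^2]. *)
pose h (w : R[i]) : R[i] := (2%:C)%C * gcc * (g w - g c) + ((2 * eps)%:C)%C * cc * (w - c).
apply: (@no_strict_superharmonic h c rho eps) => //.
- move=> w /inside[hw _]; apply: cdiffD; apply: cdiffM; try exact: cdiff_cst.
    apply: cdiffD; last exact: cdiff_cst.
    by apply: cdiffM; [exact: dE | exact: df].
  by apply: cdiffD; [exact: cdiff_id | exact: cdiff_cst].
- by rewrite /h !subrr !mulr0 addr0.
move=> w /inside[hw hwI].
have sw : cstrip w by case/andP: hw => /ltW ? /ltW ?; apply/andP.
have := max_c w sw hwI.
have sq := sqr_ge0 (normc (g w - g c)).
have ReE (u v : R[i]) : complex.Re (conjc u * (v - u)) * 2 =
    normc v ^+ 2 - normc u ^+ 2 - normc (v - u) ^+ 2.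
  rewrite !cnorm_sqr; case: u v => u1 u2 [v1 v2] /=; ring.
have Re2 (u : R) (v v' : R[i]) : complex.Re ((u%:C)%C * v * v') = u * complex.Re (v * v').
  by case: v v' => v1 v2 [v3 v4] /=; ring.
rewrite /h ReD !Re2.
have H1 : complex.Re (gcc * (g w - g c)) * 2 = _ := ReE (g c) (g w).
have H2 : eps * (complex.Re (cc * (w - c)) * 2) = _ := congr1 ( *%R eps) (ReE c w).
by move: sq H1 H2; clear; lra.
Qed.

End ComplexPlane.

(** * Three lines theorem for finite weighted families *)

Section FiniteThreeLines.
Variable R : realType.
Implicit Types (z w : R[i]) (f g : R[i] -> R[i]).

Definition strip_bounded f := exists B : R, forall z, cstrip z -> normc (f z) <= B.

Lemma strip_bounded_sum (I : Type) (s : seq I) (F : I -> R[i] -> R[i]) :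
  (forall i, strip_bounded (F i)) -> strip_bounded (fun z => \sum_(i <- s) F i z).
Proof.
move=> HF; elim: s => [|i s [B HB]].
  by exists 0 => z _; rewrite big_nil cnorm0.
have [B' HB'] := HF i; exists (B' + B) => z sz; rewrite big_cons.
by apply: le_trans (cnormD _ _) _; rewrite lerD ?HB ?HB'.
Qed.

Lemma strip_boundedM f g : strip_bounded f -> strip_bounded g ->
  strip_bounded (fun z => f z * g z).
Proof.
move=> [B HB] [B' HB']; exists (B * B') => z sz.
by rewrite cnormM ler_pM ?cnorm_ge0 ?HB ?HB'.
Qed.

Lemma cdiff_cexp_affine (a b : R) z :
  cdiff (fun z => cexp ((a%:C)%C + (b%:C)%C * z)) z.
Proof.
apply: (@cdiff_comp R (@cexp R)); last exact: cdiff_cexp.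
apply: cdiffD; first exact: cdiff_cst.
by apply: cdiffM; [exact: cdiff_cst | exact: cdiff_id].
Qed.

Lemma cnorm_cexp_affine (a b : R) z :
  normc (cexp ((a%:C)%C + (b%:C)%C * z)) = expR (a + b * complex.Re z).
Proof. by rewrite cnorm_cexp ReD ReM /= mul0r subr0. Qed.

Lemma cnorm_sum (I : Type) (s : seq I) (F : I -> R[i]) :
  normc (\sum_(i <- s) F i) <= \sum_(i <- s) normc (F i).
Proof.
elim: s => [|i s IH]; first by rewrite !big_nil cnorm0.
by rewrite !big_cons (le_trans (cnormD _ _)) // lerD2l.
Qed.

Lemma Re_sum (I : Type) (s : seq I) (F : I -> R[i]) :
  complex.Re (\sum_(i <- s) F i) = \sum_(i <- s) complex.Re (F i).
Proof.
elim: s => [|i s IH]; first by rewrite !big_nil.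
by rewrite !big_cons ReD IH.
Qed.

(* Hadamard's three lines theorem for the pairing of [a] with the extremal
   dual family [b i z = sgn (conj (a i alpha)) * u i ^ (1 - 1/p(z))]. *)
Lemma finite_three_lines (I : Type) (s : seq I) (w : I -> R) (a : I -> R[i] -> R[i])
    (p1 p p2 alpha M : R) :
  1 < p1 -> p1 < p2 -> 0 < p -> 0 < alpha < 1 ->
  p^-1 = (1 - alpha) / p1 + alpha / p2 -> 0 < M ->
  (forall i, 0 <= w i) ->
  (forall i, strip_bounded (a i)) ->
  (forall i z, cstrip z -> ccont (@cstrip R) (a i) z) ->
  (forall i z, 0 < complex.Re z < 1 -> cdiff (a i) z) ->
  (forall t, \sum_(i <- s) normc (a i (Complex 0 t)) `^ p1 * w i <= M `^ p1) ->
  (forall t, \sum_(i <- s) normc (a i (Complex 1 t)) `^ p2 * w i <= M `^ p2) ->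
  \sum_(i <- s) normc (a i (alpha%:C)%C) `^ p * w i <= M `^ p.
Proof.
move=> p1_gt1 p12 p0 /andP[al0 al1] pE M0 w0 ba ca da H0 H1.
pose c i := a i (alpha%:C)%C; set S := \sum_(i <- s) _.
have S_ge0 : 0 <= S by apply: sumr_ge0 => i _; rewrite mulr_ge0 ?powR_ge0.
have [S0|S0] := leP S 0; first by rewrite (le_trans S0) ?powR_ge0.
(* Normalised so that the [u i] have total weight 1 ([sum_u]). *)
pose u i := normc (c i) `^ p / S.
have u0 i : 0 <= u i by rewrite divr_ge0 ?powR_ge0 // ltW.
have u_gt0 i : c i != 0 -> 0 < u i.
  by move=> ci; rewrite divr_gt0 ?powR_gt0 // lt_def cnorm_ge0 cnorm_eq0 ci.
have sum_u : \sum_(i <- s) u i * w i = 1.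
  under eq_bigr do rewrite mulrAC.
  by rewrite -mulr_suml divff // gt_eqF.
(* [A0 + A1 * Re z] is [1 - 1 / p(z)], where [1 / p(z)] is affine in [Re z], from [1 / p1] on the
   left line to [1 / p2] on the right one. *)
set A0 := 1 - p1^-1; set A1 := p1^-1 - p2^-1.
have p1_gt0 : 0 < p1 := lt_trans ltr01 p1_gt1.
have p2_gt0 : 0 < p2 := lt_trans p1_gt0 p12.
have A0_gt0 : 0 < A0 by rewrite subr_gt0 invf_lt1.
have A1_gt0 : 0 < A1 by rewrite subr_gt0 ltf_pV2.
have A01 : A0 + A1 < 1 by rewrite /A0 /A1; have := p2_gt0; rewrite -invr_gt0; lra.
pose b i z : R[i] := if c i == 0 then 0 else
  (conjc (c i) * ((normc (c i))^-1%:C)%C) *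
  cexp (((A0 * ln (u i))%:C)%C + ((A1 * ln (u i))%:C)%C * z).
have nb i z : normc (b i z) = if c i == 0 then 0 else u i `^ (A0 + A1 * complex.Re z).
  rewrite /b; case: ifPn => ci; first exact: cnorm0.
  have nc : normc (c i) != 0 by rewrite cnorm_eq0.
  have nconj : normc (conjc (c i)) = normc (c i).
    by case: (c i) => x y; rewrite /conjc !cnormE sqrrN.
  rewrite cnormM cnorm_cexp_affine cnormM cnorm_real nconj ger0_norm ?invr_ge0 ?cnorm_ge0 //.
  rewrite divff // mul1r /powR gt_eqF ?u_gt0 //; congr expR; ring.
have nb1 i z : cstrip z -> normc (b i z) <= expR `|ln (u i)|.
  move=> /andP[z0 z1]; rewrite nb; case: ifPn => ci; first exact: expR_ge0.
  rewrite /powR gt_eqF ?u_gt0 // ler_expR (le_trans (ler_norm _)) // normrM.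
  rewrite -[leRHS]mul1r ler_wpM2r // ger0_norm; first by nra.
  exact: addr_ge0 (ltW A0_gt0) (mulr_ge0 (ltW A1_gt0) z0).
pose f z := \sum_(i <- s) a i z * b i z * ((w i)%:C)%C.
have db i z : cdiff (b i) z.
  rewrite /b; case: (c i == 0); first exact: cdiff_cst.
  by apply: cdiffM; [exact: cdiff_cst | exact: cdiff_cexp_affine].
have bf : strip_bounded f.
  apply: strip_bounded_sum => i; apply: strip_boundedM.
    by apply: strip_boundedM => //; exists (expR `|ln (u i)|); exact: nb1.
  by exists (normc ((w i)%:C)%C).
have cf z : cstrip z -> ccont (@cstrip R) f z.
  move=> sz; apply: ccont_sum => i; apply: ccontM; last exact: ccont_cst.
  by apply: ccontM; [exact: ca | exact: ccontS (cdiff_ccont (db i z))].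
have df z : 0 < complex.Re z < 1 -> cdiff f z.
  move=> hz; apply: cdiff_sum => i; apply: cdiffM; last exact: cdiff_cst.
  by apply: cdiffM; [exact: da | exact: db].
have line q z : 1 < q -> A0 + A1 * complex.Re z = 1 - q^-1 ->
    \sum_(i <- s) normc (a i z) `^ q * w i <= M `^ q -> normc (f z) <= M.
  move=> q1 Aq Hq; have q0 : 0 < q := lt_trans ltr01 q1.
  have q'0 : 0 < 1 - q^-1 by rewrite subr_gt0 invf_lt1.
  have Mq : 0 < M `^ q by rewrite powR_gt0.
  apply: le_trans (cnorm_sum _ _) _.
  (* Hoelder's inequality in the form of Young's inequality in each term, after division of [a] by
     [M]. The two sums are then at most [1 / q] and [1 - 1 / q]. *)
  apply: (@le_trans _ _ (\sum_(i <- s) M * (normc (a i z) `^ q / M `^ q / q + u i * (1 - q^-1)) * w i)).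
    apply: ler_sum => i _; rewrite !cnormM cnorm_real (ger0_norm (w0 i)) ler_wpM2r //.
    have -> : normc (a i z) * normc (b i z) = M * ((normc (a i z) / M) * normc (b i z)).
      by field; rewrite gt_eqF.
    rewrite ler_wpM2l ?(ltW M0) //.
    have := @conjugate_powR R (normc (a i z) / M) (normc (b i z)) q (1 - q^-1)^-1.
    rewrite divr_ge0 ?cnorm_ge0 ?(ltW M0) // => /(_ isT isT q0).
    rewrite invr_gt0 invrK subrKC => /(_ q'0 erefl) /le_trans; apply.
    apply: lerD.
      by rewrite powRM ?invr_ge0 ?cnorm_ge0 ?(ltW M0) // -[M^-1]powR_inv1 ?(ltW M0) // powRAC powR_inv1 // powR_ge0.
    rewrite ler_wpM2r ?(ltW q'0) // nb; case: ifPn => ci.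
      by rewrite powR0 ?invr_eq0 ?gt_eqF.
    by rewrite Aq -powRrM mulfV ?gt_eqF // powRr1.
  under eq_bigr do rewrite -mulrA mulrDl.
  rewrite -mulr_sumr -[leRHS]mulr1 ler_wpM2l ?(ltW M0) // big_split /=.
  apply: (@le_trans _ _ (q^-1 + (1 - q^-1))); last by rewrite subrKC.
  apply: lerD.
    have -> : \sum_(i <- s) normc (a i z) `^ q / M `^ q / q * w i =
        (\sum_(i <- s) normc (a i z) `^ q * w i) / M `^ q / q.
      by rewrite !mulr_suml; apply: eq_bigr => i _; rewrite mulrAC; congr (_ / _); rewrite mulrAC.
    by rewrite ler_piMl ?invr_ge0 ?(ltW q0) // ler_pdivrMr // mul1r.
  under eq_bigr do rewrite mulrAC.
  by rewrite -mulr_suml sum_u mul1r.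
have p2_gt1 := lt_trans p1_gt1 p12.
have [B fB] := bf.
have key : normc (f (alpha%:C)%C) <= M.
  apply: (strip_max_principle M0 fB cf df).
  - by move=> t; apply: (line p1) => //=; rewrite mulr0 addr0.
  - by move=> t; apply: (line p2) => //=; rewrite mulr1 /A0 /A1; ring.
  - by rewrite /cstrip /= !ltW.
have Aal : A0 + A1 * alpha = 1 - p^-1 by rewrite pE /A0 /A1; ring.
(* At [alpha] the dual family is extremal: each term of the pairing is
   [|c i| * u i ^ (1 - 1/p) * w i], which is [S ^ (1/p) * u i * w i]. *)
have falpha : complex.Re (f (alpha%:C)%C) = S `^ (p^-1).
  rewrite /f Re_sum -[RHS]mul1r -sum_u mulr_suml; apply: eq_bigr => i _.
  rewrite /b -/(c i); case: ifPn => [/eqP|] ci.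
    rewrite mulr0 mul0r /= /u ci cnorm0 powR0 ?gt_eqF // !mul0r //.
  have nc : 0 < normc (c i) by rewrite lt_def cnorm_ge0 cnorm_eq0 ci.
  have -> : (((A0 * ln (u i))%:C)%C + ((A1 * ln (u i))%:C)%C * (alpha%:C)%C) =
      (((1 - p^-1) * ln (u i))%:C)%C.
    by rewrite -rmorphM -rmorphD -Aal /=; congr (_%:C)%C; ring.
  rewrite cexp_real.
  have -> : expR ((1 - p^-1) * ln (u i)) = u i `^ (1 - p^-1).
    by rewrite /powR gt_eqF ?u_gt0.
  have -> : c i * (conjc (c i) * ((normc (c i))^-1%:C)%C * ((u i `^ (1 - p^-1))%:C)%C) * ((w i)%:C)%C
     = (((normc (c i)) * u i `^ (1 - p^-1) * w i)%:C)%C.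
    have -> : c i * (conjc (c i) * ((normc (c i))^-1%:C)%C * ((u i `^ (1 - p^-1))%:C)%C) * ((w i)%:C)%C =
      (c i * conjc (c i)) * ((((normc (c i))^-1 * u i `^ (1 - p^-1) * w i)%:C)%C).
      by rewrite !rmorphM /=; ring.
    have -> : c i * conjc (c i) = ((normc (c i) ^+ 2)%:C)%C.
      rewrite cnorm_sqr; case: (c i) => x y; apply/eqP; rewrite eq_complex /=.
      by apply/andP; split; apply/eqP; ring.
    by rewrite -rmorphM /=; congr (_%:C)%C; field; rewrite gt_eqF.
  rewrite /= [RHS]mulrAC; congr (_ * _).
  have -> : normc (c i) = (u i * S) `^ p^-1.
    by rewrite /u divfK ?gt_eqF // -powRrM divff ?gt_eqF // powRr1 // cnorm_ge0.
  rewrite powRM ?(ltW S0) // mulrAC -powRD; last by apply/implyP => _; rewrite gt_eqF ?u_gt0.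
  by rewrite subrKC powRr1.
have SM : S `^ p^-1 <= M.
  by rewrite -falpha (le_trans (ler_norm _)) // (le_trans (abs_Re_le _)).
have -> : S = (S `^ p^-1) `^ p by rewrite -powRrM mulVf ?gt_eqF // powRr1.
by apply: ge0_ler_powR; rewrite ?nnegrE ?powR_ge0 ?(ltW p0) ?(ltW M0).
Qed.

End FiniteThreeLines.

(** * Geometry of the graph and the maximal function *)

Section EsumTools.
Local Open Scope ereal_scope.
Variable R : realType.

Lemma le_esum_uniq (T : choiceType) (A : set T) (a : T -> \bar R) (s : seq T) :
  uniq s -> (forall x, x \in s -> A x) -> \sum_(x <- s) a x <= \esum_(x in A) a x.
Proof.
move=> us sA; apply: esum_ge; exists [set` s].
  by split; [exact: finite_seq | move=> x /= /sA].
by rewrite fsbig_seq.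
Qed.

Lemma esum_le_uniq (T : choiceType) (A : set T) (a : T -> \bar R) (M : \bar R) :
  (forall s, uniq s -> (forall x, x \in s -> A x) -> \sum_(x <- s) a x <= M) ->
  \esum_(x in A) a x <= M.
Proof.
move=> H; apply: ge_ereal_sup => _ [X [fX XA] <-].
rewrite fsbig_finite //; apply: H; first exact: finmap.fset_uniq.
by move=> x; rewrite in_fset_set // inE => /XA.
Qed.

Lemma esumZl (T : choiceType) (A : set T) (a : T -> \bar R) (c : R) : (0 <= c)%R ->
  (forall x, A x -> 0 <= a x) ->
  \esum_(x in A) (c%:E * a x) = c%:E * \esum_(x in A) a x.
Proof.
have le (b : T -> \bar R) (d : R) : (0 <= d)%R -> (forall x, A x -> 0 <= b x) ->
    \esum_(x in A) (d%:E * b x) <= d%:E * \esum_(x in A) b x.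
  move=> d0 b0; apply: esum_le_uniq => s us sA.
  rewrite big_seq -ge0_sume_distrr; last by move=> x /sA /b0.
  by rewrite -big_seq lee_wpmul2l // le_esum_uniq.
move=> c0 a0; apply/eqP; rewrite eq_le le //=.
have [->|cN0] := eqVneq c 0%R.
  by rewrite mul0e esum_ge0 // => x Ax; rewrite mul0e.
have {cN0}c1 : (0 < c)%R by rewrite lt_def cN0.
have := le (fun x => c%:E * a x) c^-1%R; rewrite invr_ge0 => /(_ c0).
move=> /(_ (fun x Ax => mule_ge0 (c0 : 0 <= c%:E) (a0 x Ax))).
under eq_esum do rewrite muleA -EFinM mulVf ?gt_eqF // mul1e.
by rewrite lee_pdivlMl.
Qed.

Lemma esum_subset (T : choiceType) (A B : set T) (a : T -> \bar R) :
  A `<=` B -> (forall x, B x -> 0 <= a x) ->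
  \esum_(x in A) a x <= \esum_(x in B) a x.
Proof. by move=> AB a0; apply: esum_le_uniq => s us sA; apply: le_esum_uniq => // x /sA /AB. Qed.

(** Tonelli for arbitrary index types: a finite sum commutes with a sum of nonnegative terms, and
    each side is a supremum of finite sums. *)
Lemma esum_exchange (T T' : choiceType) (A : set T) (B : set T') (a : T -> T' -> \bar R) :
  (forall x y, 0 <= a x y) ->
  \esum_(x in A) \esum_(y in B) a x y = \esum_(y in B) \esum_(x in A) a x y.
Proof.
have le (U U' : choiceType) (C : set U) (D : set U') (b : U -> U' -> \bar R) :
    (forall x y, 0 <= b x y) ->
    \esum_(x in C) \esum_(y in D) b x y <= \esum_(y in D) \esum_(x in C) b x y.
  move=> b0; apply: esum_le_uniq => s us sA; rewrite -esum_sum //.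
  by apply: le_esum => y _; exact: le_esum_uniq.
by move=> a0; apply/eqP; rewrite eq_le !le.
Qed.

End EsumTools.

(** * Distance, small balls and masses of neighbours *)

Section GraphGeometry.
Variables (R : realType) (G : weighted_graph R).
Implicit Types (x y z : G) (r : R).

Local Notation h := (@wgh R G).
Local Notation mu := (@wgmu R G).

Definition nb x : seq G := finmap.enum_fset (fset_set (nbrs x)).

Lemma nbrs_finite x : finite_set (nbrs x).
Proof. by have [N HN] := @wg_degree R G; apply/finite_set_leP; exists N; exact: (HN x). Qed.

Lemma mem_nb x y : (y \in nb x) = adj h x y.
Proof.
rewrite /nb in_fset_set; last exact: nbrs_finite.
by apply/idP/idP; rewrite inE.
Qed.

Lemma sum_nbrs (T : nmodType) x (F : G -> T) : \sum_(y \in nbrs x) F y = \sum_(y <- nb x) F y.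
Proof. by rewrite fsbig_finite //; exact: nbrs_finite. Qed.

Lemma nb_size : exists N : nat, (0 < N)%N /\ forall x, (size (nb x) <= N)%N.
Proof.
have [N HN] := @wg_degree R G; exists N.+1; split => // x.
by apply: leqW; exact: (geq_card_fset_set (HN x)).
Qed.

Lemma adj_refl x : adj h x x.
Proof. by rewrite /adj eqxx orbT. Qed.

Lemma adj_sym x y : adj h x y = adj h y x.
Proof. by rewrite /adj wgh_sym eq_sym. Qed.

(** As [adj] is reflexive, a path from [x] to another vertex may stay at [x] for a while; the
    induction looks for the first step that moves. *)
Lemma exists_nbr x : exists y, y != x /\ adj h x y.
Proof.
have [y yx] : exists y, y != x.
  apply/not_existsP => H; apply: (@wg_infinite R G).
  apply: (@sub_finite_set _ _ [set x]); last exact: finite_set1.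
  by move=> y _ /=; apply/eqP; have := H y; case: (y == x).
have [p xp py] := @wg_connected R G x y.
elim: p xp py => [_ /= E|z p IH /= /andP[xz zp] E]; first by rewrite E eqxx in yx.
have [zx|zx] := eqVneq z x; last by exists z.
by rewrite zx in zp E; exact: IH.
Qed.

Lemma wgh_le_hmax x y : adj h x y -> h x y <= hmax x.
Proof.
move=> xy; apply: sup_upper_bound; last by exists y.
split; first by exists (h x y), y.
exists (\sum_(z <- nb x) h x z) => _ [z xz <-].
rewrite (big_rem z) ?mem_nb //= lerDl.
by apply: sumr_ge0 => ? _; exact: wgh_ge0.
Qed.

Lemma hmax_le : exists2 C : R, 1 <= C & forall x y, adj h x y -> y != x -> hmax x <= C * h x y.
Proof.
have [C C1 HC] := @wgh_ratio R G; exists C => // x y xy yx.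
have hxy : 0 < h x y by move: xy; rewrite /adj eq_sym (negbTE yx) orbF.
apply: ge_sup; first by exists (h x y), y.
move=> _ [z xz <-]; have [->|zx] := eqVneq z x.
  by rewrite wgh_diag mulr_ge0 // ?(ltW hxy) // (le_trans ler01).
by rewrite -ler_pdivrMr //; case/andP: (HC x z y xz xy zx yx).
Qed.

Lemma hmax_gt0 x : 0 < hmax x.
Proof.
have [y [yx xy]] := exists_nbr x.
apply: lt_le_trans (wgh_le_hmax xy).
by move: xy; rewrite /adj eq_sym (negbTE yx) orbF.
Qed.

Lemma path_length_cat x (p q : seq G) :
  path_length h x (p ++ q) = path_length h x p + path_length h (last x p) q.
Proof.
elim: p x => [|y p IH] x; first by rewrite /path_length big_nil add0r.
by rewrite /path_length /= !big_cons -addrA; congr (_ + _); exact: IH.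
Qed.

Lemma path_length_ge0 x (p : seq G) : 0 <= path_length h x p.
Proof.
elim: p x => [|y p IH] x; first by rewrite /path_length big_nil.
by rewrite /path_length /= big_cons addr_ge0 ?wgh_ge0 //; exact: IH.
Qed.

Lemma path_rev x (p : seq G) : path (adj h) x p ->
  exists q, [/\ path (adj h) (last x p) q, last (last x p) q = x &
    path_length h (last x p) q = path_length h x p].
Proof.
elim: p x => [|y p IH] x /=; first by exists [::].
move=> /andP[xy yp]; have [q [q1 q2 q3]] := IH y yp.
exists (rcons q x); rewrite rcons_path last_rcons q1 q2 /= adj_sym xy; split => //.
rewrite -cats1 path_length_cat q3 q2 /path_length /= !big_cons big_nil addr0.
by rewrite addrC wgh_sym.
Qed.

Lemma gdist_has_inf x y :
  has_inf [set path_length h x s | s in [set s | path (adj h) x s /\ last x s = y]].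
Proof.
split; last by exists 0 => _ [s _ <-]; exact: path_length_ge0.
by have [p xp py] := @wg_connected R G x y; exists (path_length h x p), p.
Qed.

Lemma gdist_le x y (s : seq G) : path (adj h) x s -> last x s = y ->
  gdist x y <= path_length h x s.
Proof. by move=> p l; apply: ge_inf; [case: (gdist_has_inf x y) | exists s]. Qed.

Lemma gdist_approx x y e : 0 < e -> exists s, [/\ path (adj h) x s, last x s = y &
  path_length h x s < gdist x y + e].
Proof. by move=> e0; have [_ [s [] ? ? <-] lt] := inf_adherent e0 (gdist_has_inf x y); exists s. Qed.

Lemma gdist_ge0 x y : 0 <= gdist x y.
Proof.
by apply: lb_le_inf; [case: (gdist_has_inf x y) | move=> _ [s _ <-]; exact: path_length_ge0].
Qed.

Lemma gdistxx x : gdist x x = 0.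
Proof.
apply/eqP; rewrite eq_le gdist_ge0 andbT.
by have := @gdist_le x x [::]; rewrite /path_length big_nil; exact.
Qed.

Lemma gdist_sym x y : gdist x y = gdist y x.
Proof.
suff le (u v : G) : gdist u v <= gdist v u by apply/eqP; rewrite eq_le !le.
apply/ler_addgt0Pr => e e0; have [s [p l E]] := gdist_approx v u e0.
have [q [q1 q2 q3]] := path_rev p; rewrite l in q1 q2 q3.
by apply: le_trans (gdist_le q1 q2) _; rewrite q3 ltW.
Qed.

Lemma gdist_triangle x y z : gdist x z <= gdist x y + gdist y z.
Proof.
apply/ler_addgt0Pr => e e0; have e2 : 0 < e / 2 by rewrite divr_gt0.
have [s [p1 l1 E1]] := gdist_approx x y e2; have [t [p2 l2 E2]] := gdist_approx y z e2.
apply: (@le_trans _ _ (path_length h x (s ++ t))).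
  by apply: gdist_le; rewrite ?cat_path ?last_cat l1 // p1.
by rewrite path_length_cat l1; lra.
Qed.

Lemma gdist_adj x y : adj h x y -> gdist x y <= h x y.
Proof.
move=> xy; have := @gdist_le x y [:: y]; rewrite /path_length /= andbT xy.
by rewrite big_cons big_nil addr0; exact.
Qed.

(** The first edge of a path that really leaves [x] already has length comparable to [hmax x].
    Consequently vertices are isolated, and small balls are single points. *)
Lemma gdist_hmax : exists2 c : R, 0 < c & forall x y, x != y -> c * hmax x <= gdist x y.
Proof.
have [C C1 HC] := hmax_le; have C0 : 0 < C by rewrite (lt_le_trans ltr01).
exists C^-1 => [|x y xy]; first by rewrite invr_gt0.
apply: lb_le_inf; first by case: (gdist_has_inf x y).
move=> _ [s [p l] <-]; elim: s p l => [_ /= E|z s IH /= /andP[xz zs] E].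
  by rewrite E eqxx in xy.
rewrite /path_length /= big_cons; have [zx|zx] := eqVneq z x.
  by rewrite zx wgh_diag add0r; rewrite zx in zs E; exact: IH.
rewrite -[leLHS]addr0 lerD //; last exact: path_length_ge0.
by rewrite ler_pdivrMl //; exact: HC.
Qed.

Lemma gball_center x r : 0 < r -> gball x r x.
Proof. by move=> r0; rewrite /gball /= gdistxx. Qed.

Lemma gball_small : exists2 c : R, 0 < c & forall x r, 0 < r -> r <= c * hmax x -> gball x r = [set x].
Proof.
have [c c0 Hc] := gdist_hmax; exists c => // x r r0 rx.
apply/seteqP; split => [y|y ->]; last exact: gball_center.
rewrite /gball /= => yr; apply/eqP; rewrite eq_sym; apply/negP => /negP /Hc.
by rewrite leNgt (lt_le_trans yr).
Qed.

Lemma massE x : mass x = \sum_(y <- nb x) mu x y.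
Proof. by rewrite /mass sum_nbrs. Qed.

Lemma mu_le_mass x y : adj h x y -> mu x y <= mass x.
Proof.
move=> xy; rewrite massE (big_rem y) ?mem_nb //= lerDl big_seq.
apply: sumr_ge0 => z /mem_rem; rewrite mem_nb => xz; exact/ltW/wgmu_gt0.
Qed.

Lemma mass_gt0 x : 0 < mass x.
Proof. exact: lt_le_trans (wgmu_gt0 (adj_refl x)) (mu_le_mass (adj_refl x)). Qed.

Lemma mass_ge0 x : 0 <= mass x.
Proof. exact/ltW/mass_gt0. Qed.

Lemma mass_adj : exists2 C : R, 0 < C & forall x y, adj h x y -> mass x <= C * mass y.
Proof.
have [C HC] := @wgmu_ratio R G; have [N [N0 HN]] := nb_size.
exists (N%:R * `|C| + 1) => [|x y xy]; first by rewrite ltr_wpDl // mulr_ge0.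
apply: (@le_trans _ _ (N%:R * `|C| * mu x y)).
  rewrite massE; apply: (@le_trans _ _ (\sum_(z <- nb x) `|C| * mu x y)).
    rewrite [leLHS]big_seq [leRHS]big_seq; apply: ler_sum => z; rewrite mem_nb => xz.
    by rewrite -ler_pdivrMr ?wgmu_gt0 // (le_trans (HC x z y xz xy)) // ler_norm.
  rewrite big_const_seq count_predT iter_addr_0 -[leLHS]mulr_natl -mulrA.
  by rewrite ler_wpM2r ?mulr_ge0 ?ler_nat ?HN ?(ltW (wgmu_gt0 xy)).
have yx : adj h y x by rewrite adj_sym.
rewrite (wgmu_sym xy) (le_trans (ler_wpM2l _ (mu_le_mass yx))) ?mulr_ge0 //.
by rewrite ler_wpM2r ?mass_ge0 // lerDl.
Qed.

End GraphGeometry.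

(** * The maximal function and its weak type inequality *)

Section MaximalFunction.
Variables (R : realType) (G : weighted_graph R).
Implicit Types (x y z : G) (r : R) (D : G -> R).

Lemma massS_ge0 (A : set G) : (0 <= massS A)%E.
Proof. by apply: esum_ge0 => x _; rewrite lee_fin mass_ge0. Qed.

Lemma massS_subset (A B : set G) : A `<=` B -> (massS A <= massS B)%E.
Proof. by move=> AB; apply: esum_subset => // x _; rewrite lee_fin mass_ge0. Qed.

Lemma massS1 x : massS [set x] = (mass x)%:E.
Proof. by rewrite /massS esum_set1 // lee_fin mass_ge0. Qed.

Lemma mass_le_vol x r : 0 < r -> ((mass x)%:E <= vol x r)%E.
Proof. by move=> r0; rewrite -massS1; apply: massS_subset => y ->; exact: gball_center. Qed.

(** A small ball is one vertex, of finite mass, and doubling carries finiteness over to the radii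
    [2 ^+ n * d]. *)
Lemma vol_fin_num x r : doubling G -> 0 < r -> vol x r \is a fin_num.
Proof.
move=> [C C0 HC] r0; rewrite ge0_fin_numE ?massS_ge0 //.
have [c c0 Hc] := gball_small G.
set d := c * hmax x; have d0 : 0 < d by rewrite mulr_gt0 ?hmax_gt0.
have H n : (vol x (2 ^+ n * d) < +oo)%E.
  elim: n => [|n IH].
    by rewrite expr0 mul1r /vol Hc // massS1 ltry.
  rewrite exprS -mulrA; apply: le_lt_trans (HC _ _ _) _; first by rewrite mulr_gt0 ?exprn_gt0.
  by rewrite lte_mul_pinfty // lee_fin ltW.
have [n hn] : exists n : nat, r <= 2 ^+ n * d.
  exists (Num.bound (r / d)); rewrite -ler_pdivrMr //.
  apply: le_trans (ltW (archi_boundP (divr_ge0 (ltW r0) (ltW d0)))) _.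
  by rewrite -natrX ler_nat ltnW // ltn_expl.
apply: le_lt_trans (H n); apply: massS_subset => y /= yr; exact: lt_le_trans yr hn.
Qed.

Definition volr x r : R := fine (vol x r).

Lemma volrE x r : doubling G -> 0 < r -> vol x r = (volr x r)%:E.
Proof. by move=> hD r0; rewrite /volr fineK // vol_fin_num. Qed.

Lemma volr_gt0 x r : doubling G -> 0 < r -> 0 < volr x r.
Proof.
move=> hD r0; rewrite -lte_fin -volrE //.
by apply: lt_le_trans (mass_le_vol x r0); rewrite lte_fin mass_gt0.
Qed.

Lemma volr_le x x' r r' : doubling G -> 0 < r -> 0 < r' -> gball x r `<=` gball x' r' ->
  volr x r <= volr x' r'.
Proof. by move=> hD r0 r'0 H; rewrite -lee_fin -!volrE //; exact: massS_subset. Qed.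

Lemma volr_doubling : doubling G -> exists2 C : R, 1 <= C &
  forall x r, 0 < r -> volr x (2 * r) <= C * volr x r.
Proof.
move=> hD; have [C C0 HC] := hD; exists (C + 1) => [|x r r0]; first by rewrite lerDr ltW.
have r20 : 0 < 2 * r by rewrite mulr_gt0.
have := HC x r r0; rewrite !volrE // -EFinM lee_fin => /le_trans; apply.
by rewrite ler_wpM2r ?(ltW (volr_gt0 _ _ _)) // lerDl.
Qed.

Lemma gballS x y r r' : gdist x y + r <= r' -> gball y r `<=` gball x r'.
Proof.
move=> H z; rewrite /gball /= => zr; apply: lt_le_trans H.
by apply: le_lt_trans (gdist_triangle x y z) _; rewrite ltrD2l.
Qed.

Lemma exists_argmax (T : eqType) (f : T -> R) (s : seq T) : s != [::] ->
  exists2 x : T, x \in s & forall y : T, y \in s -> f y <= f x.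
Proof.
elim: s => // a [|b s] IH _.
  by exists a; rewrite ?mem_head // => y; rewrite inE => /eqP ->.
have [//|x xs Hx] := IH; have [fa|fa] := leP (f a) (f x).
  exists x; first by rewrite inE xs orbT.
  by move=> y; rewrite inE => /predU1P[->//|/Hx].
exists a; first exact: mem_head.
move=> y; rewrite inE => /predU1P[->//|/Hx yx]; exact: le_trans yx (ltW fa).
Qed.

(* Vitali's greedy selection: the ball of largest radius is handled first, the
   balls meeting it have their centres in its double. *)
Lemma vitali_covering (C K : R) (r : G -> R) (phi : G -> \bar R) :
  doubling G -> 0 <= C -> 0 <= K ->
  (forall x r, 0 < r -> volr x (2 * r) <= C * volr x r) ->
  (forall x, 0 <= phi x)%E ->
  forall (s : seq G) (A : set G), uniq s ->
  (forall x, x \in s -> [/\ 0 < r x, gball x (r x) `<=` A &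
     (vol x (r x) <= K%:E * \esum_(y in gball x (r x)) phi y)%E]) ->
  (\sum_(x <- s) (mass x)%:E <= (C * K)%:E * \esum_(y in A) phi y)%E.
Proof.
move=> hD C0 K0 HC phi0 s; have [n] := ubnP (size s); elim: n s => // n IH s sn A us Hs.
have [->|s0] := eqVneq s [::].
  by rewrite big_nil mule_ge0 ?lee_fin ?mulr_ge0 // esum_ge0.
have [x0 x0s Hmax] := exists_argmax r s0.
have [r0 B0A Hv] := Hs x0 x0s; set B0 := gball x0 (r x0) in B0A Hv.
(* Only centres have to be covered. Those near [x0] are charged to the sum of [phi] over [B0]; the
   balls of the others avoid [B0], so the induction hypothesis charges them to [A] minus [B0]. *)
rewrite (bigID (fun x => gdist x0 x < 2 * r x0)) /=.
rewrite (esumID B0 A) // setIidr // ge0_muleDr ?esum_ge0 //.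
apply: leeD.
  apply: (@le_trans _ _ (vol x0 (2 * r x0))).
    by rewrite -big_filter; apply: le_esum_uniq; [exact: filter_uniq | move=> x; rewrite mem_filter => /andP[]].
  have r20 : 0 < 2 * r x0 by rewrite mulr_gt0.
  apply: (@le_trans _ _ (C%:E * vol x0 (r x0))%E).
    by rewrite !volrE // -EFinM lee_fin HC.
  by rewrite EFinM -muleA lee_wpmul2l // lee_fin.
rewrite -big_filter; apply: IH.
- rewrite ltnS in sn; apply: leq_trans _ sn.
  rewrite size_filter -[X in (_ < X)%N](count_predC (fun x => ~~ (gdist x0 x < 2 * r x0)) s).
  rewrite -[X in (X < _)%N]addn0 ltn_add2l -has_count; apply/hasP; exists x0 => //=.
  by rewrite negbK gdistxx mulr_gt0.
- exact: filter_uniq.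
move=> x; rewrite mem_filter -leNgt => /andP[far xs]; have [rx BA Hx] := Hs x xs; split => //.
move=> y yB; split; [exact: BA | move=> yB0; move: far; apply/negP; rewrite -ltNge].
apply: le_lt_trans (gdist_triangle x0 y x) _; rewrite mulrDl mul1r.
apply: ltrD; first exact: yB0.
by rewrite gdist_sym (lt_le_trans yB) // Hmax.
Qed.

(** Centred maximal function of [D ^ q], with the average multiplied by the volume so that no
    quotient of extended reals occurs. *)
Definition maximal_set q D (l : R) : set G := [set x | exists2 r : R, 0 < r &
  ((l `^ q)%:E * vol x r < \esum_(y in gball x r) (D y `^ q * mass y)%:E)%E].

(** The truncation makes the weak type inequality summable over the levels: a vertex contributes
    nothing to the levels that are high compared with its value of [D]. *)
Definition above q D (l : R) y : \bar R := if l < D y then (D y `^ q * mass y)%:E else 0%E.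

Lemma above_ge0 q D l y : (0 <= above q D l y)%E.
Proof. by rewrite /above; case: ifP => // _; rewrite lee_fin mulr_ge0 ?powR_ge0 ?mass_ge0. Qed.

(** On a ball selected for the level [l], the values [D y <= l / 2] account for at most half of
    [l ^ q] times the volume, because [q >= 1]. The values above [l / 2] therefore carry the other
    half, hence the factor 2, and [vitali_covering] applies to them. *)
Lemma maximal_weak_type : doubling G -> exists2 C : R, 0 < C &
  forall q D l, 1 <= q -> (forall x, 0 <= D x) -> 0 < l ->
  (massS (maximal_set q D l) <= (C / l `^ q)%:E * \esum_(y in [set: G]) above q D (l / 2) y)%E.
Proof.
move=> hD; have [C C1 HC] := volr_doubling hD; have C0 := lt_le_trans ltr01 C1.
exists (C * 2) => [|q D l q1 D0 l0]; first by rewrite mulr_gt0.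
have q0 := lt_le_trans ltr01 q1.
have lq : 0 < l `^ q by rewrite powR_gt0.
have [r Hr] : {r : G -> R & forall x, maximal_set q D l x -> 0 < r x /\
   ((l `^ q)%:E * vol x (r x) < \esum_(y in gball x (r x)) (D y `^ q * mass y)%:E)%E}.
  apply: (@choice _ _ (fun x (r : R) => maximal_set q D l x -> 0 < r /\
   ((l `^ q)%:E * vol x r < \esum_(y in gball x r) (D y `^ q * mass y)%:E)%E)) => x.
  by have [[r r0 Hr]|h] := pselect (maximal_set q D l x); [exists r | exists 0].
apply: esum_le_uniq => s us sA; rewrite -mulrA.
apply: (vitali_covering hD (ltW C0) (r := r)) => //.
- by rewrite divr_ge0 // ltW.
- exact: above_ge0.
move=> x /sA /Hr[r0 Hx]; split => //.
rewrite volrE // in Hx *; set X := esum _ _.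
have X0 : (0 <= X)%E by apply: esum_ge0 => y _; exact: above_ge0.
have HX : (\esum_(y in gball x (r x)) (D y `^ q * mass y)%:E <=
    X + (l `^ q / 2 * volr x (r x))%:E)%E.
  have -> : ((l `^ q / 2 * volr x (r x))%:E = \esum_(y in gball x (r x)) ((l `^ q / 2)%:E * (mass y)%:E))%E.
    rewrite esumZl ?divr_ge0 ?powR_ge0 //; last by move=> y _; rewrite lee_fin mass_ge0.
    by rewrite EFinM -volrE.
  rewrite -esumD //; first last.
  - by move=> y _; rewrite -EFinM lee_fin mulr_ge0 ?mass_ge0 ?divr_ge0 ?powR_ge0.
  - by move=> y _; exact: above_ge0.
  apply: le_esum => y _; rewrite /above; case: ltP => Dy.
    by rewrite leeDl // -EFinM lee_fin mulr_ge0 ?mass_ge0 ?divr_ge0 ?powR_ge0.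
  rewrite add0e -EFinM lee_fin ler_wpM2r ?mass_ge0 //.
  apply: (@le_trans _ _ ((l / 2) `^ q)).
    by apply: ge0_ler_powR; rewrite ?nnegrE ?D0 ?divr_ge0 ?(ltW l0) ?(ltW q0).
  rewrite powRM ?invr_ge0 ?(ltW l0) // ler_wpM2l ?powR_ge0 //.
  rewrite -(powR_inv1 (ler0n R 2)) powRAC !powR_inv1 ?powR_ge0 //.
  by rewrite lef_pV2 ?posrE ?powR_gt0 // -[leLHS]powRr1 // ler_powR // ler1n.
have {HX}Hx := lt_le_trans Hx HX.
case: X X0 Hx => [X| |] //; last first.
  by move=> _ _; rewrite gt0_muley ?leey // lte_fin divr_gt0.
rewrite -!EFinM -EFinD lte_fin !lee_fin => X0 Hx.
rewrite mulrAC ler_pdivlMr //; lra.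
Qed.

(** Double counting over adjacent pairs: a vertex of [A] has at most [N] neighbours, each of mass at
    most [C] times its own. *)
Lemma massS_nbr : exists2 C : R, 0 < C & forall A : set G,
  (massS [set x | exists2 y, A y & adj (@wgh R G) x y] <= C%:E * massS A)%E.
Proof.
have [C C0 HC] := mass_adj G; have [N [N0 HN]] := nb_size G.
exists (N%:R * C) => [|A]; first by rewrite mulr_gt0 ?ltr0n.
pose a x y : \bar R := if adj (@wgh R G) x y then (C * mass y)%:E else 0%E.
have a0 x y : (0 <= a x y)%E.
  by rewrite /a; case: ifP => // _; rewrite lee_fin mulr_ge0 ?mass_ge0 // ltW.
apply: (@le_trans _ _ (\esum_(x in [set x | exists2 y, A y & adj (@wgh R G) x y]) \esum_(y in A) a x y)%E).
  apply: le_esum => x [y Ay xy]; apply: (@le_trans _ _ (a x y)).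
    by rewrite /a xy lee_fin HC.
  rewrite (_ : a x y = \sum_(z <- [:: y]) a x z)%E; last by rewrite big_seq1.
  apply: le_esum_uniq => // z.
  by rewrite inE => /eqP ->.
rewrite esum_exchange // /massS -esumZl ?mulr_ge0 ?(ltW C0) //; last first.
  by move=> y _; rewrite lee_fin mass_ge0.
apply: le_esum => y _; apply: esum_le_uniq => s us _.
rewrite /a -big_mkcond /= -big_filter big_const_seq count_predT.
have -> n : iter n (+%E (C * mass y)%:E) 0%E = (n%:R * (C * mass y))%:E.
  elim: n => [|n IH] /=; first by rewrite mul0r.
  by rewrite IH -EFinD -natr1 mulrDl mul1r addrC.
rewrite -EFinM -mulrA lee_fin ler_wpM2r ?mulr_ge0 ?mass_ge0 ?(ltW C0) // ler_nat.
apply: leq_trans (HN y); apply: uniq_leq_size; first exact: filter_uniq.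
by move=> x; rewrite mem_filter mem_nb adj_sym => /andP[].
Qed.

End MaximalFunction.

(** * Geometric sums over dyadic levels *)

Section Dyadic.
Variable R : realType.
Implicit Types (a b c tau P K : R) (k : int).

Lemma ler_sum_uniq_sub (T : eqType) (s t : seq T) (F : T -> R) :
  uniq s -> uniq t -> {subset s <= t} -> (forall x, 0 <= F x) ->
  \sum_(x <- s) F x <= \sum_(x <- t) F x.
Proof.
move=> us ut st F0; rewrite [leRHS](bigID (mem s)) /= -(big_filter t).
have -> : \sum_(i <- [seq i <- t | i \in s]) F i = \sum_(x <- s) F x.
  apply: perm_big; apply: uniq_perm => //; first exact: filter_uniq.
  by move=> x; rewrite mem_filter; apply/andP/idP => [[]//|xs]; split => //; exact: st.
by rewrite lerDl sumr_ge0.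
Qed.

Lemma geometric_le (rho : R) n : 0 <= rho < 1 -> \sum_(0 <= j < n) rho ^+ j <= (1 - rho)^-1.
Proof.
move=> /andP[r0 r1]; have d0 : 0 < 1 - rho by rewrite subr_gt0.
have -> : \sum_(0 <= j < n) rho ^+ j = (1 - rho ^+ n) / (1 - rho).
  elim: n => [|n IH]; first by rewrite big_geq // expr0 subrr mul0r.
  by rewrite big_nat_recr //= IH exprS; field; rewrite gt_eqF.
by rewrite ler_pdivrMr // mulVf ?gt_eqF // gerBl exprn_ge0.
Qed.

(** Sum of the geometric series of ratio [2 ^ (- a)], by which a sum of distinct powers of [2 ^ a]
    can exceed its largest term. *)
Definition dyad_const a : R := (1 - 2 `^ (- a))^-1.

Lemma dyad_ratio a : 0 < a -> 0 <= (2 : R) `^ (- a) < 1.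
Proof.
move=> a0; rewrite powR_ge0 /= /powR pnatr_eq0 /= expR_lt1 mulNr oppr_lt0.
by rewrite mulr_gt0 // ln_gt0 // ltr1n.
Qed.

Lemma dyad_const_gt0 a : 0 < a -> 0 < dyad_const a.
Proof. by move=> /dyad_ratio /andP[_ h]; rewrite invr_gt0 subr_gt0. Qed.

Lemma dyad_sum_le a (s : seq int) k0 : 0 < a -> uniq s -> (forall k, k \in s -> k <= k0) ->
  \sum_(k <- s) 2 `^ (k%:~R * a) <= dyad_const a * 2 `^ (k0%:~R * a).
Proof.
move=> a0 us sk; set rho : R := 2 `^ (- a).
have E k : k \in s -> (2 : R) `^ (k%:~R * a) = rho ^+ `|k0 - k|%N * 2 `^ (k0%:~R * a).
  move=> /sk kk; rewrite -powR_mulrn ?powR_ge0 // -powRrM -powRD; last by rewrite pnatr_eq0 implybT.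
  congr (_ `^ _); have -> : (`|k0 - k|%N)%:R = (k0 - k)%:~R :> R.
    by rewrite -[in RHS](@gez0_abs (k0 - k)) ?subr_ge0.
  by rewrite intrB; ring.
rewrite big_seq (eq_bigr _ E) -big_seq -mulr_suml ler_wpM2r ?powR_ge0 //.
set t := [seq `|k0 - k|%N | k <- s].
have -> : \sum_(k <- s) rho ^+ `|k0 - k|%N = \sum_(j <- t) rho ^+ j by rewrite big_map.
have ut : uniq t.
  rewrite map_inj_in_uniq // => k k' ks ks' /(congr1 Posz).
  by rewrite !gez0_abs ?subr_ge0 ?sk // => /addrI /oppr_inj.
apply: le_trans (geometric_le (\max_(j <- t) j).+1 (dyad_ratio a0)).
apply: ler_sum_uniq_sub => //; first exact: iota_uniq.
  by move=> j jt; rewrite mem_index_iota /= ltnS; exact: leq_bigmax_seq.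
by move=> j; rewrite exprn_ge0 // powR_ge0.
Qed.

Lemma seq_int_max (s : seq int) : s != [::] -> exists2 k, k \in s & forall k', k' \in s -> k' <= k.
Proof.
elim: s => // a [|b s] IH _.
  by exists a; rewrite ?mem_head // => y; rewrite inE => /eqP ->.
have [//|x xs Hx] := IH; have [fa|fa] := leP a x.
  exists x; first by rewrite inE xs orbT.
  by move=> y; rewrite inE => /predU1P[->//|/Hx].
exists a; first exact: mem_head.
move=> y; rewrite inE => /predU1P[->//|/Hx yx]; exact: le_trans yx (ltW fa).
Qed.

Lemma dyad_esum_le a b tau : 0 < a -> 0 < tau -> 0 <= b ->
  (\esum_(k in [set k : int | (tau * 2 `^ k%:~R < b)%R]) (2 `^ (k%:~R * a))%:E
    <= (dyad_const a * (b / tau) `^ a)%:E)%E.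
Proof.
move=> a0 t0 b0; apply: esum_le_uniq => s us sb; rewrite sumEFin lee_fin.
have [->|/seq_int_max[k ks Hk]] := eqVneq s [::].
  by rewrite big_nil mulr_ge0 ?powR_ge0 // ltW ?dyad_const_gt0.
apply: le_trans (dyad_sum_le a0 us Hk) _; rewrite ler_wpM2l ?(ltW (dyad_const_gt0 a0)) //.
rewrite powRrM; apply: ge0_ler_powR; rewrite ?nnegrE ?powR_ge0 ?divr_ge0 ?(ltW a0) ?(ltW t0) //.
by rewrite ler_pdivlMr // mulrC ltW //; exact: sb.
Qed.

(** The left sum is comparable to its largest term, whose [P]-th power is one of the terms on the
    right. This takes the power inside the sum for every [P > 0], at the price of a constant
    independent of [s]. *)
Lemma dyad_sum_powR_le a P (s : seq int) : 0 < a -> 0 < P -> uniq s ->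
  (\sum_(k <- s) 2 `^ (k%:~R * a)) `^ P <=
  dyad_const a `^ P * \sum_(k <- s) 2 `^ (k%:~R * (a * P)).
Proof.
move=> a0 P0 us.
have [->|/seq_int_max[k ks Hk]] := eqVneq s [::].
  by rewrite !big_nil powR0 ?gt_eqF // mulr0.
apply: (@le_trans _ _ ((dyad_const a * 2 `^ (k%:~R * a)) `^ P)).
  apply: ge0_ler_powR; rewrite ?nnegrE ?(ltW P0) ?mulr_ge0 ?powR_ge0 ?(ltW (dyad_const_gt0 a0)) //.
    by apply: sumr_ge0 => ? _; exact: powR_ge0.
  exact: dyad_sum_le.
rewrite powRM ?powR_ge0 ?(ltW (dyad_const_gt0 a0)) // ler_wpM2l ?powR_ge0 //.
rewrite -powRrM -mulrA (big_rem k) //= lerDl.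
by apply: sumr_ge0 => ? _; exact: powR_ge0.
Qed.

End Dyadic.

(** * Lipschitz truncation *)

Section LipschitzTruncation.
Variables (R : realType) (G : weighted_graph R).
Implicit Types (x y z : G) (r l : R) (D : G -> R) (f g : G -> R[i]^o).

Lemma grad_ge0 f x : 0 <= grad f x.
Proof. by rewrite mulr_ge0 ?sqrtr_ge0 // invr_ge0 ltW ?hmax_gt0. Qed.

Lemma not_maximal q D l x r : ~ maximal_set q D l x -> 0 < r ->
  (\esum_(y in gball x r) (D y `^ q * mass y)%:E <= (l `^ q)%:E * vol x r)%E.
Proof. by move=> h r0; rewrite leNgt; apply/negP => lt; apply: h; exists r. Qed.

Lemma powR_add_le q (a b : R) : 0 <= q -> 0 <= a -> 0 <= b ->
  (a + b) `^ q <= 2 `^ q * (a `^ q + b `^ q).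
Proof.
move=> q0 a0 b0; wlog ab : a b a0 b0 / a <= b.
  move=> H; have [ab|/ltW ba] := leP a b; first exact: H.
  by rewrite addrC [X in _ * X]addrC; exact: H.
apply: (@le_trans _ _ ((2 * b) `^ q)).
  by apply: ge0_ler_powR; rewrite ?nnegrE ?addr_ge0 ?mulr_ge0 // mulrDl mul1r lerD2r.
by rewrite powRM // ler_wpM2l ?powR_ge0 // lerDr powR_ge0.
Qed.

Lemma ler_powR_inv q (a b : R) : 0 < q -> 0 <= a -> 0 <= b -> a `^ q <= b `^ q -> a <= b.
Proof.
move=> q0 a0 b0; rewrite leNgt => /negP ab; rewrite leNgt; apply/negP => ba; apply: ab.
by apply: gt0_ltr_powR; rewrite ?nnegrE.
Qed.

Lemma le_powR_self q (a : R) : 1 <= q -> 1 <= a -> a <= a `^ q.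
Proof. by move=> q1 a1; rewrite -[leLHS]powRr1 ?(le_trans ler01) // ler_powR. Qed.

(** Averages are compared only through this lemma: two constants close to [f] in mean over the same
    set are close to each other. The constant is 4 because [2 ^ q * 2 <= 4 ^ q] for [q >= 1]. *)
Lemma close_constants (B : set G) (v q K : R) f (c c' : R[i]) :
  1 <= q -> massS B = v%:E -> 0 < v -> 0 <= K ->
  (\esum_(y in B) (normc (f y - c) `^ q * mass y)%:E <= (K `^ q * v)%:E)%E ->
  (\esum_(y in B) (normc (f y - c') `^ q * mass y)%:E <= (K `^ q * v)%:E)%E ->
  normc (c - c') <= 4 * K.
Proof.
move=> q1 Bv v0 K0 H1 H2; have q0 := lt_le_trans ltr01 q1.
set a := normc (c - c'); have a0 : 0 <= a := cnorm_ge0 _.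
apply: (ler_powR_inv q0); rewrite ?mulr_ge0 //.
rewrite -(ler_pM2r v0) -lee_fin.
have -> : ((a `^ q * v)%:E = \esum_(y in B) ((a `^ q)%:E * (mass y)%:E))%E.
  by rewrite esumZl ?powR_ge0 ?EFinM -?Bv // => y _; rewrite lee_fin mass_ge0.
apply: (@le_trans _ _ (\esum_(y in B) ((2 `^ q)%:E *
    ((normc (f y - c) `^ q * mass y)%:E + (normc (f y - c') `^ q * mass y)%:E)))%E).
  apply: le_esum => y _; rewrite -EFinD -!EFinM lee_fin -mulrDl mulrA ler_wpM2r ?mass_ge0 //.
  apply: le_trans (powR_add_le (ltW q0) (cnorm_ge0 _) (cnorm_ge0 _)).
  apply: ge0_ler_powR; rewrite ?nnegrE ?addr_ge0 ?cnorm_ge0 ?(ltW q0) //.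
  rewrite /a [normc (f y - c)]cdistC; have -> : c - c' = (c - f y) + (f y - c') by rewrite addrA subrK.
  exact: cnormD.
have nn (d : R[i]) y : (0 <= (normc (f y - d) `^ q * mass y)%:E)%E.
  by rewrite lee_fin mulr_ge0 ?powR_ge0 ?mass_ge0.
rewrite esumZl ?powR_ge0 //; last by move=> y _; rewrite adde_ge0.
rewrite esumD //.
apply: le_trans (lee_wpmul2l _ (leeD H1 H2)) _; first by rewrite lee_fin powR_ge0.
rewrite -EFinD -EFinM lee_fin.
have -> : 2 `^ q * (K `^ q * v + K `^ q * v) = (2 * 2 `^ q) * K `^ q * v by ring.
have -> : (4 : R) = 2 * 2 by ring.
rewrite ler_wpM2r ?(ltW v0) // powRM ?mulr_ge0 // ler_wpM2r ?powR_ge0 //.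
by rewrite powRM // ler_wpM2r ?powR_ge0 // le_powR_self // ler1n.
Qed.

(** Off the maximal set the right-hand side of the Poincare inequality is at most [Cp (r l)^q] times
    the volume. Passing to a part [B] of the ball, of mass [v], costs the factor [c], which goes
    inside the power since [c >= 1] and [q >= 1]. *)
Lemma ball_oscillation q (A Cp c v : R) f D l x r (B : set G) :
  doubling G -> 1 <= q -> 0 <= Cp -> Cp <= A `^ q -> 0 <= A -> 1 <= c ->
  (forall x r f, 0 < r ->
    (\esum_(y in gball x r) (normc (f y - average (gball x r) f) `^ q * mass y)%:E
      <= (Cp * r `^ q)%:E * \esum_(y in gball x r) (grad f y `^ q * mass y)%:E)%E) ->
  (forall x, grad f x <= D x) -> 0 < l -> ~ maximal_set q D l x -> 0 < r ->
  B `<=` gball x r -> 0 < v -> volr x r <= c * v ->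
  (\esum_(y in B) (normc (f y - average (gball x r) f) `^ q * mass y)%:E
    <= ((c * A * r * l) `^ q * v)%:E)%E.
Proof.
move=> hD q1 Cp0 CpA A0 c1 HP HD l0 xO r0 BB v0 Vv.
have q0 := lt_le_trans ltr01 q1; have c0 := lt_le_trans ltr01 c1.
apply: le_trans (esum_subset BB _) _.
  by move=> y _; rewrite lee_fin mulr_ge0 ?powR_ge0 ?mass_ge0.
apply: le_trans (HP x r f r0) _.
have E : (\esum_(y in gball x r) (grad f y `^ q * mass y)%:E <= (l `^ q * (c * v))%:E)%E.
  apply: (@le_trans _ _ ((l `^ q)%:E * vol x r)%E); last first.
    by rewrite volrE // -EFinM lee_fin ler_wpM2l ?powR_ge0.
  apply: le_trans (not_maximal xO r0); apply: le_esum => y _; rewrite lee_fin.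
  rewrite ler_wpM2r ?mass_ge0 //; apply: ge0_ler_powR; rewrite ?nnegrE ?(ltW q0) ?grad_ge0 //.
  exact: le_trans (grad_ge0 f y) (HD y).
apply: le_trans (lee_wpmul2l _ E) _; first by rewrite lee_fin mulr_ge0 ?powR_ge0.
rewrite -EFinM lee_fin !powRM ?mulr_ge0 ?(ltW c0) ?(ltW r0) ?(ltW l0) //.
have -> : Cp * r `^ q * (l `^ q * (c * v)) = c * Cp * (r `^ q * l `^ q * v) by ring.
have -> : c `^ q * A `^ q * r `^ q * l `^ q * v = c `^ q * A `^ q * (r `^ q * l `^ q * v) by ring.
rewrite ler_wpM2r ?mulr_ge0 ?powR_ge0 ?(ltW v0) //.
by apply: ler_pM; rewrite ?(ltW c0) ?le_powR_self.
Qed.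

Lemma small_radius x : exists2 d, 0 < d & forall r, 0 < r -> r <= d -> gball x r = [set x].
Proof.
have [c c0 Hc] := gball_small G; exists (c * hmax x) => [|r r0 rd]; last exact: Hc.
by rewrite mulr_gt0 ?hmax_gt0.
Qed.

(** Discrete form of Lebesgue's differentiation theorem: on a ball reduced to [x] the average of
    [D ^ q] is its value at [x]. *)
Lemma maximal_pointwise q D l x : doubling G -> 1 <= q -> (forall x, 0 <= D x) -> 0 < l ->
  ~ maximal_set q D l x -> D x <= l.
Proof.
move=> hD q1 D0 l0 xO; have q0 := lt_le_trans ltr01 q1.
have [d d0 Hd] := small_radius x.
have := not_maximal xO d0; rewrite /vol Hd // esum_set1; last first.
  by rewrite lee_fin mulr_ge0 ?powR_ge0 ?mass_ge0.
rewrite massS1 -EFinM lee_fin ler_pM2r ?mass_gt0 //.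
by apply: ler_powR_inv => //; exact: ltW.
Qed.

(* Telescoping of the averages over dyadic balls centred at [x]; the value of
   [average] only matters through the Poincare inequality. *)
Lemma maximal_lipschitz q : doubling G -> 1 <= q -> poincare G q ->
  exists2 C : R, 0 < C & forall f D l, (forall x, grad f x <= D x) -> 0 < l ->
  forall x y, ~ maximal_set q D l x -> ~ maximal_set q D l y ->
  normc (f x - f y) <= C * l * gdist x y.
Proof.
move=> hD q1 [Cp Cp0 HP]; have [C C1 HC] := volr_doubling hD.
have q0 := lt_le_trans ltr01 q1; have C0 := lt_le_trans ltr01 C1.
set A := Cp + 1; have A1 : 1 <= A by rewrite lerDr ltW.
have A0 := lt_le_trans ltr01 A1.
have CpA : Cp <= A `^ q by apply: le_trans (le_powR_self q1 A1); rewrite lerDl.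
exists (64 * C ^+ 2 * A) => [|f D l HD l0]; first by rewrite !mulr_gt0 ?exprn_gt0.
have osc x r B c v c1 := @ball_oscillation q A Cp c v f D l x r B hD q1 (ltW Cp0) CpA (ltW A0) c1 HP HD l0.
pose av x r := average (gball x r) f.
(* The telescoping is finite, as it starts from balls reduced to [x]. The constant 8 reproduces
   itself when the radius is halved: [8 / 2 + 4 = 8]. *)
have chain x : ~ maximal_set q D l x -> forall r, 0 < r -> normc (f x - av x r) <= 8 * C * A * l * r.
  move=> xO; have [d d0 Hd] := small_radius x.
  have H n : forall r, 0 < r -> r <= 2 ^+ n * d -> normc (f x - av x r) <= 8 * C * A * l * r.
    elim: n => [|n IH] r r0 rd.
      rewrite expr0 mul1r in rd.
      have vE : volr x r = mass x by rewrite /volr /vol Hd // massS1.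
      apply: (@le_trans _ _ (4 * (1 * A * r * l))).
        apply: (@close_constants [set x] (mass x) q (1 * A * r * l) f) => //.
        - exact: massS1.
        - exact: mass_gt0.
        - by rewrite !mulr_ge0 // ltW.
        - rewrite esum_set1 subrr cnorm0 powR0 ?gt_eqF // mul0r //.
          by rewrite lee_fin mulr_ge0 ?powR_ge0 ?mass_ge0.
        - apply: osc => //; rewrite ?mass_gt0 ?vE ?mul1r //.
          by rewrite Hd.
      have -> : 4 * (1 * A * r * l) = (4 * 1) * (A * l * r) by ring.
      have -> : 8 * C * A * l * r = (8 * C) * (A * l * r) by ring.
      rewrite ler_wpM2r ?mulr_ge0 ?(ltW A0) ?(ltW l0) ?(ltW r0) //; lra.
    have r2 : 0 < r / 2 by rewrite divr_gt0.
    have rE : r = 2 * (r / 2) by field.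
    have sub : gball x (r / 2) `<=` gball x r.
      by apply: gballS; rewrite gdistxx add0r; lra.
    have h1 : normc (f x - av x (r / 2)) <= 8 * C * A * l * (r / 2).
      by apply: IH => //; rewrite ler_pdivrMr // mulrAC -exprSr.
    have h2 : normc (av x (r / 2) - av x r) <= 4 * (C * A * r * l).
      apply: (@close_constants (gball x (r / 2)) (volr x (r / 2)) q _ f) => //.
      - exact: volrE.
      - exact: volr_gt0.
      - by rewrite !mulr_ge0 // ltW.
      - have := osc x (r / 2) _ 1 _ (lexx 1) xO r2 (@subset_refl _ _) (volr_gt0 x hD r2).
        rewrite !mul1r => /(_ (lexx _)) /le_trans; apply.
        rewrite lee_fin ler_wpM2r ?(ltW (volr_gt0 _ _ _)) //.
        apply: ge0_ler_powR; rewrite ?nnegrE ?mulr_ge0 ?(ltW q0) ?(ltW A0) ?(ltW C0) ?(ltW r2) ?(ltW r0) ?(ltW l0) //.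
        rewrite ler_wpM2r ?(ltW l0) // -mulrA [C * _]mulrCA ler_wpM2l ?(ltW A0) //.
        by move: C1 r0; clear; nra.
      - apply: osc => //; first exact: volr_gt0.
        by rewrite {1}rE HC.
    have -> : f x - av x r = (f x - av x (r / 2)) + (av x (r / 2) - av x r) by rewrite addrA subrK.
    apply: le_trans (cnormD _ _) _; apply: le_trans (lerD h1 h2) _.
    by rewrite le_eqVlt; apply/orP; left; apply/eqP; field.
  move=> r r0; have [n hn] : exists n : nat, r <= 2 ^+ n * d.
    exists (Num.bound (r / d)); rewrite -ler_pdivrMr //.
    apply: le_trans (ltW (archi_boundP (divr_ge0 (ltW r0) (ltW d0)))) _.
    by rewrite -natrX ler_nat ltnW // ltn_expl.
  exact: H hn.
move=> x y xO yO; have [->|xy] := eqVneq x y.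
  by rewrite subrr cnorm0 gdistxx mulr0.
set d := gdist x y; have d0 : 0 < d.
  by have [c c0 Hc] := gdist_hmax G; apply: lt_le_trans (Hc x y xy); rewrite mulr_gt0 ?hmax_gt0.
(* The ball of centre [y] and radius [2 d] lies in that of centre [x] and radius [4 d], which in
   turn lies in the ball of centre [y] and radius [8 d]; these two doublings give the factor
   [C ^+ 2] in [h3]. *)
set r := 2 * d; have r0 : 0 < r by rewrite mulr_gt0.
have r20 : 0 < 2 * r by rewrite mulr_gt0.
have h1 := chain x xO (2 * r) r20; have h2 := chain y yO r r0.
have h3 : normc (av y r - av x (2 * r)) <= 4 * (C ^+ 2 * A * (2 * r) * l).
  have C21 : 1 <= C ^+ 2 by apply: exprn_ege1.
  apply: (@close_constants (gball y r) (volr y r) q _ f) => //.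
  - exact: volrE.
  - exact: volr_gt0.
  - by rewrite !mulr_ge0 ?exprn_ge0 // ltW.
  - have := osc y r _ 1 _ (lexx 1) yO r0 (@subset_refl _ _) (volr_gt0 y hD r0).
    rewrite !mul1r => /(_ (lexx _)) /le_trans; apply.
    rewrite lee_fin ler_wpM2r ?(ltW (volr_gt0 _ _ _)) //.
    apply: ge0_ler_powR; rewrite ?nnegrE ?mulr_ge0 ?exprn_ge0 ?(ltW q0) ?(ltW A0) ?(ltW C0) ?(ltW d0) ?(ltW l0) //.
    rewrite ler_wpM2r ?(ltW l0) // -mulrA [C ^+ 2 * _]mulrCA ler_wpM2l ?(ltW A0) //.
    by move: C21 r0; clear; nra.
  - apply: osc => //; rewrite ?volr_gt0 //.
      by apply: gballS; rewrite /r -/d; lra.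
    apply: (@le_trans _ _ (volr y (2 * (2 * r)))).
      apply: volr_le; rewrite ?mulr_gt0 //.
      by apply: gballS; rewrite gdist_sym -/d /r; lra.
    apply: le_trans (HC _ _ r20) _; rewrite expr2 -mulrA ler_wpM2l ?(ltW C0) //.
    exact: HC.
have -> : f x - f y = (f x - av x (2 * r)) - (f y - av y r) - (av y r - av x (2 * r)) by ring.
apply: le_trans (cnormB _ _) _; apply: le_trans (lerD (cnormB _ _) h3) _.
apply: le_trans (lerD (lerD h1 h2) (lexx _)) _.
have -> : 8 * C * A * l * (2 * r) + 8 * C * A * l * r + 4 * (C ^+ 2 * A * (2 * r) * l) =
  (24 * C + 8 * C ^+ 2) * (A * l * r) by ring.
have -> : 64 * C ^+ 2 * A * l * d = (32 * C ^+ 2) * (A * l * r) by rewrite /r; ring.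
rewrite ler_wpM2r ?mulr_ge0 ?(ltW A0) ?(ltW l0) ?(ltW d0) //.
by move: C1; clear; nra.
Qed.

(** McShane's infimum of the cones [phi y + L d(x, y)], clipped to [[- M, M]]: clipping changes
    neither the values on [A] nor the Lipschitz constant. If [A] is empty the infimum is
    meaningless, and 0 is taken instead. *)
Lemma real_lipschitz_extension (A : set G) (phi : G -> R) (L M : R) :
  0 <= L -> 0 <= M -> (forall x, A x -> `|phi x| <= M) ->
  (forall x y, A x -> A y -> `|phi x - phi y| <= L * gdist x y) ->
  exists g : G -> R, [/\ forall x, A x -> g x = phi x, forall x, `|g x| <= M &
    forall x y, `|g x - g y| <= L * gdist x y].
Proof.
move=> L0 M0 HM HL; have [[a Aa]|A0] := pselect (A !=set0); last first.
  exists (fun _ => 0); split => [x Ax|x|x y]; rewrite ?subrr ?normr0 ?mulr_ge0 ?gdist_ge0 //.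
  by exfalso; apply: A0; exists x.
pose E x := [set phi y + L * gdist x y | y in A].
have hE x : has_inf (E x).
  split; first by exists (phi a + L * gdist x a), a.
  exists (- M) => _ [y Ay <-]; rewrite -[leLHS]addr0 lerD ?mulr_ge0 ?gdist_ge0 //.
  by have := HM y Ay; rewrite ler_norml => /andP[].
pose g0 x := inf (E x).
have g0A x : A x -> g0 x = phi x.
  move=> Ax; apply/eqP; rewrite eq_le; apply/andP; split.
    by apply: ge_inf; [case: (hE x) | exists x => //; rewrite gdistxx mulr0 addr0].
  apply: lb_le_inf; first by case: (hE x).
  by move=> _ [y Ay <-]; have := HL x y Ax Ay; rewrite ler_norml; lra.
have g0L x y : g0 x <= g0 y + L * gdist x y.
  rewrite -lerBlDr; apply: lb_le_inf; first by case: (hE y).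
  move=> _ [z Az <-]; rewrite lerBlDr.
  apply: (@le_trans _ _ (phi z + L * gdist x z)).
    by apply: ge_inf; [case: (hE x) | exists z].
  rewrite -addrA lerD2l -mulrDr ler_wpM2l // addrC; exact: gdist_triangle.
pose clip (t : R) := Num.max (- M) (Num.min M t).
have clipL (s t d : R) : 0 <= d -> s <= t + d -> clip s <= clip t + d.
  move=> d0 st; have h1 : - M <= clip t by rewrite le_max lexx.
  have h2 : Num.min M t <= clip t by rewrite le_max lexx orbT.
  rewrite [clip s]/clip ge_max; apply/andP; split; first by move: h1 d0; clear; lra.
  rewrite ge_min; apply/orP; have [Mt|tM] := leP M t.
    by left; move: h2 d0; rewrite min_l //; clear; lra.
  by right; move: h2 st; rewrite min_r ?(ltW tM) //; clear; lra.
exists (fun x => clip (g0 x)); split => [x Ax|x|x y].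
- have := HM x Ax; rewrite g0A // ler_norml => /andP[? ?].
  by rewrite /clip min_r // max_r.
- rewrite ler_norml /clip le_max lexx /= ge_max ge_min lexx andbT.
  by move: M0; clear; lra.
- have Ld : 0 <= L * gdist x y by rewrite mulr_ge0 ?gdist_ge0.
  have := clipL _ _ _ Ld (g0L x y); have := g0L y x; rewrite gdist_sym => /(clipL _ _ _ Ld).
  by rewrite ler_norml; lra.
Qed.

Lemma lipschitz_extension (A : set G) f (L M : R) :
  0 <= L -> 0 <= M -> (forall x, A x -> normc (f x) <= M) ->
  (forall x y, A x -> A y -> normc (f x - f y) <= L * gdist x y) ->
  exists g, [/\ forall x, A x -> g x = f x, forall x, normc (g x) <= 2 * M &
    forall x y, normc (g x - g y) <= 2 * L * gdist x y].
Proof.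
move=> L0 M0 HM HL.
have [||g1 [e1 m1 l1]] := @real_lipschitz_extension A (fun x => complex.Re (f x)) L M L0 M0.
- by move=> x Ax; apply: le_trans (abs_Re_le _) (HM x Ax).
- by move=> x y Ax Ay; rewrite -ReB; apply: le_trans (abs_Re_le _) (HL x y Ax Ay).
have [||g2 [e2 m2 l2]] := @real_lipschitz_extension A (fun x => complex.Im (f x)) L M L0 M0.
- by move=> x Ax; apply: le_trans (abs_Im_le _) (HM x Ax).
- by move=> x y Ax Ay; rewrite -ImB; apply: le_trans (abs_Im_le _) (HL x y Ax Ay).
exists (fun x => Complex (g1 x) (g2 x) : R[i]^o); split.
- by move=> x Ax; rewrite e1 // e2 //; case: (f x).
- move=> x; apply: le_trans (cnorm_le_abs _) _ => /=.
  by have := m1 x; have := m2 x; lra.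
- move=> x y; apply: le_trans (cnorm_le_abs _) _; rewrite ReB ImB /=.
  by have := l1 x y; have := l2 x y; lra.
Qed.

Lemma lipschitz_truncation q : doubling G -> 1 <= q -> poincare G q ->
  exists2 C : R, 1 <= C & forall f D l, (forall x, grad f x <= D x) ->
  (forall x, normc (f x) <= D x) -> 0 < l -> exists g,
    [/\ forall x, ~ maximal_set q D l x -> g x = f x, forall x, normc (g x) <= C * l &
     forall x y, normc (g x - g y) <= C * l * gdist x y].
Proof.
move=> hD q1 HP; have [C C0 HC] := maximal_lipschitz hD q1 HP.
exists (2 + 2 * C) => [|f D l H1 H2 l0]; first lra.
have D0 x : 0 <= D x := le_trans (cnorm_ge0 _) (H2 x).
have [||||g [g1 g2 g3]] := @lipschitz_extension [set x | ~ maximal_set q D l x] f (C * l) l.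
- by rewrite mulr_ge0 // ltW.
- exact: ltW.
- by move=> x xO; apply: le_trans (H2 x) (maximal_pointwise hD q1 D0 l0 xO).
- by move=> x y xO yO; exact: HC H1 l0 _ _ xO yO.
exists g; split => // [x|x y].
  by apply: le_trans (g2 x) _; rewrite ler_wpM2r ?(ltW l0) // lerDl mulr_ge0 ?ltW.
apply: le_trans (g3 x y) _; rewrite ler_wpM2r ?gdist_ge0 // mulrA ler_wpM2r ?(ltW l0) //.
by rewrite lerDr.
Qed.

End LipschitzTruncation.

(** * Total mass of the level sets, and pointwise majorants of Sobolev norms *)

Section LevelSets.
Variables (R : realType) (G : weighted_graph R).
Implicit Types (x y z : G) (D E : G -> R) (f g v : G -> R[i]^o).

(* Neighbours are added because [grad u x] sees the values of [u] around [x]. *)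
Definition level_set q D (l : R) : set G :=
  [set x | exists2 y, maximal_set q D l y & adj (@wgh R G) x y].

(** Layer cake argument: after exchanging the sums, only the levels with [tau * 2^k < 2 * D x]
    remain at [x]. Their geometric series of exponent [p - q > 0] is of order
    [(D x / tau) ^ (p - q)], which completes [D x ^ q] to [D x ^ p]. *)
Lemma level_sets_sum q p : doubling G -> 1 <= q -> q < p -> exists2 C : R, 0 < C &
  forall D tau, (forall x, 0 <= D x) -> 0 < tau ->
  (\esum_(k in [set: int]) ((2 `^ (k%:~R * p))%:E * massS (level_set q D (tau * 2 `^ k%:~R)))
   <= (C / tau `^ p)%:E * \esum_(x in [set: G]) (D x `^ p * mass x)%:E)%E.
Proof.
move=> hD q1 qp; have [C1 C10 H1] := maximal_weak_type hD; have [C2 C20 H2] := massS_nbr G.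
have q0 := lt_le_trans ltr01 q1; have p0 := lt_trans q0 qp.
have a0 : 0 < p - q by rewrite subr_gt0.
pose c := dyad_const (p - q); have c0 : 0 < c by exact: dyad_const_gt0.
exists (C2 * C1 * c * 2 `^ (p - q)) => [|D tau D0 t0]; first by rewrite !mulr_gt0 ?powR_gt0.
pose kap := C2 * C1 / tau `^ q.
have kap0 : 0 <= kap by rewrite divr_ge0 ?powR_ge0 ?mulr_ge0 ?(ltW C20) ?(ltW C10).
pose b (k : int) x : \bar R := ((kap * 2 `^ (k%:~R * (p - q)))%:E * above q D (tau * 2 `^ k%:~R / 2) x)%E.
have b0 k x : (0 <= b k x)%E by rewrite mule_ge0 ?above_ge0 // lee_fin mulr_ge0 ?powR_ge0.
apply: (@le_trans _ _ (\esum_(k in [set: int]) \esum_(x in [set: G]) b k x)%E).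
  apply: le_esum => k _; have l0 : 0 < tau * 2 `^ k%:~R by rewrite mulr_gt0 ?powR_gt0.
  rewrite /b esumZl; [|by rewrite mulr_ge0 ?powR_ge0|by move=> x _; exact: above_ge0].
  apply: le_trans (lee_wpmul2l _ (H2 _)) _; first by rewrite lee_fin powR_ge0.
  apply: le_trans (lee_wpmul2l _ (lee_wpmul2l _ (H1 q D _ q1 D0 l0))) _;
    rewrite ?lee_fin ?powR_ge0 ?(ltW C20) //.
  rewrite !muleA -!EFinM lee_wpmul2r ?esum_ge0 // => [x _|]; first exact: above_ge0.
  rewrite lee_fin le_eqVlt; apply/orP; left; apply/eqP.
  rewrite /kap powRM ?(ltW t0) ?powR_ge0 // mulrBr powRD; last by rewrite pnatr_eq0 implybT.
  rewrite powRN -(powRrM 2); field.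
  by rewrite !gt_eqF ?powR_gt0.
rewrite esum_exchange // -esumZl; first last.
- by move=> x _; rewrite lee_fin mulr_ge0 ?powR_ge0 ?mass_ge0.
- by rewrite divr_ge0 ?powR_ge0 // !mulr_ge0 ?powR_ge0 ?(ltW C20) ?(ltW C10) ?(ltW c0).
apply: le_esum => x _.
pose S := [set k : int | tau * 2 `^ k%:~R < 2 * D x].
have -> : (\esum_(k in [set: int]) b k x =
   \esum_(k in S) ((kap * (D x `^ q * mass x))%:E * (2 `^ (k%:~R * (p - q)))%:E))%E.
  rewrite [RHS]esum_mkcond; apply: eq_esum => k _.
  rewrite /b /above ltr_pdivrMr // [D x * 2]mulrC.
  have [kS|kS] := boolP (k \in S).
    by have h := set_mem kS; rewrite h -!EFinM; congr EFin; ring.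
  by rewrite notin_setE in kS; have /negP/negbTE h := kS; rewrite h mule0.
rewrite esumZl; first last.
- by move=> k _; rewrite lee_fin powR_ge0.
- by rewrite mulr_ge0 // mulr_ge0 ?powR_ge0 ?mass_ge0.
have DD : 0 <= 2 * D x by rewrite mulr_ge0.
apply: le_trans (lee_wpmul2l _ (dyad_esum_le a0 t0 DD)) _.
  by rewrite lee_fin mulr_ge0 // mulr_ge0 ?powR_ge0 ?mass_ge0.
rewrite -!EFinM lee_fin le_eqVlt; apply/orP; left; apply/eqP; rewrite -/c.
rewrite !powRM ?invr_ge0 ?mulr_ge0 ?(ltW t0) //.
have -> : D x `^ p = D x `^ q * D x `^ (p - q).
  by rewrite -powRD ?subrKC // gt_eqF.
have -> : (tau^-1) `^ (p - q) = tau `^ q / tau `^ p.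
  rewrite -(powR_inv1 (ltW t0)) -powRrM mulN1r opprB powRD; last by apply/implyP => _; rewrite gt_eqF.
  by rewrite powRN.
by rewrite /kap; field; rewrite !gt_eqF ?powR_gt0.
Qed.

Lemma Lp_norm_le P (B : R) (g : G -> R) : 0 < P -> 0 <= B ->
  (\esum_(x in [set: G]) (`|g x| `^ P * mass x)%:E <= (B `^ P)%:E)%E ->
  (Lp_norm P g <= B%:E)%E.
Proof.
move=> P0 B0 H; rewrite /Lp_norm.
have -> : B%:E = ((B `^ P)%:E `^ P^-1)%E.
  by rewrite poweR_EFin -powRrM mulfV ?gt_eqF // powRr1.
apply: gt0_ler_poweR => //; rewrite ?invr_ge0 ?(ltW P0) // in_itv /= leey andbT.
  by apply: esum_ge0 => x _; rewrite lee_fin mulr_ge0 ?powR_ge0 ?mass_ge0.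
by rewrite lee_fin powR_ge0.
Qed.

Lemma Lp_norm_le_inv P (B : R) (g : G -> R) : 0 < P -> 0 <= B ->
  (Lp_norm P g <= B%:E)%E ->
  (\esum_(x in [set: G]) (`|g x| `^ P * mass x)%:E <= (B `^ P)%:E)%E.
Proof.
move=> P0 B0; rewrite /Lp_norm; set S := esum _ _.
have S0 : (0 <= S)%E by apply: esum_ge0 => x _; rewrite lee_fin mulr_ge0 ?powR_ge0 ?mass_ge0.
case: S S0 => [s| |] //; last first.
  by move=> _; rewrite poweRyr ?leye_eq // invr_eq0 gt_eqF.
rewrite poweR_EFin !lee_fin => s0 H.
have -> : s = (s `^ P^-1) `^ P by rewrite -powRrM mulVf ?gt_eqF // powRr1.
by apply: ge0_ler_powR; rewrite ?nnegrE ?powR_ge0 ?(ltW P0).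
Qed.

Lemma grad_le : exists2 N : R, 1 <= N & forall v x (e : R), 0 <= e ->
  (forall y, adj (@wgh R G) x y -> normc (v y - v x) <= hmax x * e) -> grad v x <= N * e.
Proof.
have [N [N0 HN]] := nb_size G; exists N%:R => [|v x e e0 H]; first by rewrite ler1n.
rewrite /grad ler_pdivrMl ?hmax_gt0 // sum_nbrs.
have hN : 0 <= hmax x * (N%:R * e) by rewrite !mulr_ge0 ?(ltW (hmax_gt0 x)).
rewrite -[leRHS]ger0_norm // -sqrtr_sqr ler_wsqrtr //.
apply: (@le_trans _ _ (\sum_(y <- nb x) (hmax x * e) ^+ 2)).
  rewrite [leLHS]big_seq [leRHS]big_seq; apply: ler_sum => y; rewrite mem_nb => xy.
  by rewrite lerXn2r ?nnegrE ?cnorm_ge0 ?mulr_ge0 ?(ltW (hmax_gt0 x)) ?H.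
rewrite big_const_seq count_predT iter_addr_0 -[leLHS]mulr_natl.
have -> : (hmax x * (N%:R * e)) ^+ 2 = N%:R ^+ 2 * (hmax x * e) ^+ 2 by ring.
rewrite ler_wpM2r ?sqr_ge0 // -natrX ler_nat (leq_trans (HN x)) //.
by rewrite -[X in (X <= _)%N]expn1 leq_pexp2l.
Qed.

(** One pointwise majorant [E] serves for the function and for its differences, so that a series has
    to be estimated only once per vertex. *)
Lemma sobolev_norm_le : exists2 N : R, 1 <= N & forall P (B : R) v E, 0 < P -> 0 <= B ->
  (forall x, normc (v x) <= E x) ->
  (forall x y, adj (@wgh R G) x y -> normc (v y - v x) <= hmax x * E x) ->
  (\esum_(x in [set: G]) (E x `^ P * mass x)%:E <= (B `^ P)%:E)%E ->
  (sobolev_norm P v <= (N * B)%:E)%E.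
Proof.
have [N N1 HN] := grad_le; exists (1 + N) => [|P B v E P0 B0 H1 H2 H3].
  by move: N1; lra.
have N0 := le_trans ler01 N1.
have E0 x : 0 <= E x := le_trans (cnorm_ge0 _) (H1 x).
rewrite /sobolev_norm mulrDl mul1r EFinD; apply: leeD.
  apply: Lp_norm_le => //; apply: le_trans H3; apply: le_esum => x _; rewrite lee_fin.
  rewrite ler_wpM2r ?mass_ge0 //; apply: ge0_ler_powR; rewrite ?nnegrE ?(ltW P0) //.
  by rewrite ger0_norm ?cnorm_ge0.
apply: Lp_norm_le; rewrite ?mulr_ge0 //.
apply: (@le_trans _ _ (\esum_(x in [set: G]) ((N `^ P)%:E * (E x `^ P * mass x)%:E))%E).
  apply: le_esum => x _; rewrite -EFinM lee_fin mulrA -powRM //.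
  rewrite ler_wpM2r ?mass_ge0 //; apply: ge0_ler_powR; rewrite ?nnegrE ?(ltW P0) ?mulr_ge0 //.
  by rewrite ger0_norm ?grad_ge0 // HN // => y; exact: H2.
rewrite esumZl ?powR_ge0 // => [|x _]; last by rewrite lee_fin mulr_ge0 ?powR_ge0 ?mass_ge0.
by rewrite powRM // EFinM lee_wpmul2l // lee_fin powR_ge0.
Qed.

End LevelSets.

(** * Series of functions adapted to level sets *)

Section IntSeries.
Variable R : realType.
Implicit Types (a b : int -> R[i]) (v w : R[i]) (e : R).

Definition zseq n : seq int := map Posz (iota 0 n) ++ map Negz (iota 0 n).
(* Partial sums over [- n <= k < n]. *)
Definition zpsum a n : R[i] := \sum_(k <- zseq n) a k.
Definition zlim a v := forall e : R, 0 < e -> exists N, forall n, (N <= n)%N ->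
  normc (zpsum a n - v) <= e.

Lemma zseq_uniq n : uniq (zseq n).
Proof.
rewrite cat_uniq !map_inj_uniq ?iota_uniq ?andbT /=; [|by move=> ? ? []|by move=> ? ? []].
by apply/hasPn => _ /mapP[i _ ->]; apply/negP => /mapP[].
Qed.

Lemma zpsumE a n : zpsum a n = \sum_(0 <= i < n) (a (Posz i) + a (Negz i)).
Proof. by rewrite /zpsum big_cat /= !big_map -big_split /index_iota subn0. Qed.

Lemma zlim_unique a v w : zlim a v -> zlim a w -> v = w.
Proof.
move=> av aw; apply/eqP; rewrite -subr_eq0 -cnorm_eq0 -normr_le0 ger0_norm ?cnorm_ge0 //.
apply/ler_addgt0Pr => e e0; rewrite add0r; have e2 : 0 < e / 2 by rewrite divr_gt0.
have [N HN] := av _ e2; have [M HM] := aw _ e2.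
have := HN (maxn N M) (leq_maxl _ _); have := HM (maxn N M) (leq_maxr _ _).
have -> : v - w = (zpsum a (maxn N M) - w) - (zpsum a (maxn N M) - v) by ring.
have := cnormB (zpsum a (maxn N M) - w) (zpsum a (maxn N M) - v).
by clear; lra.
Qed.

Lemma zlimD a b v w : zlim a v -> zlim b w -> zlim (fun k => a k + b k) (v + w).
Proof.
move=> av bw e e0; have e2 : 0 < e / 2 by rewrite divr_gt0.
have [N HN] := av _ e2; have [M HM] := bw _ e2.
exists (maxn N M) => n; rewrite geq_max => /andP[/HN h1 /HM h2].
rewrite /zpsum big_split /= opprD addrACA (le_trans (cnormD _ _)) //.
by move: h1 h2; rewrite /zpsum; clear; lra.
Qed.

Lemma zlimZ a v (c : R[i]) : zlim a v -> zlim (fun k => c * a k) (c * v).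
Proof.
move=> av e e0; have d0 : 0 < e / (normc c + 1).
  by rewrite divr_gt0 // ltr_wpDl ?cnorm_ge0.
have [N HN] := av _ d0; exists N => n /HN h.
rewrite /zpsum -mulr_sumr -mulrBr cnormM.
apply: le_trans (ler_wpM2l (cnorm_ge0 c) h) _.
rewrite mulrCA ger_pMr // ler_pdivrMr ?mul1r ?lerDl //.
by rewrite ltr_wpDl ?cnorm_ge0.
Qed.

Lemma zlimB a b v w : zlim a v -> zlim b w -> zlim (fun k => a k - b k) (v - w).
Proof.
move=> av bw; rewrite -mulN1r; have := zlimD av (zlimZ (-1) bw).
by congr zlim; apply/funext => k; rewrite mulN1r.
Qed.

Lemma zlim_norm_le a v (B : R) : zlim a v ->
  (forall n, \sum_(k <- zseq n) normc (a k) <= B) -> normc v <= B.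
Proof.
move=> av H; apply/ler_addgt0Pr => e e0; have [N HN] := av _ e0.
have -> : v = zpsum a N - (zpsum a N - v) by ring.
apply: le_trans (cnormB _ _) _; apply: lerD (HN N (leqnn N)).
exact: le_trans (cnorm_sum _ _) (H N).
Qed.

Lemma real_series_bounded_cvg (u : nat -> R) (B : R) :
  (forall n, \sum_(0 <= i < n) `|u i| <= B) ->
  exists l : R, forall e, 0 < e -> exists N, forall n, (N <= n)%N ->
    `|\sum_(0 <= i < n) u i - l| <= e.
Proof.
move=> H; have cu : cvgn [normed series u].
  apply: nondecreasing_is_cvgn; last by exists B => _ [n _ <-]; exact: H.
  apply: (iffLR (nondecreasing_seqP _)) => n; rewrite /= seriesSr lerDl //.
have := normed_cvg cu => /cvgP; move/cvg_ex : (normed_cvg cu) => [l ul] _.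
exists l => e e0; have /cvgrPdist_le /(_ e e0) [N _ HN] := ul.
by exists N => n Nn; rewrite distrC; exact: HN.
Qed.

Lemma zlim_exists a (B : R) : (forall n, \sum_(k <- zseq n) normc (a k) <= B) ->
  exists v, zlim a v.
Proof.
move=> H.
have H' n : \sum_(0 <= i < n) normc (a (Posz i) + a (Negz i)) <= B.
  apply: le_trans (H n); rewrite big_cat /= !big_map -big_split /index_iota subn0.
  by apply: ler_sum => i _; exact: cnormD.
have [x Hx] := @real_series_bounded_cvg (fun i => complex.Re (a (Posz i) + a (Negz i))) B
  (fun n => le_trans (ler_sum _ (fun i _ => abs_Re_le _)) (H' n)).
have [y Hy] := @real_series_bounded_cvg (fun i => complex.Im (a (Posz i) + a (Negz i))) B
  (fun n => le_trans (ler_sum _ (fun i _ => abs_Im_le _)) (H' n)).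
exists (Complex x y) => e e0; have e2 : 0 < e / 2 by rewrite divr_gt0.
have [N HN] := Hx _ e2; have [M HM] := Hy _ e2.
exists (maxn N M) => n; rewrite geq_max => /andP[/HN h1 /HM h2].
apply: le_trans (cnorm_le_abs _) _; rewrite ReB ImB zpsumE Re_sum.
have -> : complex.Im (\sum_(0 <= i < n) (a i + a (Negz i))) =
    \sum_(0 <= i < n) complex.Im (a (Posz i) + a (Negz i)).
  elim: n {h1 h2} => [|n IH]; first by rewrite !big_geq.
  by rewrite !big_nat_recr //= ImD IH.
by move: h1 h2 => /=; clear; lra.
Qed.

Definition zsum a : R[i] := xget 0 [set v | zlim a v].

Lemma zsumP a (B : R) : (forall n, \sum_(k <- zseq n) normc (a k) <= B) -> zlim a (zsum a).
Proof. by move=> /zlim_exists[v av]; rewrite /zsum; case: xgetP => // /(_ v). Qed.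

Lemma zsum_eq a v : zlim a v -> zsum a = v.
Proof.
move=> av; apply: (zlim_unique _ av); rewrite /zsum.
by case: xgetP => // /(_ v).
Qed.

End IntSeries.

(** * Sobolev norms of series over the levels *)

Section SobolevSeries.
Variables (R : realType) (G : weighted_graph R).
Implicit Types (x y : G) (f g v w : G -> R[i]^o).

Lemma Lp_norm_ge0 P (g : G -> R) : (0 <= Lp_norm P g)%E.
Proof. exact: poweR_ge0. Qed.

Lemma sobolev_norm_ge0 P v : (0 <= sobolev_norm P v)%E.
Proof. by rewrite adde_ge0 ?Lp_norm_ge0. Qed.

Lemma gradD_le v w x : grad (v + w) x <= 2 * (grad v x + grad w x).
Proof.
rewrite /grad -mulrDr mulrCA ler_wpM2l ?invr_ge0 ?(ltW (hmax_gt0 x)) // !sum_nbrs.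
set A := \sum_(y <- nb x) normc (v y - v x) ^+ 2; set B := \sum_(y <- nb x) normc (w y - w x) ^+ 2.
have A0 : 0 <= A by apply: sumr_ge0 => y _; exact: sqr_ge0.
have B0 : 0 <= B by apply: sumr_ge0 => y _; exact: sqr_ge0.
have r0 : 0 <= 2 * (Num.sqrt A + Num.sqrt B) by rewrite mulr_ge0 // addr_ge0 ?sqrtr_ge0.
rewrite -[leRHS]ger0_norm // -sqrtr_sqr ler_wsqrtr //.
apply: (@le_trans _ _ (2 * (A + B))).
  rewrite /A /B -big_split mulr_sumr; apply: ler_sum => y _ /=.
  have -> : (v + w) y - (v + w) x = (v y - v x) + (w y - w x) by rewrite !fctE; ring.
  have h := cnormD (v y - v x) (w y - w x).
  apply: (@le_trans _ _ ((normc (v y - v x) + normc (w y - w x)) ^+ 2)).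
    by rewrite lerXn2r ?nnegrE ?addr_ge0 ?cnorm_ge0.
  have := sqr_ge0 (normc (v y - v x) - normc (w y - w x)).
  by clear; nra.
have hA : Num.sqrt A ^+ 2 = A by exact: sqr_sqrtr.
have hB : Num.sqrt B ^+ 2 = B by exact: sqr_sqrtr.
have -> : (2 * (Num.sqrt A + Num.sqrt B)) ^+ 2 =
  4 * Num.sqrt A ^+ 2 + 4 * Num.sqrt B ^+ 2 + 8 * (Num.sqrt A * Num.sqrt B) by ring.
have : 0 <= Num.sqrt A * Num.sqrt B by rewrite mulr_ge0 ?sqrtr_ge0.
by rewrite hA hB; move: A0 B0; clear; lra.
Qed.

(** A substitute for Minkowski's inequality, used only where a constant does no harm: to make norms
    small and to show that they are bounded. The factor 2 in the hypothesis is that of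
    [gradD_le]. *)
Lemma Lp_norm_quasi_triangle P (a b : R) (g g1 g2 : G -> R) : 1 <= P -> 0 <= a -> 0 <= b ->
  (forall x, `|g x| <= 2 * (`|g1 x| + `|g2 x|)) ->
  (Lp_norm P g1 <= a%:E)%E -> (Lp_norm P g2 <= b%:E)%E -> (Lp_norm P g <= (8 * (a + b))%:E)%E.
Proof.
move=> P1 a0 b0 H H1 H2; have P0 := lt_le_trans ltr01 P1.
have K1 := Lp_norm_le_inv P0 a0 H1; have K2 := Lp_norm_le_inv P0 b0 H2.
apply: Lp_norm_le; rewrite ?mulr_ge0 ?addr_ge0 //.
have nn (h : G -> R) x : (0 <= (`|h x| `^ P * mass x)%:E)%E.
  by rewrite lee_fin mulr_ge0 ?powR_ge0 ?mass_ge0.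
apply: (@le_trans _ _ (\esum_(x in [set: G]) ((4 `^ P)%:E *
    ((`|g1 x| `^ P * mass x)%:E + (`|g2 x| `^ P * mass x)%:E)))%E).
  apply: le_esum => x _; rewrite -EFinD -EFinM lee_fin -mulrDl mulrA ler_wpM2r ?mass_ge0 //.
  apply: (@le_trans _ _ ((2 * (`|g1 x| + `|g2 x|)) `^ P)).
    by apply: ge0_ler_powR; rewrite ?nnegrE ?(ltW P0) ?mulr_ge0 ?addr_ge0.
  have -> : (4 : R) = 2 * 2 by ring.
  rewrite !powRM ?addr_ge0 // -mulrA ler_wpM2l ?powR_ge0 //.
  by apply: powR_add_le; rewrite ?(ltW P0).
rewrite esumZl ?powR_ge0 // => [|x _]; last by rewrite adde_ge0.
rewrite esumD //; apply: le_trans (lee_wpmul2l _ (leeD K1 K2)) _; first by rewrite lee_fin powR_ge0.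
rewrite -EFinD -EFinM lee_fin.
have -> : 8 * (a + b) = 4 * (2 * (a + b)) by ring.
rewrite [in leRHS]powRM ?mulr_ge0 ?addr_ge0 // ler_wpM2l ?powR_ge0 //.
have aab : a `^ P <= (a + b) `^ P by apply: ge0_ler_powR; rewrite ?nnegrE ?(ltW P0) ?addr_ge0 ?lerDl.
have bab : b `^ P <= (a + b) `^ P by apply: ge0_ler_powR; rewrite ?nnegrE ?(ltW P0) ?addr_ge0 ?lerDr.
rewrite powRM ?addr_ge0 //; apply: (@le_trans _ _ (2 * (a + b) `^ P)).
  by rewrite mulrDl mul1r lerD.
by rewrite ler_wpM2r ?powR_ge0 // le_powR_self // ler1n.
Qed.

Lemma sobolev_norm_quasi_triangle P (a b : R) v w : 1 <= P -> 0 <= a -> 0 <= b ->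
  (sobolev_norm P v <= a%:E)%E -> (sobolev_norm P w <= b%:E)%E ->
  (sobolev_norm P (v + w)%R <= (16 * (a + b))%:E)%E.
Proof.
move=> P1 a0 b0 H1 H2.
have [h1 h1'] : (Lp_norm P (fun x => normc (v x)) <= a%:E)%E /\ (Lp_norm P (grad v) <= a%:E)%E.
  by split; apply: le_trans H1; rewrite ?leeDl ?leeDr ?Lp_norm_ge0.
have [h2 h2'] : (Lp_norm P (fun x => normc (w x)) <= b%:E)%E /\ (Lp_norm P (grad w) <= b%:E)%E.
  by split; apply: le_trans H2; rewrite ?leeDl ?leeDr ?Lp_norm_ge0.
have -> : 16 * (a + b) = 8 * (a + b) + 8 * (a + b) by ring.
rewrite EFinD; apply: leeD.
  apply: Lp_norm_quasi_triangle h1 h2 => // x.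
  rewrite !ger0_norm ?cnorm_ge0 //; apply: le_trans (cnormD (v x) (w x)) _.
  by have := cnorm_ge0 (v x); have := cnorm_ge0 (w x); lra.
apply: Lp_norm_quasi_triangle h1' h2' => // x.
by rewrite !ger0_norm ?grad_ge0 // gradD_le.
Qed.

Variables (u : int -> G -> R[i]) (Om : int -> set G) (p b : R).

Definition on_level k x : R := if x \in Om k then 1 else 0.

Lemma on_level_ge0 k x : 0 <= on_level k x.
Proof. by rewrite /on_level; case: ifP. Qed.

Definition adapted := [/\ 0 < p, 0 < b,
  forall k x, normc (u k x) <= b * (2 `^ k%:~R * on_level k x) &
  forall k x y, adj (@wgh R G) x y ->
    normc (u k y - u k x) <= hmax x * (b * (2 `^ k%:~R * on_level k x))].

(** The set [J] of levels makes it possible to isolate a tail of small energy from finitely many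
    levels. *)
Definition level_energy (J : set int) x : \bar R :=
  \esum_(k in J) (2 `^ (k%:~R * p) * on_level k x)%:E.

Definition total_energy (J : set int) : \bar R :=
  \esum_(k in J) ((2 `^ (k%:~R * p))%:E * massS (Om k))%E.

Lemma level_energy_ge0 J x : (0 <= level_energy J x)%E.
Proof. by apply: esum_ge0 => k _; rewrite lee_fin mulr_ge0 ?powR_ge0 ?on_level_ge0. Qed.

Lemma total_energy_ge0 J : (0 <= total_energy J)%E.
Proof. by apply: esum_ge0 => k _; rewrite mule_ge0 ?massS_ge0 // lee_fin powR_ge0. Qed.

Lemma total_energyE J : total_energy J = (\esum_(x in [set: G]) ((mass x)%:E * level_energy J x))%E.
Proof.
transitivity (\esum_(x in [set: G]) \esum_(k in J) ((mass x)%:E * (2 `^ (k%:~R * p) * on_level k x)%:E))%E; last first.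
  apply: eq_esum => x _; rewrite esumZl ?mass_ge0 // => k _.
  by rewrite lee_fin mulr_ge0 ?powR_ge0 ?on_level_ge0.
rewrite esum_exchange; last first.
  by move=> x k; rewrite -EFinM lee_fin !mulr_ge0 ?powR_ge0 ?on_level_ge0 ?mass_ge0.
apply: eq_esum => k _; rewrite /massS esum_mkcond -esumZl ?powR_ge0 //; last first.
  by move=> x _; case: ifP => // _; rewrite lee_fin mass_ge0.
apply: eq_esum => x _; rewrite /on_level; case: ifP => _.
  by rewrite mulr1 -!EFinM mulrC.
by rewrite mulr0 !mule0.
Qed.

Lemma level_energy_fin J x (T : R) : (total_energy J <= T%:E)%E ->
  (level_energy J x)%E \is a fin_num.
Proof.
move=> HT; rewrite ge0_fin_numE ?level_energy_ge0 // ltNge leye_eq; apply/negP => /eqP E.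
have : ((mass x)%:E * level_energy J x <= T%:E)%E.
  apply: le_trans HT; rewrite total_energyE.
  rewrite (_ : ((mass x)%:E * _ = \sum_(y <- [:: x]) ((mass y)%:E * level_energy J y))%E); last by rewrite big_seq1.
  exact: le_esum_uniq.
by rewrite E gt0_muley ?lte_fin ?mass_gt0.
Qed.

(** The weight [2 ^ (k (p / P - 1))] times the size [2 ^ k] of [e k] is [2 ^ (k p / P)]. By
    [dyad_sum_powR_le] the sum of these over the levels containing [x] is controlled by the power
    [1 / P] of the sum of the [2 ^ (k p)]. Here [e] stands for the normalised values, or
    differences, of the [u k]. *)
Lemma sum_weighted_le (J : set int) (T A P : R) (c : int -> R[i]) (e : int -> R) x n :
  0 < p -> 0 < P -> 0 <= A -> (total_energy J <= T%:E)%E ->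
  (forall k, J k -> normc (c k) <= A * 2 `^ (k%:~R * (p / P - 1))) ->
  (forall k, ~ J k -> c k = 0) ->
  (forall k, e k <= 2 `^ k%:~R * on_level k x) ->
  \sum_(k <- zseq n) normc (c k) * e k <=
    A * dyad_const (p / P) * (fine (level_energy J x)) `^ P^-1.
Proof.
move=> p0 P0 A0 HT HJ HJ0 He.
have pP : 0 < p / P by rewrite divr_gt0.
pose s := [seq k <- zseq n | (k \in J) && (x \in Om k)].
have us : uniq s by rewrite filter_uniq // zseq_uniq.
apply: (@le_trans _ _ (\sum_(k <- s) A * 2 `^ (k%:~R * (p / P)))).
  rewrite /s big_filter [leRHS]big_mkcond /=; apply: ler_sum => k _.
  have [kJ|kJ] := boolP (k \in J); last first.
    by rewrite HJ0 ?cnorm0 ?mul0r //; rewrite notin_setE in kJ.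
  apply: (@le_trans _ _ (normc (c k) * (2 `^ k%:~R * on_level k x))).
    by rewrite ler_wpM2l ?cnorm_ge0.
  rewrite /on_level /=; case: ifP => _; last by rewrite !mulr0.
  rewrite mulr1 (_ : k%:~R * (p / P) = k%:~R * (p / P - 1) + k%:~R); last by ring.
  rewrite [X in A * X]powRD; last by rewrite pnatr_eq0 implybT.
  by rewrite mulrA ler_wpM2r ?powR_ge0 // HJ //; exact: set_mem.
rewrite -mulr_sumr -mulrA ler_wpM2l //.
have S0 : 0 <= \sum_(k <- s) 2 `^ (k%:~R * (p / P)) :> R.
  by apply: sumr_ge0 => k _; exact: powR_ge0.
apply: (ler_powR_inv P0) => //.
  by rewrite mulr_ge0 ?powR_ge0 // ltW ?dyad_const_gt0.
apply: le_trans (dyad_sum_powR_le pP P0 us) _.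
rewrite powRM ?powR_ge0 ?(ltW (dyad_const_gt0 pP)) // ler_wpM2l ?powR_ge0 //.
rewrite -powRrM mulVf ?gt_eqF // powRr1 ?fine_ge0 ?level_energy_ge0 //.
rewrite divfK ?gt_eqF // -lee_fin fineK ?(level_energy_fin _ HT) // -sumEFin.
have sJ k : k \in s -> J k.
  by rewrite mem_filter => /andP[/andP[/set_mem]].
apply: le_trans (le_esum_uniq _ us sJ).
rewrite [leLHS]big_seq [leRHS]big_seq; apply: lee_sum => k.
by rewrite mem_filter /on_level => /andP[/andP[_ ->] _]; rewrite mulr1.
Qed.

Lemma adapted_summable (J : set int) (T A P : R) (c : int -> R[i]) x :
  adapted -> 0 < P -> 0 <= A -> (total_energy J <= T%:E)%E ->
  (forall k, J k -> normc (c k) <= A * 2 `^ (k%:~R * (p / P - 1))) ->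
  (forall k, ~ J k -> c k = 0) ->
  zlim (fun k => c k * u k x) (zsum (fun k => c k * u k x)).
Proof.
move=> [p0 b0 H1 H2] P0 A0 HT HJ HJ0.
apply: (@zsumP _ _ (b * (A * dyad_const (p / P) * (fine (level_energy J x)) `^ P^-1))) => n.
apply: le_trans (ler_wpM2l (ltW b0) (@sum_weighted_le J T A P c (fun k => b^-1 * normc (u k x)) x n p0 P0 A0 HT HJ HJ0 _)).
  rewrite mulr_sumr; apply: ler_sum => k _; rewrite cnormM.
  by rewrite mulrCA mulVKf ?gt_eqF.
by move=> k; rewrite ler_pdivrMl //.
Qed.

End SobolevSeries.

(** The pointwise bound of [sum_weighted_le], raised to the power [P] and summed over the vertices,
    is exactly the total energy. The levels are thus added at each vertex, not norm by norm, and the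
    energy enters with the power [1 / P]. *)
Lemma adapted_norm_le (R : realType) (G : weighted_graph R) : exists2 N : R, 1 <= N &
  forall (u : int -> G -> R[i]) (Om : int -> set G) (p b : R) (J : set int) (T A P : R) (c : int -> R[i])
    (v : G -> R[i]^o),
  adapted u Om p b -> 0 < P -> 0 <= A -> 0 <= T -> (total_energy Om p J <= T%:E)%E ->
  (forall k, J k -> normc (c k) <= A * 2 `^ (k%:~R * (p / P - 1))) ->
  (forall k, ~ J k -> c k = 0) ->
  (forall x, zlim (fun k => c k * u k x) (v x)) ->
  (sobolev_norm P v <= (N * (b * A * dyad_const (p / P) * T `^ P^-1))%:E)%E.
Proof.
have [N N1 HN] := sobolev_norm_le G; exists N => // u Om p b J T A P c v [p0 b0 H1 H2] P0 A0 T0 HT HJ HJ0 Hv.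
have pP : 0 < p / P by rewrite divr_gt0.
pose K := b * A * dyad_const (p / P).
have K0 : 0 <= K by rewrite !mulr_ge0 ?(ltW b0) // ltW ?dyad_const_gt0.
pose E x := K * (fine (level_energy Om p J x)) `^ P^-1.
apply: (HN P _ v E) => //.
- by rewrite mulr_ge0 ?powR_ge0.
- move=> x; apply: zlim_norm_le (Hv x) _ => n; rewrite /E /K -!mulrA [A * _]mulrA.
  apply: le_trans (ler_wpM2l (ltW b0) (@sum_weighted_le _ _ Om p J T A P c (fun k => b^-1 * normc (u k x)) x n p0 P0 A0 HT HJ HJ0 _)).
    rewrite mulr_sumr; apply: ler_sum => k _; rewrite cnormM.
    by rewrite mulrCA mulVKf ?gt_eqF.
  by move=> k; rewrite ler_pdivrMl.
- move=> x y xy; have := zlimB (Hv y) (Hv x) => Hyx.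
  apply: zlim_norm_le Hyx _ => n; rewrite /E /K -!mulrA [A * _]mulrA mulrA.
  have hb : 0 < hmax x * b by rewrite mulr_gt0 ?hmax_gt0.
  apply: le_trans (ler_wpM2l (ltW hb) (@sum_weighted_le _ _ Om p J T A P c (fun k => (hmax x * b)^-1 * normc (u k y - u k x)) x n p0 P0 A0 HT HJ HJ0 _)).
    rewrite mulr_sumr; apply: ler_sum => k _; rewrite -mulrBr cnormM.
    by rewrite mulrCA mulVKf ?gt_eqF.
  by move=> k; rewrite ler_pdivrMl // -mulrA; exact: H2.
rewrite powRM ?powR_ge0 // -powRrM mulVf ?gt_eqF // powRr1 //.
rewrite (_ : (\esum_(x in [set: G]) (E x `^ P * mass x)%:E =
    (K `^ P)%:E * total_energy Om p J)%E); last first.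
  rewrite total_energyE -esumZl ?powR_ge0 //; last first.
    by move=> x _; rewrite mule_ge0 ?level_energy_ge0 // lee_fin mass_ge0.
  apply: eq_esum => x _; rewrite /E powRM ?powR_ge0 // -powRrM mulVf ?gt_eqF //.
  rewrite powRr1 ?fine_ge0 ?level_energy_ge0 // -[in RHS](fineK (level_energy_fin x HT)).
  by rewrite -!EFinM; congr EFin; ring.
by rewrite EFinM lee_wpmul2l // lee_fin powR_ge0.
Qed.


(** * The analytic family *)

Section ComplexFilters.
Variable R : realType.
Implicit Types (z w : R[i]^o) (d e : R).

Lemma near_normc z d : 0 < d -> \forall w \near z, normc (w - z) <= d.
Proof.
move=> d0; apply/nbhs_ballP; exists (d%:C)%C => /=; first by rewrite ltcR.
move=> w; rewrite /ball /= => h; have : (normc (z - w) < d)%R by rewrite -ltcR.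
by rewrite cdistC => /ltW.
Qed.

Lemma normc_near z (P : set R[i]^o) : (\forall w \near z, P w) ->
  exists2 d, 0 < d & forall w, normc (w - z) <= d -> P w.
Proof.
move=> /nbhs_ballP[[a b] /= e0 H].
(* Radii of balls are elements of [R[i]], and a positive one is real. *)
have [a0 b0] : 0 < a /\ b = 0 by move: e0; rewrite ltcE /= => /andP[/eqP ? ?].
exists (a / 2) => [|w hw]; first by rewrite divr_gt0.
apply: H; rewrite /ball /= b0; have : (normc (z - w) < a)%R.
  by rewrite cdistC; apply: le_lt_trans hw _; lra.
by rewrite -ltcR.
Qed.

Lemma ecvg0P (T : Type) (F : set_system T) (f : T -> \bar R) : Filter F ->
  (forall x, 0 <= f x)%E ->
  (forall e, 0 < e -> \forall x \near F, (f x <= e%:E)%E) -> f x @[x --> F] --> 0%E.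
Proof.
move=> FF f0 H; apply/fine_cvgP; split.
  apply: filterS (H 1 ltr01) => x fx.
  by rewrite ge0_fin_numE // (le_lt_trans fx) ?ltry.
apply/cvgrPdist_le => e e0; apply: filterS (H e e0) => x fx.
rewrite sub0r normrN /= ger0_norm ?fine_ge0 // -lee_fin fineK //.
by rewrite ge0_fin_numE // (le_lt_trans fx) ?ltry.
Qed.

Lemma ecvg0_near (T : Type) (F : set_system T) (f : T -> \bar R) e : Filter F ->
  f x @[x --> F] --> 0%E -> 0 < e -> \forall x \near F, (f x <= e%:E)%E.
Proof.
move=> FF /fine_cvgP[f1 /cvgrPdist_le /(_ e)] H e0.
apply: filterS2 f1 (H e0) => x fx /=; rewrite sub0r normrN => h.
by rewrite -(fineK fx) lee_fin (le_trans (ler_norm _)).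
Qed.

End ComplexFilters.

(** * Analytic coefficients of the series *)

Section Coefficients.
Variable R : realType.
Implicit Types (z w : R[i]) (k : int).
Variables (s0 s1 al : R).

(* [z ^ 2] makes the family decay on vertical lines, and [- al ^ 2] compensates
   it at [al]. *)
Definition exponent k z : R[i] :=
  z * z + ((k%:~R * ln 2 * (s1 - s0))%:C)%C * z + ((k%:~R * ln 2 * s0 - al ^+ 2)%:C)%C.

Definition coef k z : R[i] := cexp (exponent k z).

(* The supremum of [2 `^ (k (s0 + (s1 - s0) t))] over [0 <= t <= 1], for [s1 <= s0]. *)
Definition weight k : R := if 0 <= k then 2 `^ (k%:~R * s0) else 2 `^ (k%:~R * s1).

Definition exponent_der k z : R[i] := (2%:C)%C * z + ((k%:~R * ln 2 * (s1 - s0))%:C)%C.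

Lemma pow2E (t : R) : 2 `^ t = expR (t * ln 2).
Proof. by rewrite /powR pnatr_eq0. Qed.

Lemma Re_exponent k z : complex.Re (exponent k z) =
  (complex.Re z ^+ 2 - complex.Im z ^+ 2 - al ^+ 2) +
  k%:~R * ln 2 * (s0 + (s1 - s0) * complex.Re z).
Proof. by rewrite /exponent !ReD !ReM /= mul0r subr0; ring. Qed.

Lemma cnorm_coef k z : normc (coef k z) =
  expR (complex.Re z ^+ 2 - complex.Im z ^+ 2 - al ^+ 2) *
  2 `^ (k%:~R * (s0 + (s1 - s0) * complex.Re z)).
Proof.
by rewrite /coef cnorm_cexp Re_exponent expRD pow2E; congr (_ * expR _); ring.
Qed.

Lemma ln2_gt0 : 0 < ln 2 :> R.
Proof. by rewrite ln_gt0 // ltr1n. Qed.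

Lemma weight_ge k (t : R) : s1 <= s0 -> 0 <= t <= 1 ->
  2 `^ (k%:~R * (s0 + (s1 - s0) * t)) <= weight k.
Proof.
move=> s10 /andP[t0 t1]; rewrite /weight; case: ifPn => k0; rewrite ler_powR ?ler1n //.
  rewrite ler_wpM2l ?ler0z // gerDl; rewrite mulr_le0_ge0 // subr_le0 //.
rewrite -ltNge in k0; rewrite ler_wnM2l ?lerz0 ?(ltW k0) //.
by move: t1 s10 t0; clear; nra.
Qed.

Lemma cnorm_coef_le k z : s1 <= s0 -> cstrip z -> normc (coef k z) <= expR 1 * weight k.
Proof.
move=> s10 sz; have /andP[z0 z1] := sz.
rewrite cnorm_coef ler_pM ?expR_ge0 ?powR_ge0 ?weight_ge // ler_expR.
have h : complex.Re z ^+ 2 <= 1 by rewrite expr_le1.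
by have := sqr_ge0 (complex.Im z); have := sqr_ge0 al; move: h; clear; lra.
Qed.

Lemma cdiff_coef k z : cdiff (coef k) z.
Proof.
apply: (@cdiff_comp R (@cexp R)); last exact: cdiff_cexp.
apply: cdiffD; last exact: cdiff_cst.
apply: cdiffD; apply: cdiffM; try exact: cdiff_id.
exact: cdiff_cst.
Qed.

Lemma sqr_le_expR (e t : R) : 0 < e -> 0 <= t -> t ^+ 2 <= 2 / e ^+ 2 * expR (e * t).
Proof.
move=> e0 t0; have := expR_ge1Dxn 1 (mulr_ge0 (ltW e0) t0).
rewrite -[(2)`!%:R]/2 exprMn => h; rewrite mulrAC ler_pdivlMr ?exprn_gt0 //.
by move: h; clear; lra.
Qed.

Lemma id_le_expR (e t : R) : 0 < e -> t <= e^-1 * expR (e * t).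
Proof.
move=> e0; rewrite mulrC ler_pdivlMr // mulrC.
by have := expR_ge1Dx (e * t); lra.
Qed.

(** The point is that [C] and [r] do not depend on [k], although the derivative and the remainder
    contain factors [|k|], [|k| ^ 2] and an exponential of [|k|]. Since [z] is interior, [coef k z]
    is smaller than [weight k] by a factor exponential in [|k|], and this gain absorbs them. *)
Lemma coef_taylor z : s1 <= s0 -> 0 < complex.Re z < 1 ->
  exists C r : R, [/\ 0 <= C, 0 < r,
    forall k, normc (coef k z * exponent_der k z) <= C * weight k &
    forall k w, w != z -> normc (w - z) <= r ->
      normc ((w - z)^-1 * (coef k w - coef k z) - coef k z * exponent_der k z)
        <= C * normc (w - z) * weight k].
Proof.
move=> s10 /andP[x0 x1]; set x := complex.Re z in x0 x1.
pose e : R := Num.min x (1 - x) / 2.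
have e0 : 0 < e by rewrite divr_gt0 // lt_min x0 subr_gt0.
have [ex ex1] : 2 * e <= x /\ x + 2 * e <= 1.
  have : 2 * e <= x by rewrite /e mulrCA divff // mulr1 ge_min lexx.
  have : 2 * e <= 1 - x by rewrite /e mulrCA divff // mulr1 ge_min lexx orbT.
  by clear; lra.
pose m : R := 2 * normc z + 1; have m0 : 0 <= m by rewrite addr_ge0 ?mulr_ge0 ?cnorm_ge0.
pose v k : R := `|k%:~R * ln 2 * (s1 - s0)|.
have v0 k : 0 <= v k by exact: normr_ge0.
(* The exponential amounts to moving [Re z] by [2 * e], to the left for [k >= 0] and to the right
   for [k < 0]; by the choice of [e] the new point stays in the strip. *)
have wgt k : normc (coef k z) * expR (2 * e * v k) <= expR 1 * weight k.
  rewrite cnorm_coef -/x -[leLHS]mulrA ler_pM ?expR_ge0 ?mulr_ge0 ?powR_ge0 //.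
    rewrite ler_expR; have h : x ^+ 2 <= 1 by rewrite expr_le1 ?(ltW x0) ?(ltW x1).
    by have := sqr_ge0 (complex.Im z); have := sqr_ge0 al; move: h; clear; lra.
  have -> : expR (2 * e * v k) = 2 `^ (2 * e * `|k%:~R * (s1 - s0)|).
    rewrite pow2E; congr expR; rewrite /v !normrM (ger0_norm (ltW ln2_gt0)); ring.
  rewrite -powRD; last by rewrite pnatr_eq0 implybT.
  rewrite normrM (ler0_norm (x := s1 - s0)) ?subr_le0 //.
  have [k0|k0] := leP 0 k.
    have -> : k%:~R * (s0 + (s1 - s0) * x) + 2 * e * (`|k%:~R| * - (s1 - s0)) =
        k%:~R * (s0 + (s1 - s0) * (x - 2 * e)).
      by rewrite ger0_norm ?ler0z //; ring.
    by apply: weight_ge => //; move: e0 ex ex1; clear; lra.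
  have -> : k%:~R * (s0 + (s1 - s0) * x) + 2 * e * (`|k%:~R| * - (s1 - s0)) =
      k%:~R * (s0 + (s1 - s0) * (x + 2 * e)).
    by rewrite ler0_norm ?lerz0 ?(ltW k0) //; ring.
  by apply: weight_ge => //; move: e0 x0 ex ex1; clear; lra.
have der_le k : normc (exponent_der k z) <= m + v k.
  apply: le_trans (cnormD _ _) _; rewrite cnormM !cnorm_real lerD //.
  by rewrite ger0_norm // lerDl.
pose C1 := e^-1 * expR (e * m).
pose C2 := 8 / e ^+ 2 * expR (2 * e * m) + 1.
have C10 : 0 <= C1 by rewrite mulr_ge0 ?expR_ge0 // invr_ge0 ltW.
have C20 : 0 <= C2 by rewrite addr_ge0 // mulr_ge0 ?expR_ge0 // divr_ge0 // sqr_ge0.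
have C12 : 0 <= C1 + C2 := addr_ge0 C10 C20.
exists ((C1 + C2) * expR 1), (Num.min 1 e); split.
- exact: mulr_ge0 C12 (expR_ge0 _).
- by rewrite lt_min ltr01.
- move=> k; rewrite cnormM; apply: (@le_trans _ _ (normc (coef k z) * (C1 * expR (2 * e * v k)))).
    rewrite ler_wpM2l ?cnorm_ge0 //; apply: le_trans (der_le k) _.
    apply: le_trans (id_le_expR _ e0) _; rewrite mulrDr expRD mulrA ler_wpM2l // ler_expR.
    by rewrite ler_wpM2r //; move: e0; clear; lra.
  rewrite mulrCA -[leRHS]mulrA; apply: ler_pM => //; rewrite ?mulr_ge0 ?cnorm_ge0 ?expR_ge0 //.
  by rewrite lerDl.
move=> k w wz; rewrite le_min => /andP[h1 he].
set ze := w - z in h1 he *; set n := normc ze in h1 he *.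
have ze0 : ze != 0 by rewrite subr_eq0.
have n0 : 0 < n by rewrite lt_def cnorm_ge0 cnorm_eq0 ze0.
(* The exponent is quadratic in [z] with leading coefficient 1, so its increment from [z] to [w] is
   exactly [eta]. *)
pose eta : R[i] := ze * (exponent_der k z + ze).
have cwE : coef k w = coef k z * cexp eta.
  rewrite /coef -cexpD; congr cexp; have -> : w = z + ze by rewrite /ze addrC subrK.
  by rewrite /exponent /eta /exponent_der /= (_ : (2%:C)%C = 2 :> R[i]) //; ring.
have -> : ze^-1 * (coef k w - coef k z) - coef k z * exponent_der k z =
    coef k z * (ze^-1 * (cexp eta - 1 - eta) + ze).
  by rewrite cwE /eta; field.
have eta_le : normc eta <= n * (m + v k).
  rewrite cnormM -/n ler_wpM2l ?(ltW n0) //.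
  apply: le_trans (cnormD _ _) _; apply: (@le_trans _ _ (2 * normc z + v k + 1)).
    rewrite lerD // ; apply: le_trans (cnormD _ _) _.
    by rewrite cnormM !cnorm_real ger0_norm.
  by rewrite /m; clear; lra.
have mv0 : 0 <= m + v k by rewrite addr_ge0.
have main : normc (ze^-1 * (cexp eta - 1 - eta) + ze) <= n * (C2 * expR (2 * e * v k)).
  apply: le_trans (cnormD _ _) _; rewrite cnormM normcV -/n.
  (* Half of the available exponential absorbs the square of [m + v k], the other half the factor
     [expR (normc eta)], since [n <= e]. *)
  have t1 : normc (cexp eta - 1 - eta) <= n ^+ 2 * (8 / e ^+ 2 * expR (2 * e * (m + v k))).
    apply: le_trans (cexp_taylor1_le _) _.
    apply: (@le_trans _ _ (4 * (n * (m + v k)) ^+ 2 * expR (e * (m + v k)))).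
      apply: ler_pM; [exact: mulr_ge0 (ler0n R 4) (sqr_ge0 _) | exact: expR_ge0 | |].
        by rewrite ler_wpM2l // lerXn2r ?nnegrE ?cnorm_ge0 ?mulr_ge0 ?(ltW n0).
      by rewrite ler_expR (le_trans eta_le) // ler_wpM2r.
    have h := sqr_le_expR e0 mv0.
    have -> : n ^+ 2 * (8 / e ^+ 2 * expR (2 * e * (m + v k))) =
       4 * n ^+ 2 * (2 / e ^+ 2 * expR (e * (m + v k))) * expR (e * (m + v k)).
      rewrite (_ : 2 * e * (m + v k) = e * (m + v k) + e * (m + v k)); last by ring.
      by rewrite expRD; field; rewrite gt_eqF.
    rewrite ler_wpM2r ?expR_ge0 // exprMn mulrA ler_wpM2l //.
    exact: mulr_ge0 (ler0n R 4) (sqr_ge0 _).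
  rewrite /C2 mulrDl mul1r mulrDr; apply: lerD; last first.
    rewrite ler_pMr // -[leLHS]expR0 ler_expR mulr_ge0 //.
    by rewrite mulr_ge0 // ltW.
  rewrite ler_pdivrMl // mulrA -expr2; apply: le_trans t1 _.
  by rewrite mulrDr expRD !mulrA.
rewrite cnormM; apply: le_trans (ler_wpM2l (cnorm_ge0 _) main) _.
have -> : normc (coef k z) * (n * (C2 * expR (2 * e * v k))) =
   (C2 * n) * (normc (coef k z) * expR (2 * e * v k)) by ring.
have -> : (C1 + C2) * expR 1 * n * weight k = ((C1 + C2) * n) * (expR 1 * weight k) by ring.
apply: ler_pM; rewrite ?mulr_ge0 ?cnorm_ge0 ?expR_ge0 ?(ltW n0) //.
by rewrite ler_wpM2r ?(ltW n0) // lerDr.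
Qed.

End Coefficients.

(** * Series in the sum of the two Sobolev spaces *)

Section CalderonSeries.
Variables (R : realType) (G : weighted_graph R).
Variables (u : int -> G -> R[i]) (Om : int -> set G) (p b T : R).
Implicit Types (x y : G) (c : int -> R[i]) (v w : G -> R[i]^o).

Lemma scaled_le (K e : R) : 0 <= K -> 0 <= e -> K * (e / (K + 1)) <= e.
Proof.
move=> K0 e0; have K1 : 0 < K + 1 by rewrite ltr_wpDl.
rewrite mulrA ler_pdivrMr //; rewrite mulrDr mulr1 mulrC lerDl //.
Qed.

Lemma seq_radius (Q : int -> R -> Prop) (X : seq int) :
  (forall k d d', Q k d -> 0 < d' -> d' <= d -> Q k d') ->
  (forall k, k \in X -> exists2 d : R, 0 < d & Q k d) ->
  exists2 d : R, 0 < d & forall k, k \in X -> Q k d.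
Proof.
move=> mono; elim: X => [|k X IH] H; first by exists 1.
have [d1 d10 H1] := H k (mem_head _ _).
have [|d2 d20 H2] := IH; first by move=> k' k'X; apply: H; rewrite inE k'X orbT.
exists (Num.min d1 d2); first by rewrite lt_min d10.
move=> k'; rewrite inE => /predU1P[->|k'X].
  by apply: mono H1 _ _; rewrite ?lt_min ?d10 // ge_min lexx.
by apply: mono (H2 k' k'X) _ _; rewrite ?lt_min ?d10 // ge_min lexx orbT.
Qed.

Lemma total_energy_tail (e : R) : (total_energy Om p [set: int] <= T%:E)%E -> 0 < e ->
  exists X : seq int, (total_energy Om p [set k | k \notin X] <= e%:E)%E.
Proof.
move=> HT e0.
have a0 k : (0 <= (2 `^ (k%:~R * p))%:E * massS (Om k))%E by rewrite mule_ge0 ?massS_ge0 // lee_fin powR_ge0.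
have fin : total_energy Om p [set: int] \is a fin_num.
  by rewrite ge0_fin_numE ?total_energy_ge0 // (le_lt_trans HT) ?ltry.
have [_ [A [fA _] <-]] := ub_ereal_sup_adherent e0 fin.
rewrite -/(esum _ _) -/(total_energy _ _ _) fsbig_finite // => lt.
exists (finmap.enum_fset (fset_set A)); set X := finmap.enum_fset _ in lt *.
have E : total_energy Om p [set: int] =
   (total_energy Om p [set k | k \in X] + total_energy Om p [set k | k \notin X])%E.
  rewrite /total_energy (esumID [set k | k \in X]) // !setTI; congr (_ + _)%E.
  by congr (esum _ _); apply/seteqP; split => k /= /negP.
have le1 : (\sum_(k <- X) (2 `^ (k%:~R * p))%:E * massS (Om k) <= total_energy Om p [set k | k \in X])%E.
  by apply: le_esum_uniq => //; exact: finmap.fset_uniq.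
have := lt_le_trans lt le1; rewrite E in fin *.
have /andP[f1 f2] : (total_energy Om p [set k | k \in X] \is a fin_num) && (total_energy Om p [set k | k \notin X] \is a fin_num).
  by rewrite -fin_numD.
rewrite -(fineK f1) -(fineK f2) -!EFinD lte_fin lee_fin => h.
by lra.
Qed.

(** Dominated convergence for the series: on the finite set [X] the coefficients are small while the
    energy is bounded, outside [X] the energy is small while the coefficients are bounded. As [X]
    and [d] are chosen before [c], continuity of each coefficient gives continuity of the sum. *)
Lemma adapted_dominated (P A e : R) : adapted u Om p b -> 1 <= P -> 0 <= A -> 0 <= T ->
  (total_energy Om p [set: int] <= T%:E)%E -> 0 < e ->
  exists X : seq int, exists2 d : R, 0 < d & forall c v,
    (forall k, normc (c k) <= A * 2 `^ (k%:~R * (p / P - 1))) ->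
    (forall k, k \in X -> normc (c k) <= d) ->
    (forall x, zlim (fun k => c k * u k x) (v x)) ->
    (sobolev_norm P v <= e%:E)%E.
Proof.
move=> Had P1 A0 T0 HT e0; have P0 := lt_le_trans ltr01 P1.
have [N N1 HN0] := adapted_norm_le G; have HN := HN0 u Om p b; have N0 := le_trans ler01 N1.
have [p0 b0 _ _] := Had.
pose D := dyad_const (p / P); have D0 : 0 <= D by apply/ltW/dyad_const_gt0; rewrite divr_gt0.
(* The quasi-triangle inequality for the two parts costs [16 * (e1 + e1)]. *)
pose e1 := e / 32; have e10 : 0 < e1 by rewrite divr_gt0.
pose K2 := N * (b * A * D); have K20 : 0 <= K2 by rewrite !mulr_ge0 // ltW.
pose t := e1 / (K2 + 1); have t0 : 0 < t by rewrite divr_gt0 // ltr_wpDl.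
have tP : 0 < t `^ P by rewrite powR_gt0.
have [X HX] := total_energy_tail HT tP.
pose K1 := N * (b * D * T `^ P^-1); have K10 : 0 <= K1 by rewrite !mulr_ge0 ?powR_ge0 // ltW.
pose d := e1 / (K1 + 1); have d0 : 0 < d by rewrite divr_gt0 // ltr_wpDl.
(* A positive lower bound of the weights on [X] turns the absolute bound [d * m] on the coefficients
   into one relative to the weights. *)
have [m m0 Hm] : exists2 m : R, 0 < m & forall k, k \in X -> m <= 2 `^ (k%:~R * (p / P - 1)).
  apply: (@seq_radius (fun k m => m <= 2 `^ (k%:~R * (p / P - 1)))).
    by move=> k r r' h _ h'; exact: le_trans h' h.
  by move=> k _; exists (2 `^ (k%:~R * (p / P - 1))) => //; rewrite powR_gt0.
exists X, (d * m) => [|c v Hc HcX Hv]; first by rewrite mulr_gt0.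
pose c1 k := if k \in X then c k else 0; pose c2 k := if k \in X then 0 else c k.
have c1le k : [set: int] k -> normc (c1 k) <= d * 2 `^ (k%:~R * (p / P - 1)).
  rewrite /c1; case: ifP => [kX _|_ _]; last by rewrite cnorm0 mulr_ge0 ?powR_ge0 // ltW.
  by apply: le_trans (HcX k kX) _; rewrite ler_wpM2l ?(ltW d0) ?Hm.
have c2le k : [set k | k \notin X] k -> normc (c2 k) <= A * 2 `^ (k%:~R * (p / P - 1)).
  by rewrite /= /c2 => /negbTE ->.
have c20 k : ~ [set k | k \notin X] k -> c2 k = 0.
  by rewrite /= /c2 => /negP; rewrite negbK => ->.
have c10 k : ~ [set: int] k -> c1 k = 0 by move=> /(_ I).
pose v1 x := zsum (fun k => c1 k * u k x); pose v2 x := zsum (fun k => c2 k * u k x).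
have Hv1 x : zlim (fun k => c1 k * u k x) (v1 x).
  exact: adapted_summable Had P0 (ltW d0) HT c1le c10.
have Hv2 x : zlim (fun k => c2 k * u k x) (v2 x).
  exact: adapted_summable Had P0 A0 HX c2le c20.
have -> : v = ((v1 : G -> R[i]^o) + v2)%R.
  apply/funext => x; apply: (zlim_unique (Hv x)).
  have := zlimD (Hv1 x) (Hv2 x); congr zlim; apply/funext => k.
  by rewrite /c1 /c2; case: ifP => _; rewrite mul0r ?addr0 ?add0r.
have S1 := HN _ _ _ _ c1 v1 Had P0 (ltW d0) T0 HT c1le c10 Hv1.
have S2 := HN _ _ _ _ c2 v2 Had P0 A0 (ltW tP) HX c2le c20 Hv2.
have {}S1 : (sobolev_norm P (v1 : G -> R[i]^o) <= e1%:E)%E.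
  apply: le_trans S1 _; rewrite lee_fin -/D.
  have -> : N * (b * d * D * T `^ P^-1) = K1 * d by rewrite /K1; ring.
  exact: scaled_le (ltW e10).
have {}S2 : (sobolev_norm P (v2 : G -> R[i]^o) <= e1%:E)%E.
  apply: le_trans S2 _; rewrite lee_fin -/D -powRrM mulfV ?gt_eqF // powRr1 ?(ltW t0) //.
  have -> : N * (b * A * D * t) = K2 * t by rewrite /K2; ring.
  exact: scaled_le (ltW e10).
apply: le_trans (sobolev_norm_quasi_triangle P1 (ltW e10) (ltW e10) S1 S2) _.
by rewrite lee_fin (_ : 16 * (e1 + e1) = e) // /e1; field.
Qed.

Variables (p1 p2 al : R).
Local Notation s0 := (p / p1 - 1).
Local Notation s1 := (p / p2 - 1).
Local Notation W := (fun s : R => @sobolev_norm R G s).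

Lemma sum_norm_ge0 v : (0 <= sum_norm (W p1) (W p2) v)%E.
Proof.
by apply: le_ereal_inf_tmp => _ [w _ <-]; rewrite adde_ge0 ?sobolev_norm_ge0.
Qed.

Lemma sum_norm_le (v1 v2 : G -> R[i]^o) (a1 a2 : \bar R) :
  (W p1 v1 <= a1)%E -> (W p2 v2 <= a2)%E -> (sum_norm (W p1) (W p2) (v1 + v2)%R <= a1 + a2)%E.
Proof.
by move=> h1 h2; apply: le_trans (leeD h1 h2); apply: ereal_inf_lbound; exists (v1, v2).
Qed.

(* In [sum_k c k * u k], with [c k] of size [weight k], the terms [k >= 0] lie in
   W^{1,p1} and the others in W^{1,p2}. *)
Definition pos_part c k : R[i] := if 0 <= k then c k else 0.
Definition neg_part c k : R[i] := if 0 <= k then 0 else c k.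

Lemma pos_part_le c A : 0 <= A -> (forall k, normc (c k) <= A * weight s0 s1 k) ->
  forall k, normc (pos_part c k) <= A * 2 `^ (k%:~R * s0).
Proof.
move=> A0 H k; rewrite /pos_part; case: ifP => k0; last by rewrite cnorm0 mulr_ge0 ?powR_ge0.
by apply: le_trans (H k) _; rewrite /weight k0.
Qed.

Lemma neg_part_le c A : 0 <= A -> (forall k, normc (c k) <= A * weight s0 s1 k) ->
  forall k, normc (neg_part c k) <= A * 2 `^ (k%:~R * s1).
Proof.
move=> A0 H k; rewrite /neg_part; case: ifP => k0; first by rewrite cnorm0 mulr_ge0 ?powR_ge0.
by apply: le_trans (H k) _; rewrite /weight k0.
Qed.

Lemma pos_neg_split c x (v1 v2 : R[i]) : zlim (fun k => pos_part c k * u k x) v1 ->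
  zlim (fun k => neg_part c k * u k x) v2 -> zlim (fun k => c k * u k x) (v1 + v2).
Proof.
move=> h1 h2; have := zlimD h1 h2; congr zlim; apply/funext => k.
by rewrite /pos_part /neg_part; case: ifP => _; rewrite mul0r ?addr0 ?add0r.
Qed.

Lemma weighted_split c v (A : R) : adapted u Om p b -> 1 <= p1 -> 1 <= p2 -> 0 <= A ->
  (total_energy Om p [set: int] <= T%:E)%E ->
  (forall k, normc (c k) <= A * weight s0 s1 k) ->
  exists v1 v2 : G -> R[i]^o, [/\ forall x, zlim (fun k => pos_part c k * u k x) (v1 x),
    forall x, zlim (fun k => neg_part c k * u k x) (v2 x) &
    ((forall x, zlim (fun k => c k * u k x) (v x)) -> v = (v1 + v2)%R)].
Proof.
move=> Had p11 p21 A0 HT H; have P10 := lt_le_trans ltr01 p11; have P20 := lt_le_trans ltr01 p21.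
exists (fun x => zsum (fun k => pos_part c k * u k x)), (fun x => zsum (fun k => neg_part c k * u k x)).
have h1 x : zlim (fun k => pos_part c k * u k x) (zsum (fun k => pos_part c k * u k x)).
  apply: (adapted_summable x Had P10 A0 HT) => [k _|k /(_ I)] //; exact: pos_part_le.
have h2 x : zlim (fun k => neg_part c k * u k x) (zsum (fun k => neg_part c k * u k x)).
  apply: (adapted_summable x Had P20 A0 HT) => [k _|k /(_ I)] //; exact: neg_part_le.
split => // Hv; apply/funext => x.
exact: zlim_unique (Hv x) (pos_neg_split (h1 x) (h2 x)).
Qed.

Lemma weighted_zlim c (A : R) x : adapted u Om p b -> 1 <= p1 -> 1 <= p2 -> 0 <= A ->
  (total_energy Om p [set: int] <= T%:E)%E ->
  (forall k, normc (c k) <= A * weight s0 s1 k) ->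
  zlim (fun k => c k * u k x) (zsum (fun k => c k * u k x)).
Proof.
move=> Had p11 p21 A0 HT H.
have [v1 [v2 [h1 h2 _]]] := weighted_split (fun _ => 0) Had p11 p21 A0 HT H.
by have h := pos_neg_split (h1 x) (h2 x); rewrite (zsum_eq h).
Qed.

Lemma weighted_bounded : adapted u Om p b -> 1 <= p1 -> 1 <= p2 -> 0 <= T ->
  (total_energy Om p [set: int] <= T%:E)%E ->
  exists2 K : R, 0 <= K & forall c v A, 0 <= A ->
    (forall k, normc (c k) <= A * weight s0 s1 k) ->
    (forall x, zlim (fun k => c k * u k x) (v x)) ->
    (sum_norm (W p1) (W p2) v <= (K * A)%:E)%E.
Proof.
move=> Had p11 p21 T0 HT; have P10 := lt_le_trans ltr01 p11; have P20 := lt_le_trans ltr01 p21.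
have [N N1 HN0] := adapted_norm_le G; have HN := HN0 u Om p b; have N0 := le_trans ler01 N1.
have [p0 b0 _ _] := Had.
have D1 : 0 <= dyad_const (p / p1) by apply/ltW/dyad_const_gt0; rewrite divr_gt0.
have D2 : 0 <= dyad_const (p / p2) by apply/ltW/dyad_const_gt0; rewrite divr_gt0.
exists (N * (b * dyad_const (p / p1) * T `^ p1^-1) + N * (b * dyad_const (p / p2) * T `^ p2^-1)).
  by rewrite addr_ge0 // !mulr_ge0 ?powR_ge0 // ltW.
move=> c v A A0 H Hv.
have [v1 [v2 [h1 h2 /(_ Hv) ->]]] := weighted_split v Had p11 p21 A0 HT H.
have S1 := HN setT T A p1 (pos_part c) v1 Had P10 A0 T0 HT (fun k _ => pos_part_le A0 H k) (fun k h => False_ind _ (h I)) h1.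
have S2 := HN setT T A p2 (neg_part c) v2 Had P20 A0 T0 HT (fun k _ => neg_part_le A0 H k) (fun k h => False_ind _ (h I)) h2.
apply: le_trans (sum_norm_le S1 S2) _; rewrite -EFinD lee_fin le_eqVlt; apply/orP; left; apply/eqP.
by ring.
Qed.

Lemma weighted_dominated (A e : R) : adapted u Om p b -> 1 <= p1 -> 1 <= p2 -> 0 <= A -> 0 <= T ->
  (total_energy Om p [set: int] <= T%:E)%E -> 0 < e ->
  exists X : seq int, exists2 d : R, 0 < d & forall c v,
    (forall k, normc (c k) <= A * weight s0 s1 k) ->
    (forall k, k \in X -> normc (c k) <= d) ->
    (forall x, zlim (fun k => c k * u k x) (v x)) ->
    (sum_norm (W p1) (W p2) v <= e%:E)%E.
Proof.
move=> Had p11 p21 A0 T0 HT e0; have e2 : 0 < e / 2 by rewrite divr_gt0.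
have [X1 [d1 d10 H1]] := adapted_dominated Had p11 A0 T0 HT e2.
have [X2 [d2 d20 H2]] := adapted_dominated Had p21 A0 T0 HT e2.
exists (X1 ++ X2), (Num.min d1 d2) => [|c v H HX Hv]; first by rewrite lt_min d10.
have [v1 [v2 [h1 h2 /(_ Hv) ->]]] := weighted_split v Had p11 p21 A0 HT H.
rewrite [e]splitr EFinD; apply: sum_norm_le.
  apply: H1 (pos_part_le A0 H) _ h1 => k kX; rewrite /pos_part; case: ifP => _; last by rewrite cnorm0 ltW.
  by have := HX k; rewrite mem_cat kX le_min => /(_ isT) /andP[].
apply: H2 (neg_part_le A0 H) _ h2 => k kX; rewrite /neg_part; case: ifP => _; first by rewrite cnorm0 ltW.
by have := HX k; rewrite mem_cat kX orbT le_min => /(_ isT) /andP[].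
Qed.

End CalderonSeries.

(** * Membership of the series in Calderon's space *)

Section CalderonMembership.
Variables (R : realType) (G : weighted_graph R).
Variables (u : int -> G -> R[i]) (Om : int -> set G) (p b T p1 p2 al : R).
Implicit Types (x y : G) (c : int -> R[i]) (v w : G -> R[i]^o).

Local Notation s0 := (p / p1 - 1).
Local Notation s1 := (p / p2 - 1).
Local Notation W := (fun s : R => @sobolev_norm R G s).
Local Notation cf := (coef s0 s1 al).

Definition coef_series (z : R[i]^o) : G -> R[i]^o := fun x => zsum (fun k => cf k z * u k x).

Hypothesis Had : adapted u Om p b.
Hypotheses (p1_ge1 : 1 <= p1) (p2_ge1 : 1 <= p2) (T_ge0 : 0 <= T).
Hypothesis energy_le : (total_energy Om p [set: int] <= T%:E)%E.
Hypothesis s10 : s1 <= s0.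

Lemma coef_series_zlim (z : R[i]) x : cstrip z -> zlim (fun k => cf k z * u k x) (coef_series z x).
Proof.
move=> sz; apply: (weighted_zlim x Had p1_ge1 p2_ge1 (expR_ge0 1) energy_le) => k.
exact: cnorm_coef_le.
Qed.

Lemma coef_diff_zlim (z w : R[i]) x : cstrip z -> cstrip w ->
  zlim (fun k => (cf k w - cf k z) * u k x) ((coef_series w - coef_series z) x).
Proof.
move=> sz sw; have := zlimB (coef_series_zlim x sw) (coef_series_zlim x sz).
by congr zlim; apply/funext => k; rewrite mulrBl.
Qed.

Lemma coef_near (X : seq int) (z : R[i]) (e : R) : 0 < e -> exists2 d : R, 0 < d &
  forall k, k \in X -> forall w : R[i], normc (w - z) <= d -> normc (cf k w - cf k z) <= e.
Proof.
move=> e0; apply: (@seq_radius R (fun k d => forall w : R[i], normc (w - z) <= d -> normc (cf k w - cf k z) <= e)).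
  by move=> k d d' H _ dd w h; apply: H; exact: le_trans h dd.
move=> k _; have [d d0 H] := cdiff_ccont (cdiff_coef s0 s1 al k z) e0.
by exists d => // w; exact: H.
Qed.

Lemma line_coef_zlim j t x : 0 <= j <= 1 ->
  zlim (fun k => cf k (Complex j t) * u k x) (Defs.vline j coef_series t x).
Proof. by move=> hj; apply: coef_series_zlim. Qed.

Lemma line_vanishing j (P : R) : 0 <= j <= 1 -> 1 <= P ->
  (forall k t, normc (cf k (Complex j t)) <= expR (1 - t ^+ 2) * 2 `^ (k%:~R * (p / P - 1))) ->
  continuous_vanishing (W P) (Defs.vline j coef_series).
Proof.
move=> hj P1 Hc; have P0 := lt_le_trans ltr01 P1.
have [N N1 HN0] := adapted_norm_le G; have HN := HN0 u Om p b; have N0 := le_trans ler01 N1.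
have [p0 b0 _ _] := Had.
have D0 : 0 <= dyad_const (p / P) by apply/ltW/dyad_const_gt0; rewrite divr_gt0.
pose K := N * (b * dyad_const (p / P) * T `^ P^-1).
have K0 : 0 <= K by rewrite !mulr_ge0 ?powR_ge0 // ltW.
have bound t : (W P (Defs.vline j coef_series t) <= (K * expR (1 - t ^+ 2))%:E)%E.
  apply: le_trans (HN setT T (expR (1 - t ^+ 2)) P (fun k => cf k (Complex j t)) (Defs.vline j coef_series t)
    Had P0 (expR_ge0 _) T_ge0 energy_le (fun k _ => Hc k t) (fun k h => False_ind _ (h I)) _) _.
    by move=> x; exact: line_coef_zlim.
  by rewrite lee_fin /K le_eqVlt; apply/orP; left; apply/eqP; ring.
have decay e : 0 < e -> exists M : R, forall t, M <= `|t| -> (W P (Defs.vline j coef_series t) <= e%:E)%E.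
  (* For [|t| >= 1] one has [expR (t ^+ 2) >= t ^+ 2 >= |t|], so [|t| >= K * expR 1 / e] is
     enough. *)
  move=> e0; exists (1 + K * expR 1 / e) => t ht; apply: le_trans (bound t) _; rewrite lee_fin.
  have h0 : 0 <= K * expR 1 / e by rewrite divr_ge0 ?(ltW e0) // mulr_ge0 ?expR_ge0.
  have t1 : 1 <= `|t| by apply: le_trans ht; rewrite lerDl.
  have h1 : K * expR 1 / e <= `|t| by apply: le_trans ht; rewrite lerDr.
  rewrite expRD mulrA expRN ler_pdivrMr ?expR_gt0 // [leRHS]mulrC -ler_pdivrMr //.
  apply: le_trans h1 _; apply: le_trans (expR_ge1Dx (t ^+ 2)).
  rewrite -[t ^+ 2]real_normK ?num_real //.
  by apply: (@le_trans _ _ (`|t| ^+ 2)); rewrite ?lerDr // expr2 ler_peMl.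
split.
- by move=> t; apply: le_lt_trans (bound t) _; rewrite ltry.
- move=> t; apply: ecvg0P => [s|e e0]; first exact: sobolev_norm_ge0.
  have A0 := addr_ge0 (expR_ge0 (1 : R)) (expR_ge0 (1 : R)).
  have [X [d d0 H]] := adapted_dominated Had P1 A0 T_ge0 energy_le e0.
  have [r r0 Hr] := coef_near X (Complex j t) d0.
  apply/nbhs_ballP; exists r => //= s; rewrite /ball /= => hs.
  apply: (H (fun k => cf k (Complex j s) - cf k (Complex j t))).
  + move=> k; apply: le_trans (cnormB _ _) _; rewrite mulrDl; apply: lerD;
      apply: le_trans (Hc k _) _; rewrite ler_wpM2r ?powR_ge0 // ler_expR gerBl ?sqr_ge0 //.
  + move=> k kX; apply: Hr => //; apply: le_trans (cnorm_le_abs _) _.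
    by rewrite ReB ImB /= subrr normr0 add0r distrC ltW.
  + by move=> x; exact: coef_diff_zlim.
- apply: ecvg0P => [s|e e0]; first exact: sobolev_norm_ge0.
  have [M HM] := decay e e0; exists (Num.max M 0); split; first by rewrite num_real.
  by move=> t; rewrite gt_max => /andP[Mt t0]; apply: HM; rewrite ger0_norm ltW.
- apply: ecvg0P => [s|e e0]; first exact: sobolev_norm_ge0.
  have [M HM] := decay e e0; exists (- Num.max M 0); split; first by rewrite num_real.
  move=> t; rewrite ltrNr gt_max => /andP[Mt t0]; apply: HM; rewrite ler0_norm ?(ltW Mt) //.
  by rewrite -oppr_ge0 ltW.
Qed.

Lemma line0_coef k t : normc (cf k (Complex 0 t)) <= expR (- t ^+ 2) * 2 `^ (k%:~R * s0).
Proof.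
rewrite cnorm_coef /= mulr0 addr0 ler_wpM2r ?powR_ge0 // ler_expR expr0n /= sub0r.
by rewrite gerDl oppr_le0 sqr_ge0.
Qed.

Lemma line1_coef k t : normc (cf k (Complex 1 t)) <= expR (1 - t ^+ 2) * 2 `^ (k%:~R * s1).
Proof.
rewrite cnorm_coef /= mulr1 subrKC ler_wpM2r ?powR_ge0 // ler_expR expr1n.
by rewrite gerDl oppr_le0 sqr_ge0.
Qed.

Lemma coef_series_calderon : calderon (W p1) (W p2) coef_series.
Proof.
have [K K0 HK] := weighted_bounded Had p1_ge1 p2_ge1 T_ge0 energy_le.
split.
- exists (K * expR 1) => z sz; apply: (HK (fun k => cf k z)); rewrite ?expR_ge0 //.
    by move=> k; exact: cnorm_coef_le.
  by move=> x; exact: coef_series_zlim.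
- move=> z sz; apply: ecvg0P => [w|e e0]; first exact: sum_norm_ge0.
  have A0 := addr_ge0 (expR_ge0 (1 : R)) (expR_ge0 (1 : R)).
  have [X [d d0 H]] := weighted_dominated Had p1_ge1 p2_ge1 A0 T_ge0 energy_le e0.
  have [r r0 Hr] := coef_near X z d0.
  rewrite near_withinE; apply: filterS (near_normc z r0) => w wz sw.
  apply: (H (fun k => cf k w - cf k z)).
  + move=> k; apply: le_trans (cnormB _ _) _; rewrite mulrDl; apply: lerD; exact: cnorm_coef_le.
  + by move=> k kX; exact: Hr.
  + by move=> x; exact: coef_diff_zlim.
- move=> z hz; have sz : cstrip z by case/andP: hz => /ltW h1 /ltW h2; apply/andP.
  have [C [r [C0 r0 Hd Ht]]] := coef_taylor al s10 hz.
  pose dk k := cf k z * exponent_der s0 s1 k z.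
  pose L : G -> R[i]^o := fun x => zsum (fun k => dk k * u k x).
  have HL x : zlim (fun k => dk k * u k x) (L x).
    exact: (weighted_zlim x Had p1_ge1 p2_ge1 C0 energy_le).
  exists L.
    by apply: le_lt_trans (HK dk L C C0 Hd HL) _; rewrite ltry.
  apply: ecvg0P => [w|e e0]; first exact: sum_norm_ge0.
  case/andP: (hz) => x0 x1; set xz := complex.Re z in x0 x1.
  (* The last two terms keep [w] in the strip, where the series is known to converge; elsewhere
     [coef_series] could be a dummy value. *)
  pose rho := Num.min (Num.min r (e / (K * C + 1))) (Num.min xz (1 - xz)).
  have KC0 : 0 <= K * C by rewrite mulr_ge0.
  have q0 : 0 < e / (K * C + 1) by rewrite divr_gt0 // ltr_wpDl.
  have x1' : 0 < 1 - xz by rewrite subr_gt0.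
  have rho0 : 0 < rho by rewrite !lt_min r0 q0 x0 x1'.
  rewrite /dnbhs near_withinE; apply: filterS (near_normc z rho0) => w.
  rewrite !le_min => /andP[/andP[wr we] /andP[w0 w1]] wz.
  have sw : cstrip w.
    have := le_trans (abs_Re_le _) w0; have := le_trans (abs_Re_le _) w1.
    by rewrite ReB -/xz !ler_norml /cstrip /= => h1 h2; apply/andP; split; lra.
  have wC : 0 <= C * normc (w - z) by rewrite mulr_ge0 ?cnorm_ge0.
  apply: le_trans (HK (fun k => (w - z)^-1 * (cf k w - cf k z) - dk k) _ _ wC _ _) _.
  + by move=> k; exact: Ht.
  + move=> x; have := zlimB (zlimZ (w - z)^-1 (coef_diff_zlim x sz sw)) (HL x).
    by congr zlim; apply/funext => k; rewrite mulrA -mulrBl.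
  rewrite lee_fin mulrA; apply: le_trans (ler_wpM2l KC0 we) _.
  exact: scaled_le KC0 (ltW e0).
- apply: line_vanishing; rewrite ?lexx ?ler01 // => k t.
  apply: le_trans (line0_coef k t) _; rewrite ler_wpM2r ?powR_ge0 // ler_expR.
  by rewrite lerDr.
- by apply: line_vanishing; rewrite ?lexx ?ler01 // => k t; exact: line1_coef.
Qed.

End CalderonMembership.

(** The bound is linear in [b] but not in the energy [T]. In the application [b] is proportional to
    the norm of [f] and [T] does not depend on [f]. *)
Lemma coef_series_norm (R : realType) (G : weighted_graph R) : exists2 N : R, 1 <= N &
  forall (u : int -> G -> R[i]) (Om : int -> set G) (p b T p1 p2 al : R),
  adapted u Om p b -> 1 <= p1 -> 1 <= p2 -> 0 <= T ->
  (total_energy Om p [set: int] <= T%:E)%E -> p / p2 - 1 <= p / p1 - 1 ->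
  (calderon_norm (sobolev_norm p1) (sobolev_norm p2) (coef_series u p p1 p2 al)
    <= (N * b * expR 1 * (dyad_const (p / p1) * T `^ p1^-1 + dyad_const (p / p2) * T `^ p2^-1))%:E)%E.
Proof.
have [N N1 HN] := adapted_norm_le G; exists N => // u Om p b T p1 p2 al Had p11 p21 T0 HT s10.
have N0 := le_trans ler01 N1; have [p0 b0 _ _] := Had.
have P10 := lt_le_trans ltr01 p11; have P20 := lt_le_trans ltr01 p21.
have D1 : 0 <= dyad_const (p / p1) * T `^ p1^-1.
  by rewrite mulr_ge0 ?powR_ge0 //; apply/ltW/dyad_const_gt0; rewrite divr_gt0.
have D2 : 0 <= dyad_const (p / p2) * T `^ p2^-1.
  by rewrite mulr_ge0 ?powR_ge0 //; apply/ltW/dyad_const_gt0; rewrite divr_gt0.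
have line j (P : R) : 0 <= j <= 1 -> 0 < P ->
    (forall k t, normc (coef (p / p1 - 1) (p / p2 - 1) al k (Complex j t)) <= expR 1 * 2 `^ (k%:~R * (p / P - 1))) ->
    forall t, (sobolev_norm P (Defs.vline j (coef_series u p p1 p2 al) t) <=
      (N * b * expR 1 * (dyad_const (p / P) * T `^ P^-1))%:E)%E.
  move=> hj P0 Hc t.
  apply: le_trans (HN u Om p b setT T (expR 1) P (fun k => coef (p / p1 - 1) (p / p2 - 1) al k (Complex j t)) _ Had P0 (expR_ge0 _)
     T0 HT (fun k _ => Hc k t) (fun k h => False_ind _ (h I)) _) _.
    by move=> x; apply: (line_coef_zlim al Had p11 p21 HT s10).
  by rewrite lee_fin le_eqVlt; apply/orP; left; apply/eqP; ring.
have E1 : 0 <= N * b * expR 1 by rewrite !mulr_ge0 ?expR_ge0 // ltW.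
rewrite /calderon_norm ge_max; apply/andP; split; apply: ge_ereal_sup => _ [t _ <-].
  apply: le_trans (line 0 p1 _ P10 _ t) _; rewrite ?lexx ?ler01 //.
    move=> k t'; apply: le_trans (line0_coef _ _ _ _ k t') _; rewrite ler_wpM2r ?powR_ge0 // ler_expR.
    by apply: le_trans ler01; rewrite oppr_le0 sqr_ge0.
  by rewrite lee_fin ler_wpM2l // lerDl.
apply: le_trans (line 1 p2 _ P20 _ t) _; rewrite ?lexx ?ler01 //.
  move=> k t'; apply: le_trans (line1_coef _ _ _ _ k t') _; rewrite ler_wpM2r ?powR_ge0 // ler_expR.
  by rewrite gerBl sqr_ge0.
by rewrite lee_fin ler_wpM2l // lerDr.
Qed.

(** * An analytic family through a given function *)

Section UpperBound.
Variables (R : realType) (G : weighted_graph R).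
Implicit Types (x y : G) (f : G -> R[i]^o) (D : G -> R).

Lemma maximal_set_mono q D (l l' : R) x : 0 <= q -> 0 <= l -> l <= l' ->
  maximal_set q D l' x -> maximal_set q D l x.
Proof.
move=> q0 l0 ll [r r0 Hr]; exists r => //; apply: le_lt_trans Hr.
rewrite lee_wpmul2r ?massS_ge0 // lee_fin; apply: ge0_ler_powR; rewrite ?nnegrE //.
exact: le_trans ll.
Qed.

Lemma pow2_ge (M a : R) : 0 < a -> exists n0 : nat, forall n, (n0 <= n)%N -> M <= 2 `^ (n%:R * a).
Proof.
move=> a0; have c0 : 0 < a * ln 2 by rewrite mulr_gt0 ?ln2_gt0.
have M0 : 0 <= `|M| / (a * ln 2) by rewrite divr_ge0 // ltW.
exists (Num.bound (`|M| / (a * ln 2))) => n hn.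
rewrite pow2E; apply: le_trans (ler_norm M) _; apply: le_trans (expR_ge1Dx _).
apply: (@le_trans _ _ (n%:R * a * ln 2)); last by rewrite lerDr.
rewrite -mulrA -ler_pdivrMr //; apply: le_trans (ltW (archi_boundP M0)) _.
by rewrite ler_nat.
Qed.

(** The partial sums run over [- n <= k < n], so they collapse to [g n - g (- n)]. *)
Lemma zlim_telescope (g : int -> R[i]) (v : R[i]) :
  (forall e : R, 0 < e -> exists n0 : nat, forall n, (n0 <= n)%N ->
     normc (g (Posz n) - v) <= e /\ normc (g (- Posz n)) <= e) ->
  zlim (fun k => g (k + 1) - g k) v.
Proof.
move=> H e e0; have e2 : 0 < e / 2 by rewrite divr_gt0.
have [n0 Hn] := H _ e2; exists n0 => n /Hn[h1 h2].
have -> : zpsum (fun k => g (k + 1) - g k) n = g (Posz n) - g (- Posz n).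
  rewrite zpsumE; elim: n {h1 h2} => [|n IH]; first by rewrite big_geq // oppr0 subrr.
  rewrite big_nat_recr //= IH.
  have -> : Posz n + 1 = Posz n.+1 by rewrite -addn1 PoszD.
  have -> : Negz n + 1 = - Posz n by rewrite NegzE -addn1 PoszD opprD addrNK.
  by rewrite NegzE; ring.
rewrite addrAC; apply: le_trans (cnormB _ _) _.
by rewrite [leRHS]splitr lerD.
Qed.

(** The levels are [tau * 2^k], with [tau] a bound for the norm of [f]: the energy is then an
    absolute constant, and the estimate is linear in [tau]. Taking any [tau > 0] above the norm
    includes [f = 0]. *)
Theorem calderon_upper (q p1 p p2 al : R) : doubling G -> 1 <= q -> poincare G q ->
  q < p -> 1 <= p1 -> p1 < p -> p < p2 ->
  (p / p1 - 1) + ((p / p2 - 1) - (p / p1 - 1)) * al = 0 ->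
  exists2 K : R, 0 < K & forall f (tau : R), 0 < tau -> (sobolev_norm p f <= tau%:E)%E ->
  exists F, [/\ calderon (sobolev_norm p1) (sobolev_norm p2) F, F (al%:C)%C = f &
    (calderon_norm (sobolev_norm p1) (sobolev_norm p2) F <= (K * tau)%:E)%E].
Proof.
move=> hD q1 HP qp p11 p1p pp2 al0.
have q0 := lt_le_trans ltr01 q1; have p0 := lt_trans q0 qp.
have P10 := lt_le_trans ltr01 p11; have P20 := lt_trans p0 pp2.
have p21 : 1 <= p2 := le_trans p11 (ltW (lt_trans p1p pp2)).
have s10 : p / p2 - 1 <= p / p1 - 1.
  by rewrite lerD2r ler_pM2l // lef_pV2 ?posrE // ltW // (lt_trans p1p).
have [C C1 HC] := lipschitz_truncation hD q1 HP; have C0 := lt_le_trans ltr01 C1.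
have [E E0 HE] := level_sets_sum hD q1 qp.
have [N N1 HN] := coef_series_norm G; have N0 := lt_le_trans ltr01 N1.
(* The factor 2 comes from bounding [D ^ p] by the sum of the [p]-th powers of [|f|] and of the
   gradient; the powers of [tau] cancel in [HT]. *)
pose T := E * 2; have T0 : 0 < T by rewrite mulr_gt0.
pose Q := dyad_const (p / p1) * T `^ p1^-1 + dyad_const (p / p2) * T `^ p2^-1.
have Q0 : 0 < Q by rewrite addr_gt0 // mulr_gt0 ?powR_gt0 // dyad_const_gt0 // divr_gt0.
exists (N * (3 * C) * expR 1 * Q) => [|f tau tau0 Hf]; first by rewrite !mulr_gt0 ?expR_gt0.
pose D x := Num.max (normc (f x)) (grad f x).
have D0 x : 0 <= D x by rewrite le_max cnorm_ge0.
have Df x : normc (f x) <= D x by rewrite le_max lexx.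
have Dg x : grad f x <= D x by rewrite le_max lexx orbT.
pose l (k : int) : R := tau * 2 `^ k%:~R.
have l0 k : 0 < l k by rewrite mulr_gt0 ?powR_gt0.
have lS k : l (k + 1) = 2 * l k.
  by rewrite /l intrD powRD ?pnatr_eq0 ?implybT // powRr1 //; ring.
have [g Hg] : {g : int -> G -> R[i]^o & forall k,
    [/\ forall x, ~ maximal_set q D (l k) x -> g k x = f x, forall x, normc (g k x) <= C * l k &
     forall x y, normc (g k x - g k y) <= C * l k * gdist x y]}.
  apply: (@choice _ _ (fun k g => [/\ forall x, ~ maximal_set q D (l k) x -> g x = f x,
     forall x, normc (g x) <= C * l k & forall x y, normc (g x - g y) <= C * l k * gdist x y])) => k.
  by have [g Hg] := HC f D (l k) Dg Df (l0 k); exists g.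
pose Om k := level_set q D (l k).
pose u (k : int) x : R[i] := g (k + 1) x - g k x.
(* A vertex off the [k]-th maximal set is also off the next one, so both truncations equal [f]
   there. *)
have off k x : ~ maximal_set q D (l k) x -> u k x = 0.
  move=> xk; rewrite /u; have [g1 _ _] := Hg k; have [g2 _ _] := Hg (k + 1).
  have lle : l k <= l (k + 1) by rewrite lS ler_peMl ?(ltW (l0 k)) ?ler1n.
  rewrite (g1 _ xk) (g2 x); first exact: subrr.
  by move=> h; apply: xk; exact: maximal_set_mono (ltW q0) (ltW (l0 k)) lle h.
(* The two truncations contribute [C * l (k + 1) + C * l k], that is [3 * C * l k]. *)
have Had : adapted u Om p (3 * C * tau).
  split => //; first by rewrite !mulr_gt0.
    move=> k x; have -> : 3 * C * tau * (2 `^ k%:~R * on_level Om k x) = 3 * C * l k * on_level Om k x.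
      by rewrite /l; ring.
    rewrite /on_level; case: ifPn => xk; last first.
      rewrite off ?cnorm0 ?mulr0 // => h; move: xk; rewrite notin_setE; apply.
      by exists x => //; exact: adj_refl.
    rewrite mulr1; apply: le_trans (cnormB _ _) _.
    have [_ h1 _] := Hg k; have [_ h2 _] := Hg (k + 1).
    have := h1 x; have := h2 x; rewrite lS; lra.
  move=> k x y xy.
  have -> : hmax x * (3 * C * tau * (2 `^ k%:~R * on_level Om k x)) = 3 * C * l k * hmax x * on_level Om k x.
    by rewrite /l; ring.
  rewrite /on_level; case: ifPn => xk; last first.
    rewrite notin_setE in xk; rewrite !off ?subrr ?cnorm0 ?mulr0 // => h; apply: xk.
      by exists x => //; exact: adj_refl.
    by exists y.
  have [_ _ h1] := Hg k; have [_ _ h2] := Hg (k + 1).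
  rewrite mulr1 /u.
  have -> : g (k + 1) y - g k y - (g (k + 1) x - g k x) =
     (g (k + 1) y - g (k + 1) x) - (g k y - g k x) by ring.
  apply: le_trans (cnormB _ _) _; apply: le_trans (lerD (h2 _ _) (h1 _ _)) _.
  rewrite lS -mulrDl.
  have -> : C * (2 * l k) + C * l k = 3 * C * l k by ring.
  have cl : 0 <= 3 * C * l k by apply: mulr_ge0 (ltW (l0 k)); exact: mulr_ge0 _ (ltW C0).
  apply: (ler_wpM2l cl); rewrite gdist_sym.
  exact: le_trans (gdist_adj xy) (wgh_le_hmax xy).
have HT : (total_energy Om p [set: int] <= T%:E)%E.
  apply: le_trans (HE D tau D0 tau0) _.
  have S2 : (\esum_(x in [set: G]) (D x `^ p * mass x)%:E <= (2 * tau `^ p)%:E)%E.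
    have nn (h : G -> R) x : (0 <= (`|h x| `^ p * mass x)%:E)%E.
      by rewrite lee_fin mulr_ge0 ?powR_ge0 ?mass_ge0.
    apply: (@le_trans _ _ (\esum_(x in [set: G]) ((`|normc (f x)| `^ p * mass x)%:E + (`|grad f x| `^ p * mass x)%:E))%E).
      apply: le_esum => x _; rewrite -EFinD lee_fin -mulrDl ler_wpM2r ?mass_ge0 //.
      rewrite !ger0_norm ?cnorm_ge0 ?grad_ge0 // /D /Num.max.
      by case: ifP => _; rewrite ?lerDl ?lerDr powR_ge0.
    rewrite esumD => [|x _|x _]; [|exact: nn (fun x => normc (f x)) x|exact: nn].
    rewrite mulr2n mulrDl mul1r EFinD; apply: leeD; apply: Lp_norm_le_inv; rewrite ?(ltW tau0) //.
      by apply: le_trans Hf; rewrite leeDl ?Lp_norm_ge0.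
    by apply: le_trans Hf; rewrite leeDr ?Lp_norm_ge0.
  apply: le_trans (lee_wpmul2l _ S2) _; first by rewrite lee_fin divr_ge0 ?powR_ge0 ?(ltW E0).
  rewrite -EFinM lee_fin /T le_eqVlt; apply/orP; left; apply/eqP.
  by field; rewrite gt_eqF ?powR_gt0.
exists (coef_series u p p1 p2 al); split.
- exact: coef_series_calderon Had p11 p21 (ltW T0) HT s10.
- apply/funext => x; apply: zsum_eq.
  have -> : (fun k => coef (p / p1 - 1) (p / p2 - 1) al k (al%:C)%C * u k x) = (fun k => g (k + 1) x - g k x).
    apply/funext => k; rewrite -[RHS]mul1r; congr (_ * _).
    rewrite /coef; have -> : exponent (p / p1 - 1) (p / p2 - 1) al k (al%:C)%C = 0.
      rewrite /exponent -!rmorphM -!rmorphD /= (_ : _ + _ = 0) //.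
      transitivity (k%:~R * ln 2 * ((p / p1 - 1) + ((p / p2 - 1) - (p / p1 - 1)) * al)); first by ring.
      by rewrite al0 mulr0.
    exact: cexp0.
  (* For large [n] the vertex [x] leaves the maximal sets, since otherwise [2 ^ (n p) * mass x]
     would exceed the energy, and [g n x] is [f x]. At the other end [g (- n) x] is at most
     [C * tau * 2 ^ (- n)]. The choices of [n1] and [n2] express this. *)
  apply: (zlim_telescope (g := fun k => g k x)) => e e0.
  have [n1 H1] := pow2_ge (T / mass x + 1) p0.
  have [n2 H2] := pow2_ge (C * tau / e) (ltr01 : 0 < (1 : R)).
  exists (maxn n1 n2) => n; rewrite geq_max => /andP[/H1 h1 /H2 h2]; split.
    have [g1 _ _] := Hg (Posz n); rewrite (g1 x); first by rewrite subrr cnorm0 ltW.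
    move=> hx; suff : (((2 `^ (n%:R * p))%:E * (mass x)%:E) <= T%:E)%E.
      rewrite -EFinM lee_fin -ler_pdivlMr ?mass_gt0 // => h3.
      by have := le_trans h1 h3; rewrite gerDl ler10.
    apply: le_trans HT; apply: (@le_trans _ _ ((2 `^ ((Posz n)%:~R * p))%:E * massS (Om (Posz n)))%E).
      rewrite lee_wpmul2l ?lee_fin ?powR_ge0 // -massS1; apply: massS_subset => _ ->.
      by exists x => //; exact: adj_refl.
    rewrite (_ : ((2 `^ ((Posz n)%:~R * p))%:E * massS (Om (Posz n)) =
      \sum_(k <- [:: Posz n]) ((2 `^ (k%:~R * p))%:E * massS (Om k)))%E); last by rewrite big_seq1.
    exact: le_esum_uniq.
  have [_ h3 _] := Hg (- Posz n); apply: le_trans (h3 x) _.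
  rewrite /l mulrA intrN powRN -ler_pdivlMr ?invr_gt0 ?powR_gt0 // invrK.
  by move: h2; rewrite mulr1 ler_pdivrMr // [leRHS]mulrC.
apply: le_trans (HN u Om p (3 * C * tau) T p1 p2 al Had p11 p21 (ltW T0) HT s10) _.
rewrite lee_fin -/Q le_eqVlt; apply/orP; left; apply/eqP; ring.
Qed.

End UpperBound.

(** * Three lines in Sobolev spaces *)

Section LowerBound.
Variables (R : realType) (G : weighted_graph R).
Implicit Types (x y : G) (v : G -> R[i]^o).

Local Notation W := (@sobolev_norm R G).

Lemma diff_le_grad v x y : adj (@wgh R G) x y -> normc (v y - v x) <= hmax x * grad v x.
Proof.
move=> xy; rewrite /grad mulrA divff ?gt_eqF ?hmax_gt0 // mul1r sum_nbrs.
rewrite -[leLHS]ger0_norm ?cnorm_ge0 // -sqrtr_sqr ler_wsqrtr //.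
by rewrite (big_rem y) ?mem_nb //= lerDl sumr_ge0 // => z _; exact: sqr_ge0.
Qed.

Lemma eval_le P v x (e : R) : 0 < P -> 0 <= e -> (W P v <= e%:E)%E ->
  normc (v x) <= (mass x)^-1 `^ P^-1 * e.
Proof.
move=> P0 e0 H.
have H1 : (Lp_norm P (fun x => normc (v x)) <= e%:E)%E.
  by apply: le_trans H; rewrite leeDl ?Lp_norm_ge0.
apply: (ler_powR_inv P0); rewrite ?cnorm_ge0 ?mulr_ge0 ?powR_ge0 //.
rewrite powRM ?powR_ge0 // -powRrM mulVf ?gt_eqF // powRr1 ?invr_ge0 ?mass_ge0 //.
rewrite mulrC ler_pdivlMr ?mass_gt0 // -lee_fin; apply: le_trans (Lp_norm_le_inv P0 e0 H1).
have := @le_esum_uniq R G setT (fun x => (`|normc (v x)| `^ P * mass x)%:E) [:: x].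
by rewrite big_seq1 ger0_norm ?cnorm_ge0 //; apply.
Qed.

(** Vertices are atoms, so evaluation is continuous on both spaces and on their sum. This turns the
    vector-valued [F] into scalar functions that are continuous on the strip and analytic inside.
    The factor 2 is there because the infimum in [sum_norm] may not be attained. *)
Lemma sum_norm_eval P1 P2 x : 0 < P1 -> 0 < P2 -> exists2 C : R, 0 < C &
  forall v (e : R), 0 < e -> (sum_norm (W P1) (W P2) v <= e%:E)%E -> normc (v x) <= C * e.
Proof.
move=> P10 P20; pose C P := (mass x)^-1 `^ P^-1.
have C0 P : 0 < C P by rewrite powR_gt0 // invr_gt0 mass_gt0.
exists (2 * (C P1 + C P2)) => [|v e e0 H]; first by rewrite mulr_gt0 ?addr_gt0.
have /ereal_inf_lt[_ [[v1 v2] /= <- <-] h] : (sum_norm (W P1) (W P2) v < (2 * e)%:E)%E.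
  by apply: le_lt_trans H _; rewrite lte_fin; move: e0; clear; lra.
have e2 : 0 <= 2 * e by rewrite mulr_ge0 ?(ltW e0).
have h1 : (W P1 v1 <= (2 * e)%:E)%E by apply: le_trans (ltW h); rewrite leeDl ?sobolev_norm_ge0.
have h2 : (W P2 v2 <= (2 * e)%:E)%E by apply: le_trans (ltW h); rewrite leeDr ?sobolev_norm_ge0.
apply: le_trans (cnormD (v1 x) (v2 x)) _.
have -> : 2 * (C P1 + C P2) * e = C P1 * (2 * e) + C P2 * (2 * e) by ring.
by apply: lerD; apply: eval_le.
Qed.

Section Evaluation.
Variables (p1 p2 : R) (F : R[i]^o -> G -> R[i]^o).
Hypotheses (P10 : 0 < p1) (P20 : 0 < p2) (HF : calderon (W p1) (W p2) F).

Lemma calderon_eval_bounded x : strip_bounded (fun z => F z x).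
Proof.
have [C C0 H] := sum_norm_eval x P10 P20; have [M HM] := cald_bounded HF.
exists (C * Num.max M 1) => z sz; apply: H; first by rewrite lt_max ltr01 orbT.
by apply: le_trans (HM z sz) _; rewrite lee_fin le_max lexx.
Qed.

Lemma calderon_eval_cont x (z : R[i]^o) : cstrip z -> ccont (@cstrip R) (fun z => F z x) z.
Proof.
move=> sz e e0; have [C C0 H] := sum_norm_eval x P10 P20.
have e1 : 0 < e / C by rewrite divr_gt0.
have := ecvg0_near (within_filter _ (nbhs_filter z)) (cald_continuous HF sz) e1.
rewrite near_withinE => /normc_near[d d0 Hd]; exists d => // w sw wz.
by have := H _ _ e1 (Hd w wz sw); rewrite mulrC divfK // gt_eqF.
Qed.

Lemma calderon_eval_diff x (z : R[i]^o) : 0 < complex.Re z < 1 -> cdiff (fun z => F z x) z.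
Proof.
move=> sz; have [C C0 H] := sum_norm_eval x P10 P20.
have [L _ HL] := cald_analytic HF sz.
exists (fun w => if w == z then L x else (F w x - F z x) / (w - z)).
  move=> e e0; have e1 : 0 < e / C by rewrite divr_gt0.
  have := ecvg0_near (within_filter _ (nbhs_filter z)) HL e1.
  rewrite /dnbhs near_withinE => /normc_near[d d0 Hd]; exists d => // w _ wz.
  rewrite eqxx; case: eqVneq => [_|wz']; first by rewrite subrr cnorm0 ltW.
  by have := H _ _ e1 (Hd w wz wz'); rewrite mulrC divfK ?gt_eqF // /= mulrC.
move=> w; case: eqVneq => [->|wz]; first by rewrite !subrr mulr0.
by rewrite divfK // subr_eq0.
Qed.

End Evaluation.

Lemma esum_three_lines (p1 p p2 al M : R) (F : R[i]^o -> G -> R[i]^o) : 1 < p1 -> p1 < p2 -> 0 < p -> 0 < al < 1 ->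
  p^-1 = (1 - al) / p1 + al / p2 -> 0 < M -> calderon (W p1) (W p2) F ->
  (forall t : R, (W p1 (F (Complex 0 t)%R) <= M%:E)%E) ->
  (forall t : R, (W p2 (F (Complex 1 t)%R) <= M%:E)%E) ->
  (Lp_norm p (fun x => normc (F (al%:C)%C x)) <= M%:E)%E.
Proof.
move=> p11 p12 p0 a01 E M0 HF H1 H2; have p10 := lt_trans ltr01 p11; have p20 := lt_trans p10 p12.
apply: Lp_norm_le => //; first exact: ltW.
have line (P : R) v s : 0 < P -> (W P v <= M%:E)%E -> uniq s ->
    \sum_(x <- s) normc (v x) `^ P * mass x <= M `^ P.
  move=> P0 HW us; have HL : (Lp_norm P (fun x => normc (v x)) <= M%:E)%E.
    by apply: le_trans HW; rewrite leeDl ?Lp_norm_ge0.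
  rewrite -lee_fin -sumEFin; apply: le_trans (Lp_norm_le_inv P0 (ltW M0) HL).
  have := @le_esum_uniq R G setT (fun x => (`|normc (v x)| `^ P * mass x)%:E) s us (fun _ _ => I).
  by under eq_bigr do rewrite ger0_norm ?cnorm_ge0 //.
apply: esum_le_uniq => s us _; rewrite sumEFin lee_fin.
under eq_bigr do rewrite ger0_norm ?cnorm_ge0 //.
apply: (finite_three_lines (a := fun x z => F z x) p11 p12 p0 a01 E M0) => //.
- by move=> x; exact: mass_ge0.
- by move=> x; exact: (calderon_eval_bounded p10 p20 HF).
- by move=> x z; exact: (calderon_eval_cont p10 p20 HF).
- by move=> x z; exact: (calderon_eval_diff p10 p20 HF).
- by move=> t; exact: line.
- by move=> t; exact: line.
Qed.

(** The family is indexed by the pairs of a vertex and a neighbour, with the mass of the vertex as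
    weight. Its [l^P] norm and that of the gradient are comparable, since the number of neighbours
    is at most [N]; hence the factor [N] on the boundary lines and [N'] on the way back. *)
Lemma grad_three_lines : exists2 K : R, 1 <= K & forall (p1 p p2 al M : R) (F : R[i]^o -> G -> R[i]^o),
  1 < p1 -> p1 < p2 -> 0 < p -> 0 < al < 1 ->
  p^-1 = (1 - al) / p1 + al / p2 -> 0 < M -> calderon (W p1) (W p2) F ->
  (forall t : R, (W p1 (F (Complex 0 t)%R) <= M%:E)%E) ->
  (forall t : R, (W p2 (F (Complex 1 t)%R) <= M%:E)%E) ->
  (Lp_norm p (grad (F (al%:C)%C)) <= (K * M)%:E)%E.
Proof.
have [N [N0 HN]] := nb_size G; have [N' N'1 HN'] := grad_le G.
have N1 : (1 : R) <= N%:R by rewrite ler1n.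
have N'0 := lt_le_trans ltr01 N'1.
exists (N' * N%:R) => [|p1 p p2 al M F p11 p12 p0 a01 E M0 HF H1 H2].
  by rewrite -[leLHS]mulr1 ler_pM.
have p10 := lt_trans ltr01 p11; have p20 := lt_trans p10 p12.
have NM : 0 < N%:R * M by rewrite mulr_gt0 // ltr0n.
have K0 : 0 <= N' * N%:R * M by rewrite -mulrA mulr_ge0 ?(ltW NM) ?(ltW N'0).
apply: Lp_norm_le => //.
pose a (xy : G * G) z : R[i] := (F z xy.2 + (- 1) * F z xy.1) * (((hmax xy.1)^-1)%:C)%C.
have aE x y z : adj (@wgh R G) x y ->
    normc (a (x, y) z) = normc (F z y - F z x) / hmax x.
  move=> xy; rewrite /a /= cnormM cnorm_real mulN1r ger0_norm // invr_ge0 ltW //.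
  exact: hmax_gt0.
have line (P : R) (z : R[i]) s : 1 <= P -> (W P (F z) <= M%:E)%E -> uniq s ->
    \sum_(xy <- [seq (x, y) | x <- s, y <- nb x]) normc (a xy z) `^ P * mass xy.1 <= (N%:R * M) `^ P.
  move=> P1 HW us; have P0 := lt_le_trans ltr01 P1.
  have HL : (Lp_norm P (grad (F z)) <= M%:E)%E.
    by apply: le_trans HW; rewrite leeDr ?Lp_norm_ge0.
  rewrite big_allpairs_dep /=.
  apply: (@le_trans _ _ (\sum_(x <- s) N%:R * (grad (F z) x `^ P * mass x))).
    apply: ler_sum => x _.
    apply: (@le_trans _ _ (\sum_(y <- nb x) grad (F z) x `^ P * mass x)).
      rewrite big_seq [leRHS]big_seq; apply: ler_sum => y; rewrite mem_nb => xy.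
      rewrite ler_wpM2r ?mass_ge0 //; apply: ge0_ler_powR; rewrite ?nnegrE ?cnorm_ge0 ?grad_ge0 ?(ltW P0) //.
      by rewrite (aE x y z xy) ler_pdivrMr ?hmax_gt0 // mulrC diff_le_grad.
    rewrite big_const_seq count_predT iter_addr_0 -[leLHS]mulr_natl.
    by rewrite ler_wpM2r ?ler_nat // mulr_ge0 ?powR_ge0 ?mass_ge0.
  rewrite -mulr_sumr powRM ?(ltW M0) //; apply: ler_pM => //.
  + by apply: sumr_ge0 => x _; rewrite mulr_ge0 ?powR_ge0 ?mass_ge0.
  + exact: le_powR_self.
  + rewrite -lee_fin -sumEFin; apply: le_trans (Lp_norm_le_inv P0 (ltW M0) HL).
    have := @le_esum_uniq R G setT (fun x => (`|grad (F z) x| `^ P * mass x)%:E) s us (fun _ _ => I).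
    by under eq_bigr do rewrite ger0_norm ?grad_ge0 //.
apply: esum_le_uniq => s us _; rewrite sumEFin lee_fin.
have key : \sum_(xy <- [seq (x, y) | x <- s, y <- nb x]) normc (a xy (al%:C)%C) `^ p * mass xy.1 <= (N%:R * M) `^ p.
  apply: (finite_three_lines p11 p12 p0 a01 E NM) => [xy|xy|xy z sz|xy z sz|t|t].
  - exact: mass_ge0.
  - apply: strip_boundedM; last by exists (normc (((hmax xy.1)^-1)%:C)%C).
    have [B1 HB1] := calderon_eval_bounded p10 p20 HF xy.1.
    have [B2 HB2] := calderon_eval_bounded p10 p20 HF xy.2.
    exists (B2 + B1) => z sz; rewrite mulN1r; apply: le_trans (cnormB _ _) _.
    by rewrite lerD ?HB1 ?HB2.
  - apply: ccontM; last exact: ccont_cst.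
    apply: ccontD; first exact: (calderon_eval_cont p10 p20 HF).
    by apply: ccontM; [exact: ccont_cst | exact: (calderon_eval_cont p10 p20 HF)].
  - apply: cdiffM; last exact: cdiff_cst.
    apply: cdiffD; first exact: (calderon_eval_diff p10 p20 HF).
    by apply: cdiffM; [exact: cdiff_cst | exact: (calderon_eval_diff p10 p20 HF)].
  - by apply: line; rewrite ?(ltW p11).
  - by apply: line; rewrite ?(ltW (lt_trans p11 p12)).
have -> : N' * N%:R * M = N' * (N%:R * M) by rewrite mulrA.
rewrite powRM ?(ltW NM) ?(ltW N'0) //.
apply: le_trans (ler_wpM2l (powR_ge0 _ _) key).
rewrite big_allpairs_dep /= mulr_sumr; apply: ler_sum => x _.
rewrite ger0_norm ?grad_ge0 // -mulr_suml mulrA ler_wpM2r ?mass_ge0 //.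
set S := \sum_(y <- nb x) _.
have S0 : 0 <= S by apply: sumr_ge0 => y _; exact: powR_ge0.
have -> : S = (S `^ p^-1) `^ p by rewrite -powRrM mulVf ?gt_eqF // powRr1.
rewrite -powRM ?powR_ge0 ?(ltW N'0) //.
apply: ge0_ler_powR; rewrite ?nnegrE ?grad_ge0 ?(ltW p0) ?mulr_ge0 ?powR_ge0 ?(ltW N'0) //.
(* Each difference quotient at [x] is at most the [l^p] norm [S ^ (1/p)] of all of them. *)
apply: HN' => [|y xy]; first exact: powR_ge0.
rewrite -ler_pdivrMl ?hmax_gt0 // mulrC -(aE x y _ xy).
apply: (ler_powR_inv p0); rewrite ?cnorm_ge0 ?powR_ge0 //.
rewrite -powRrM mulVf ?gt_eqF // powRr1 // /S (big_rem y) ?mem_nb //= lerDl.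
by apply: sumr_ge0 => z _; exact: powR_ge0.
Qed.

Theorem calderon_lower : exists2 K : R, 0 < K & forall (p1 p p2 al M : R) (F : R[i]^o -> G -> R[i]^o),
  1 < p1 -> p1 < p2 -> 0 < p -> 0 < al < 1 ->
  p^-1 = (1 - al) / p1 + al / p2 -> 0 < M -> calderon (W p1) (W p2) F ->
  (forall t : R, (W p1 (F (Complex 0 t)%R) <= M%:E)%E) ->
  (forall t : R, (W p2 (F (Complex 1 t)%R) <= M%:E)%E) ->
  (W p (F (al%:C)%C) <= (K * M)%:E)%E.
Proof.
have [K K1 HK] := grad_three_lines; exists (1 + K) => [|p1 p p2 al M F p11 p12 p0 a01 E M0 HF H1 H2].
  by rewrite addr_gt0 // (lt_le_trans _ K1).
rewrite /sobolev_norm mulrDl mul1r EFinD; apply: leeD.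
  exact: (esum_three_lines p11 p12).
exact: (HK p1 p p2).
Qed.

(** Decay at both ends leaves a segment, on which local bounds are made uniform by compactness. This
    supplies the number [M] of the three lines theorem for every element of Calderon's space. *)
Lemma continuous_vanishing_bounded P (g : R -> G -> R[i]^o) : 1 <= P ->
  continuous_vanishing (W P) g -> exists2 M : R, 0 < M & forall t, (W P (g t) <= M%:E)%E.
Proof.
move=> P1 [fin cont pinf ninf].
have [a [_ Ha]] := @ecvg0_near R _ _ _ _ _ pinf ltr01.
have [b [_ Hb]] := @ecvg0_near R _ _ _ _ _ ninf ltr01.
have /compact_near_coveringP cpt := @segment_compact R b a.
have : \forall n \near \oo, forall t, `[b, a]%classic t -> (W P (g t) <= n%:R%:E)%E.
  apply: (cpt nat \oo (fun n t => (W P (g t) <= n%:R%:E)%E)) => t _.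
  have [m Hm] : exists m : R, 0 <= m /\ (W P (g t) <= m%:E)%E.
    exists (fine (W P (g t))); rewrite fine_ge0 ?sobolev_norm_ge0 // fineK //.
    by rewrite ge0_fin_numE ?sobolev_norm_ge0 //; exact: fin.
  have [m0 hm] := Hm.
  have cn := @ecvg0_near R _ _ _ _ _ (cont t) ltr01.
  (* The norm of [g s] is estimated through [g s - g t] and [g t] by the quasi-triangle inequality,
     hence [16 * (1 + m)]. *)
  exists ([set s | (W P (g s - g t)%R <= 1%:E)%E], [set n : nat | 16 * (1 + m) <= n%:R]) => /=.
    split; first exact: cn.
    exact: nbhs_infty_ger.
  move=> [s n] /= [h1 h2].
  have := sobolev_norm_quasi_triangle P1 ler01 m0 h1 hm.
  by rewrite subrK => h; apply: le_trans h _; rewrite lee_fin.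
move=> [n _ /(_ n (leqnn n)) /= Hn].
exists (n%:R + 1) => [|t]; first by rewrite ltr_wpDl.
have [ta|ta] := ltP a t.
  by apply: le_trans (Ha _ ta) _; rewrite lee_fin lerDr.
have [tb|tb] := ltP t b.
  by apply: le_trans (Hb _ tb) _; rewrite lee_fin lerDr.
apply: (@le_trans _ _ (n%:R%:E)); last by rewrite lee_fin lerDl.
by apply: Hn; rewrite /= in_itv /= tb ta.
Qed.

End LowerBound.

(** * Identification of the interpolation space, with equivalence of norms *)

Theorem corollary3p5 (R : realType) (G : weighted_graph R)
    (hD : doubling G)
    (hP : exists2 q : R, 1 <= q & poincare G q)
    (p1 p p2 alpha : R)
    (hp1 : poincare_threshold G < p1) (hp1p : p1 < p) (hpp2 : p < p2)
    (halpha : alpha = (p1^-1 - p^-1) / (p1^-1 - p2^-1)) :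
  let W := fun s : R => @sobolev_norm R G s in
  alpha = p2 * (p - p1) / (p * (p2 - p1)) /\
  interp_space (W p1) (W p2) alpha = normed_space (W p) /\
  exists c C : R, [/\ 0 < c, 0 < C &
    forall f, normed_space (W p) f ->
      ((c%:E * W p f <= interp_norm (W p1) (W p2) alpha f)%E /\
       (interp_norm (W p1) (W p2) alpha f <= C%:E * W p f)%E)].
Proof.
move=> W.
(* [p1] lies strictly above the infimum, so some admissible exponent [q] lies below [p1]; as
   [q >= 1], this also gives [1 < p1]. *)
have [q [q1 HP] qp1] : exists2 q : R, 1 <= q /\ poincare G q & q < p1.
  have [q0 q01 HP0] := hP.
  have hi : has_inf [set q | 1 <= q /\ poincare G q].
    by split; [exists q0 | exists 1 => q []].
  have e0 : 0 < p1 - poincare_threshold G by rewrite subr_gt0.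
  by have [q Hq] := inf_adherent e0 hi; rewrite addrC subrK; exists q.
have p11 := le_lt_trans q1 qp1.
have p10 := lt_trans ltr01 p11; have p0 := lt_trans p10 hp1p; have p20 := lt_trans p0 hpp2.
have p12 := lt_trans hp1p hpp2.
have [n1 n n2] : [/\ p1 != 0, p != 0 & p2 != 0] by split; rewrite gt_eqF.
have n12 : p2 - p1 != 0 by rewrite subr_eq0 gt_eqF.
have alE : alpha = p2 * (p - p1) / (p * (p2 - p1)).
  by rewrite halpha; field; rewrite n1 n n2 n12.
have al01 : 0 < alpha < 1.
  rewrite alE; apply/andP; split; first by rewrite divr_gt0 ?mulr_gt0 ?subr_gt0.
  rewrite ltr_pdivrMr ?mulr_gt0 ?subr_gt0 // mul1r -subr_gt0.
  have -> : p * (p2 - p1) - p2 * (p - p1) = p1 * (p2 - p) by ring.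
  by rewrite mulr_gt0 ?subr_gt0.
have E : p^-1 = (1 - alpha) / p1 + alpha / p2 by rewrite alE; field; rewrite n1 n n2 n12.
have E' : (p / p1 - 1) + ((p / p2 - 1) - (p / p1 - 1)) * alpha = 0.
  by rewrite alE; field; rewrite n1 n n2 n12.
have [K K0 HK] := calderon_upper hD q1 HP (lt_trans qp1 hp1p) (ltW p11) hp1p hpp2 E'.
have [L L0 HL] := calderon_lower G.
have fin f : normed_space (W p) f -> W p f = (fine (W p f))%:E.
  by move=> Hf; rewrite fineK // ge0_fin_numE ?sobolev_norm_ge0.
have fin0 f : 0 <= fine (W p f) by rewrite fine_ge0 ?sobolev_norm_ge0.
split=> //; split.
  rewrite eqEsubset; split=> [_ [F HF <-] | f Hf].
    have [M1 M10 HM1] := continuous_vanishing_bounded (ltW p11) (cald_left HF).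
    have [M2 _ HM2] := continuous_vanishing_bounded (le_trans (ltW p11) (ltW p12)) (cald_right HF).
    apply: le_lt_trans (ltry (L * Num.max M1 M2)).
    (* The boundary bounds come from compactness, and the three lines estimate makes the value at
       [alpha] finite in W^{1,p}. *)
    apply: (HL p1 p p2 alpha (Num.max M1 M2) F p11 p12 p0 al01 E) => [||t|t] //.
    - by rewrite lt_max M10.
    - by apply: le_trans (HM1 t) _; rewrite lee_fin le_max lexx.
    - by apply: le_trans (HM2 t) _; rewrite lee_fin le_max lexx orbT.
  have [||F [HF Ff _]] := HK f (fine (W p f) + 1); last by exists F.
    by rewrite ltr_wpDl.
  by rewrite [leLHS](fin f Hf) lee_fin lerDl.
exists L^-1, K; split=> [||f Hf] //; first by rewrite invr_gt0.
split.
  apply: le_ereal_inf_tmp => _ [F [HF Ff] <-].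
  have H1 t : (W p1 (F (Complex 0 t)%R) <= calderon_norm (W p1) (W p2) F)%E.
    by rewrite le_max; apply/orP; left; apply: ereal_sup_ubound; exists t.
  have H2 t : (W p2 (F (Complex 1 t)%R) <= calderon_norm (W p1) (W p2) F)%E.
    by rewrite le_max; apply/orP; right; apply: ereal_sup_ubound; exists t.
  have c0 := le_trans (sobolev_norm_ge0 _ _) (H1 0).
  case: (calderon_norm _ _ F) H1 H2 c0 => [r| |] H1 H2 c0; last by [].
    rewrite (fin f Hf) -EFinM lee_fin ler_pdivrMl //.
    (* The three lines estimate requires a positive bound while the norm [r] of [F] may be 0; the
       slack [e / L] is removed in the limit. *)
    apply/ler_addgt0Pr => e e0; have eL : 0 < e / L by rewrite divr_gt0.
    have -> : L * r + e = L * (r + e / L) by rewrite mulrDr mulrCA divff ?mulr1 // gt_eqF.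
    rewrite -lee_fin -fin // -Ff.
    apply: (HL p1 p p2 alpha _ F p11 p12 p0 al01 E) => [||t|t] //.
    - by rewrite ltr_wpDl.
    - by apply: le_trans (H1 t) _; rewrite lee_fin lerDl ltW.
    - by apply: le_trans (H2 t) _; rewrite lee_fin lerDl ltW.
  exact: leey.
(* The same device for the upper bound, where [tau] has to be positive also when [f] has norm 0. *)
apply/lee_addgt0Pr => e e0; have eK : 0 < e / K by rewrite divr_gt0.
have [||F [HF Ff HF']] := HK f (fine (W p f) + e / K).
- by rewrite ltr_wpDl.
- by rewrite [leLHS](fin f Hf) lee_fin lerDl ltW.
apply: (@le_trans _ _ (calderon_norm (W p1) (W p2) F)).
  by apply: ereal_inf_lbound; exists F.
apply: le_trans HF' _; rewrite {2}(fin f Hf) -EFinM -EFinD lee_fin.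
by rewrite mulrDr mulrCA divff ?mulr1 // gt_eqF.
Qed.
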